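(* Let $B$ be an $\mathbb{R}^K$-valued fractional Brownian motion with Hurst index $H\in(\frac13,1)$ and rough path lift $\mathbf{B}$, let $\theta=(\theta_1,\dots,\theta_K)\in\mathbb{R}^K_+$, and let $y$ be a pathwise solution of $$\mathrm{d}y_t=u_t(y_t)\,\mathrm{d}t+\sum_{k=1}^K\theta_k\sigma_k(y_t)\,\mathrm{d}\mathbf{B}^k_t .$$ Let $\pi_n=\{iT2^{-n}\}_{i=0}^{2^n}$ be the dyadic partitions of $[0,T]$, let $\mathbb{F}=\{f_1,\dots,f_M\}\subset C^2(\mathbb{R}^d)$, and define $X,X_n\in\mathbb{R}^{M\times K}$, $Y,\bar Y_n\in\mathbb{R}^M$ by $$X^{mk}=\int_0^T\sigma_k[f_m]^2(y_r)\,\mathrm{d}r,\quad Y^m=\langle f_m(y)\rangle^{(1-2H)}_T,\quad X^{mk}_n=\sum_{[t_i,t_{i+1}]\in\pi_n}\sigma_k[f_m]^2(y_{t_i})(t_{i+1}-t_i),\quad \bar Y^m_n=\langle f_m(y)\rangle^{(1-2H_n),n}_T,$$ where $$H_n=\frac12\Big(1-\frac{\ln S_n}{\ln2}\Big),\qquad S_n=\frac{\langle\langle y\rangle\rangle^{(0),n+1}_T}{\langle\langle y\rangle\rangle^{(0),n}_T}.$$ Let $\beta=(\theta_k^2)_{1\le k\le K}$, $\bar\beta_n=\operatorname{arg\,min}_{b\in\mathbb{R}^K}|\bar Y_n-X_nb|$, and $\bar\theta_n=\sqrt{\bar\beta_n}$ (componentwise). Assume that $\mathbb{F}$ is such that the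 columns of $X$ are linearly independent and $Y\ne\mathbf{0}$. Then, for all $\epsilon\in(0,H)$, almost surely, $$|\beta-\bar\beta_n|=\mathcal{O}_{C_1}\big(n\,\delta_n^{H-\epsilon}\big),$$ where $\delta_n=2^{-n/2}\sqrt n$ if $H\le\frac12$, $\delta_n=2^{-n(1-H)}\sqrt n$ if $H>\frac12$, and $C_1=C_1(T,\kappa(X),\|B\|_{H-\epsilon},\|f(y)'\|_{H-\epsilon},[f(y)^\sharp]_{2(H-\epsilon)},[\sigma_k[f]^2(y)]_{H-\epsilon};\ f\in\mathbb{F},\,1\le k\le K)$. Moreover, for all $k$ such that $\beta_k>0$ and for all $\epsilon\in(0,H)$, almost surely, $$|\theta_k-\bar\theta_{n,k}|=\mathcal{O}_{C_1\vee\beta_k^{-1}}\big(n\,\delta_n^{H-\epsilon}\big).$$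
   Context: Scaled variation: with $\delta x_{st}=x_t-x_s$, for $\gamma\in\mathbb{R}$ and scalar $x$, $\langle x\rangle^{(\gamma),n}_t=\sum(t_{i+1}-t_i)^\gamma(\delta x_{t_it_{i+1}})^2$, the sum running over the intervals $[t_i,t_{i+1}]$ of $\pi_n$ contained in $[0,t]$, and $\langle x\rangle^{(\gamma)}_t=\lim_n\langle x\rangle^{(\gamma),n}_t$. For $\mathbb{R}^d$-valued $y$, $\langle\langle y\rangle\rangle^{(\gamma),n}=\sum_{i=1}^d\langle y^i\rangle^{(\gamma),n}$. Fractional Brownian motion with Hurst index $H$: centered Gaussian process $B$ with $\mathbb{E}(B_t\otimes B_s)=\frac12(t^{2H}+s^{2H}-|t-s|^{2H})I_{K\times K}$; a.s. $B\in C^\alpha$ for every $\alpha<H$. Rough path lift: $\Delta_T=\{(s,t)\in[0,T]^2:s\le t\}$; $C^\beta_2$ is the set of $f$ on $\Delta_T$ with $[f]_\beta=\sup_{s<t}|f_{st}|/|t-s|^\beta<\infty$. For $\alpha\in(\frac13,\frac12]$ an $\alpha$-Hölder rough path is $(z,\mathbb{Z})\in C^\alpha([0,T];\mathbb{R}^K)\times C^{2\alpha}_2([0,T];\mathbb{R}^{K\times K})$ with $\mathbb{Z}_{st}=\mathbb{Z}_{sr}+\delta z_{sr}\otimes\delta z_{rt}+\mathbb{Z}_{rt}$ for $s\le r\le t$. If $H\in(\frac13,\frac12]$, $\mathbf{B}=(B,\mathbb{B})$, where $\mathbb{B}$ is the a.s. limit in the rough path topology of $\int_s^t\int_s^{t_1}\mathrm{d}B^n_r\otimes\mathrm{d}B^n_{t_1}$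 with $B^n$ the piecewise linear interpolations of $B$ along dyadic partitions; a.s. $\mathbf{B}$ is an $\alpha$-Hölder rough path for every $\alpha\in(\frac13,H)$. If $H>\frac12$, $\mathbf{B}=B$. Pathwise solution: write $\tilde\sigma_k=\theta_k\sigma_k$. $u\in C([0,T]\times\mathbb{R}^d;\mathbb{R}^d)$, $\sigma=(\sigma_k)_{1\le k\le K}\in C^{\lfloor1/\alpha\rfloor}(\mathbb{R}^d;\mathbb{R}^{d\times K})$. A.s., for every $\alpha\in(\frac13,H)$ (every $\alpha\in(\frac12,H)$ if $H>\frac12$), $y\in C^\alpha([0,T];\mathbb{R}^d)$, $\delta y_{st}-\int_s^tu_r(y_r)\mathrm{d}r-\sum_k\tilde\sigma_k(y_s)\delta B^k_{st}$ belongs to $C^{2\alpha}_2$, and, if $H\le\frac12$, $\delta y_{st}-\int_s^tu_r(y_r)\mathrm{d}r-\sum_k\tilde\sigma_k(y_s)\delta B^k_{st}-\sum_{k,l}\tilde\sigma_l[\tilde\sigma_k](y_s)\mathbb{B}^{l,k}_{st}$ belongs to $C^{3\alpha}_2$. Notation: $\sigma_k[f]=\sum_j\sigma_k^j\partial_{x_j}f$; $\tilde\sigma_l[\tilde\sigma_k]^i=\sum_j\tilde\sigma_l^j\partial_{x_j}\tilde\sigma_k^i$. $f(y)'=(\tilde\sigma_k[f](y))_{1\le k\le K}$ and $f(y)^\sharp_{st}=\delta f(y)_{st}-\sum_k\tilde\sigma_k[f](y_s)\delta B^k_{st}$. $[\cdot]_\alpha$ is the $\alpha$-Hölder seminorm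 and $\|\cdot\|_\alpha=\|\cdot\|_\infty+[\cdot]_\alpha$. $\kappa(X)=\|X\|_2\,\|(X^TX)^{-1}X^T\|_2$ with $\|\cdot\|_2$ the Frobenius norm. The matrices and vectors $X,X_n,Y,\bar Y_n$ are random; the assumptions on $X,Y$ are understood almost surely. Convention: $a_n=\mathcal{O}_C(b_n)$ means that there are a finite constant depending only on the quantities indicated by the subscript (and on $\epsilon$ and the fixed exponents and dimensions), and an $n_0$ (possibly random), such that $|a_n|\le\mathrm{const}\cdot b_n$ for all $n\ge n_0$ (in particular, for such $n$ the quantity $H_n$ is well defined, the minimizer $\bar\beta_n$ is unique and, when $\beta_k>0$, $\bar\beta_{n,k}>0$ so that $\bar\theta_{n,k}$ is well defined). *)

(* Defs.v *)
From HB Require Import structures.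
From mathcomp Require Import all_boot all_order all_algebra.
From mathcomp Require Import all_classical all_reals all_analysis.
Set Implicit Arguments.
Unset Strict Implicit.
Unset Printing Implicit Defensive.
Import Order.TTheory GRing.Theory Num.Theory.
Import numFieldNormedType.Exports.
Local Open Scope classical_set_scope.
Local Open Scope ring_scope.

(* Frobenius norm; on row and column vectors this is the Euclidean norm |.|
   (the library norm `|A| of a matrix is the max norm). *)
Definition fnorm (R : realType) (m n : nat) (A : 'M[R]_(m, n)) : R :=
  Num.sqrt (\sum_i \sum_j A i j ^+ 2).

Definition delta (V : zmodType) (S : Type) (x : S -> V) (s t : S) : V :=
  x t - x s.

(* Hölder seminorms and norms on [0, T] are extended reals: +oo when the
   function does not have the regularity. *)
Definition holder2 (R : realType) (T a : R) (g : R -> R -> R) : \bar R :=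
  ereal_sup [set (`|g p.1 p.2| / (p.2 - p.1) `^ a)%:E
            | p in [set p : R * R | [/\ 0 <= p.1, p.1 < p.2 & p.2 <= T]]].

Definition holder2_mx (R : realType) (m n : nat) (T a : R)
    (g : R -> R -> 'M[R]_(m, n)) : \bar R :=
  holder2 T a (fun s t => fnorm (g s t)).

Definition holder_norm (R : realType) (m n : nat) (T a : R)
    (x : R -> 'M[R]_(m, n)) : \bar R :=
  (ereal_sup [set (fnorm (x t))%:E | t in [set t : R | (0 <= t <= T)%R]]
   + holder2_mx T a (delta x))%E.

Definition partial (R : realType) (d : nat) (j : 'I_d) (f : 'rV[R]_d -> R)
    (x : 'rV[R]_d) : R :=
  'D_(delta_mx 0 j) f x.

Fixpoint Cn (R : realType) (d n : nat) (f : 'rV[R]_d -> R) : Prop :=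
  if n is n'.+1
  then (forall x, differentiable f x) /\ forall j, Cn n' (partial j f)
  else continuous f.

(* s[f] = \sum_j s^j \partial_j f *)
Definition vf_act (R : realType) (d : nat) (s : 'rV[R]_d -> 'rV[R]_d)
    (f : 'rV[R]_d -> R) (x : 'rV[R]_d) : R :=
  \sum_j s x 0 j * partial j f x.

(* s[g]^i = s[g^i] *)
Definition vf_act_vec (R : realType) (d : nat)
    (s g : 'rV[R]_d -> 'rV[R]_d) (x : 'rV[R]_d) : 'rV[R]_d :=
  \row_i vf_act s (fun z => g z 0 i) x.

Definition dyadic (R : realType) (T : R) (n i : nat) : R :=
  i%:R * T / 2 ^+ n.

Definition scaled_var_n (R : realType) (T gamma : R) (n : nat) (x : R -> R)
    (t : R) : R :=
  \sum_(i < (2 ^ n)%N | dyadic T n i.+1 <= t)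
    (dyadic T n i.+1 - dyadic T n i) `^ gamma
    * delta x (dyadic T n i) (dyadic T n i.+1) ^+ 2.

Definition scaled_var (R : realType) (T gamma : R) (x : R -> R) (t : R) : R :=
  lim (scaled_var_n T gamma n x t @[n --> \oo]).

Definition scaled_var_vec_n (R : realType) (d : nat) (T gamma : R) (n : nat)
    (y : R -> 'rV[R]_d) (t : R) : R :=
  \sum_i scaled_var_n T gamma n (fun r => y r 0 i) t.

(* Gaussian laws include the degenerate ones; [normal_prob m 0] is not the
   Dirac mass at m in the library, whence the disjunction. *)
Definition gaussian_rv (R : realType) (disp : measure_display)
    (Omega : measurableType disp) (P : probability Omega R)
    (X : Omega -> R) : Prop :=
  (exists m : R, forall A, measurable A -> P (X @^-1` A) = dirac m A)
  \/ (exists m s : R, 0 < s /\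
        forall A, measurable A -> P (X @^-1` A) = normal_prob m s A).

Definition sample_path (R : realType) (K : nat) (disp : measure_display)
    (Omega : measurableType disp) (P : probability Omega R)
    (B : R -> 'I_K -> {RV P >-> R}) (w : Omega) (t : R) : 'rV[R]_K :=
  \row_k B t k w.

(* Fractional Brownian motion on [0, T], with its (almost surely) Hölder
   continuous paths. *)
Definition is_fBm (R : realType) (K : nat) (disp : measure_display)
    (Omega : measurableType disp) (P : probability Omega R) (T H : R)
    (B : R -> 'I_K -> {RV P >-> R}) : Prop :=
  [/\ forall (N : nat) (t : 'I_N -> R) (c : 'I_N -> 'I_K -> R),
        (forall i, 0 <= t i <= T) ->
        gaussian_rv P (fun w => \sum_i \sum_k c i k * B (t i) k w),
      forall t k, 0 <= t <= T -> ('E_P[B t k] = 0)%E,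
      forall s t k l, 0 <= s <= T -> 0 <= t <= T ->
        ('E_P[fun w => (B t k w * B s l w)%R])%E =
        (2^-1 * (t `^ (2 * H) + s `^ (2 * H) - `|t - s| `^ (2 * H))
         * (k == l)%:R)%:E
    & {ae P, forall w, forall a, 0 < a < H ->
        (holder2_mx T a (delta (sample_path B w)) < +oo)%E}].

(* Piecewise linear interpolation of z along the n-th dyadic partition. *)
Definition lin_interp (R : realType) (K : nat) (T : R) (n : nat)
    (z : R -> 'rV[R]_K) (t : R) : 'rV[R]_K :=
  let i := Num.truncn (t * 2 ^+ n / T) in
  z (dyadic T n i)
  + ((t - dyadic T n i) / (dyadic T n i.+1 - dyadic T n i))
    *: delta z (dyadic T n i) (dyadic T n i.+1).

(* (l, k)-entry: \int_s^t \int_s^{t1} dz^l_r dz^k_{t1}, for z absolutely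
   continuous, i.e. dz_r = z'(r) dr. *)
Definition iterated_int (R : realType) (K : nat) (z : R -> 'rV[R]_K)
    (s t : R) : 'M[R]_K :=
  \matrix_(l, k) \int[@lebesgue_measure R]_(t1 in `[s, t])
    ((\int[@lebesgue_measure R]_(r in `[s, t1]) derive1 (fun q => z q 0 l) r)
     * derive1 (fun q => z q 0 k) t1).

Definition is_rough_path (R : realType) (K : nat) (T a : R)
    (z : R -> 'rV[R]_K) (Z : R -> R -> 'M[R]_K) : Prop :=
  [/\ (holder2_mx T a (delta z) < +oo)%E,
      (holder2_mx T (2 * a) Z < +oo)%E
    & forall s r t, 0 <= s -> s <= r -> r <= t -> t <= T ->
        Z s t = Z s r + (delta z s r)^T *m delta z r t + Z r t].

Definition rough_cvg (R : realType) (K : nat) (T a : R)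
    (zn : nat -> R -> 'rV[R]_K) (Zn : nat -> R -> R -> 'M[R]_K)
    (z : R -> 'rV[R]_K) (Z : R -> R -> 'M[R]_K) : Prop :=
  (holder_norm T a (fun t => zn n t - z t) @[n --> \oo] --> 0%E) /\
  (holder2_mx T (2 * a) (fun s t => Zn n s t - Z s t) @[n --> \oo] --> 0%E).

(* For H > 1/2 the lift is the path itself, and BB plays no role. *)
Definition is_rough_lift (R : realType) (K : nat) (disp : measure_display)
    (Omega : measurableType disp) (P : probability Omega R) (T H : R)
    (B : R -> 'I_K -> {RV P >-> R}) (BB : Omega -> R -> R -> 'M[R]_K) : Prop :=
  H <= 2^-1 ->
  {ae P, forall w, forall a, 3^-1 < a < H ->
     is_rough_path T a (sample_path B w) (BB w) /\
     rough_cvg T a (fun n => lin_interp T n (sample_path B w))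
       (fun n => iterated_int (lin_interp T n (sample_path B w)))
       (sample_path B w) (BB w)}.

Definition admissible (R : realType) (H a : R) : Prop :=
  if H <= 2^-1 then 3^-1 < a < H else 2^-1 < a < H.

Definition scaled_vf (R : realType) (K d : nat) (theta : 'I_K -> R)
    (sigma : 'I_K -> 'rV[R]_d -> 'rV[R]_d) (k : 'I_K) (x : 'rV[R]_d) :
    'rV[R]_d :=
  theta k *: sigma k x.

Definition remainder1 (R : realType) (K d : nat)
    (u : R -> 'rV[R]_d -> 'rV[R]_d) (sig : 'I_K -> 'rV[R]_d -> 'rV[R]_d)
    (z : R -> 'rV[R]_K) (y : R -> 'rV[R]_d) (s t : R) : 'rV[R]_d :=
  delta y s t
  - \row_i (\int[@lebesgue_measure R]_(r in `[s, t]) u r (y r) 0 i)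
  - \sum_k delta z s t 0 k *: sig k (y s).

Definition remainder2 (R : realType) (K d : nat)
    (u : R -> 'rV[R]_d -> 'rV[R]_d) (sig : 'I_K -> 'rV[R]_d -> 'rV[R]_d)
    (z : R -> 'rV[R]_K) (Z : R -> R -> 'M[R]_K) (y : R -> 'rV[R]_d)
    (s t : R) : 'rV[R]_d :=
  remainder1 u sig z y s t
  - \sum_k \sum_l Z s t l k *: vf_act_vec (sig l) (sig k) (y s).

Definition is_pathwise_solution (R : realType) (K d : nat)
    (disp : measure_display) (Omega : measurableType disp)
    (P : probability Omega R) (T H : R)
    (B : R -> 'I_K -> {RV P >-> R}) (BB : Omega -> R -> R -> 'M[R]_K)
    (theta : 'I_K -> R) (u : R -> 'rV[R]_d -> 'rV[R]_d)
    (sigma : 'I_K -> 'rV[R]_d -> 'rV[R]_d)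
    (y : Omega -> R -> 'rV[R]_d) : Prop :=
  let sig := scaled_vf theta sigma in
  [/\ {within [set p : R * 'rV[R]_d | 0 <= p.1 <= T],
        continuous (fun p => u p.1 p.2)},
      forall a, admissible H a ->
        forall k i, Cn (Num.truncn a^-1) (fun x => sigma k x 0 i)
    & {ae P, forall w, forall a, admissible H a ->
        [/\ (holder2_mx T a (delta (y w)) < +oo)%E,
            (holder2_mx T (2 * a) (remainder1 u sig (sample_path B w) (y w)) < +oo)%E
          & H <= 2^-1 ->
            (holder2_mx T (3 * a)
               (remainder2 u sig (sample_path B w) (BB w) (y w)) < +oo)%E]}].

(* f(y)' and f(y)^sharp; sig are the scaled fields theta_k sigma_k. *)
Definition gubinelli (R : realType) (K d : nat)
    (sig : 'I_K -> 'rV[R]_d -> 'rV[R]_d) (f : 'rV[R]_d -> R)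
    (y : R -> 'rV[R]_d) (t : R) : 'rV[R]_K :=
  \row_k vf_act (sig k) f (y t).

Definition sharp (R : realType) (K d : nat)
    (sig : 'I_K -> 'rV[R]_d -> 'rV[R]_d) (f : 'rV[R]_d -> R)
    (z : R -> 'rV[R]_K) (y : R -> 'rV[R]_d) (s t : R) : R :=
  delta (f \o y) s t - \sum_k vf_act (sig k) f (y s) * delta z s t 0 k.

Definition S_ratio (R : realType) (d : nat) (T : R) (y : R -> 'rV[R]_d)
    (n : nat) : R :=
  scaled_var_vec_n T 0 n.+1 y T / scaled_var_vec_n T 0 n y T.

Definition hurst_est (R : realType) (d : nat) (T : R) (y : R -> 'rV[R]_d)
    (n : nat) : R :=
  2^-1 * (1 - ln (S_ratio T y n) / ln 2).

(* The quotient and the logarithm in H_n are meaningful. *)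
Definition hurst_est_defined (R : realType) (d : nat) (T : R)
    (y : R -> 'rV[R]_d) (n : nat) : Prop :=
  scaled_var_vec_n T 0 n y T != 0 /\ 0 < S_ratio T y n.

Definition X_mx (R : realType) (K d M : nat) (T : R)
    (sigma : 'I_K -> 'rV[R]_d -> 'rV[R]_d) (f : 'I_M -> 'rV[R]_d -> R)
    (y : R -> 'rV[R]_d) : 'M[R]_(M, K) :=
  \matrix_(m, k) \int[@lebesgue_measure R]_(r in `[0, T])
    (vf_act (sigma k) (f m) (y r) ^+ 2).

Definition Xn_mx (R : realType) (K d M : nat) (T : R)
    (sigma : 'I_K -> 'rV[R]_d -> 'rV[R]_d) (f : 'I_M -> 'rV[R]_d -> R)
    (y : R -> 'rV[R]_d) (n : nat) : 'M[R]_(M, K) :=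
  \matrix_(m, k) \sum_(i < (2 ^ n)%N)
    vf_act (sigma k) (f m) (y (dyadic T n i)) ^+ 2
    * (dyadic T n i.+1 - dyadic T n i).

Definition Y_vec (R : realType) (d M : nat) (T H : R)
    (f : 'I_M -> 'rV[R]_d -> R) (y : R -> 'rV[R]_d) : 'cV[R]_M :=
  \col_m scaled_var T (1 - 2 * H) (f m \o y) T.

Definition Ybar_vec (R : realType) (d M : nat) (T : R)
    (f : 'I_M -> 'rV[R]_d -> R) (y : R -> 'rV[R]_d) (n : nat) : 'cV[R]_M :=
  \col_m scaled_var_n T (1 - 2 * hurst_est T y n) n (f m \o y) T.

Definition is_argmin (R : realType) (M K : nat) (X : 'M[R]_(M, K))
    (Y : 'cV[R]_M) (b : 'cV[R]_K) : Prop :=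
  forall b' : 'cV[R]_K, fnorm (Y - X *m b) <= fnorm (Y - X *m b').

Definition kappa (R : realType) (M K : nat) (X : 'M[R]_(M, K)) : R :=
  fnorm X * fnorm (invmx (X^T *m X) *m X^T).

Definition delta_rate (R : realType) (H : R) (n : nat) : R :=
  if H <= 2^-1 then 2 `^ (- (n%:R / 2)) * Num.sqrt n%:R
  else 2 `^ (- (n%:R * (1 - H))) * Num.sqrt n%:R.

(* A deterministic function of
   T, kappa(X), ||B||, (||f(y)'||)_f, ([f(y)^sharp])_f, ([sigma_k[f]^2(y)])_{f,k},
   with values in R: the constant is finite even at infinite arguments. *)
Definition const_fun (R : realType) (K M : nat) : Type :=
  R -> R -> \bar R -> ('I_M -> \bar R) -> ('I_M -> \bar R) ->
  ('I_M -> 'I_K -> \bar R) -> R.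

(* The constant evaluated along the paths z of B and y, with a = H - eps. *)
Definition const_at (R : realType) (K d M : nat) (C : const_fun R K M)
    (T a : R) (theta : 'I_K -> R) (sigma : 'I_K -> 'rV[R]_d -> 'rV[R]_d)
    (f : 'I_M -> 'rV[R]_d -> R) (z : R -> 'rV[R]_K) (y : R -> 'rV[R]_d) : R :=
  let sig := scaled_vf theta sigma in
  C T (kappa (X_mx T sigma f y)) (holder_norm T a z)
    (fun m => holder_norm T a (gubinelli sig (f m) y))
    (fun m => holder2 T (2 * a) (sharp sig (f m) z y))
    (fun m k =>
       holder2 T a (delta (fun t => vf_act (sigma k) (f m) (y t) ^+ 2))).

(* Main.v *)
Require Import Defs.
From HB Require Import structures.
From mathcomp Require Import all_boot all_order all_algebra.
From mathcomp Require Import all_classical all_reals all_analysis.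
From mathcomp Require Import measurable_realfun ring lra.
Import Order.TTheory GRing.Theory Num.Theory.
Import numFieldNormedType.Exports.
Local Open Scope classical_set_scope.
Local Open Scope ring_scope.

(** Everything rests on a law of large numbers with a rate for the quadratic
    covariations of fractional Brownian motion, localised to blocks.  Write
    [Hmax] for the maximum of [1/2] and [H], and group the [2^n] increments of
    level [n] into about [2^(n (1 - Hmax))] blocks.  The variance of a sum of
    squares of centered Gaussian variables is determined by their correlations,
    and the correlations of fractional Gaussian noise have a constant sign off the
    diagonal, so that the sum of their absolute values over [L] steps is at most
    [2 L^(2 Hmax)].  Hence the scaled quadratic variation of [B^k] on a block
    differs from the length of the block by an amount whose mean, summed over
    the blocks, is [O(2^(- n Hmax (1 - Hmax)))]; summing over [n] turns this
    into an almost sure bound with any smaller exponent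
    ([defect_mean], [ae_bounded_of_geometric_mean], [fBm_covariation_rate]).
    Cross terms [B^k B^l] follow by polarisation.

    From there on the argument is pathwise.  A controlled path, with increments
    [sum_k g_k(s) (B^k_t - B^k_s)] up to a smoother remainder, has squared
    increments made of [g_k g_l] times products of increments of [B].  Freezing
    [g_k g_l] on each block costs the Hölder oscillation over one block,
    [2^(- n a (1 - Hmax))] with [a < H] arbitrary, and what remains is a Riemann
    sum: the scaled variation of the path converges to [sum_k int g_k^2] at the
    rate [2^(- r n)] for every [r < (1 - Hmax) H]
    ([controlled_variation_rate]).  Taylor's formula shows that [f(y)] and the
    coordinates of [y] are controlled ([solution_function],
    [solution_coordinate]); in particular [Y = X beta], and [X_n] converges to
    [X] at the same rate.

    The variation of [y] does not vanish because [Y] does not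
    ([variation_gt0]), so the ratio defining [S_n] makes sense and [H_n - H]
    has the same exponential rate ([hurst_est_rate]).  Replacing [H] by [H_n]
    multiplies the response by the mesh to the power [2 (H - H_n)], which is
    [1 + O(n |H - H_n|)] ([mesh_power_rate]).  Finally, as [X] has full column
    rank, [X_n] eventually is injective with uniform bounds, the minimiser is
    unique and its error is at most a constant times the residual
    [Ybar_n - X_n beta] of the true parameter ([argmin_error]).

    All these rates hold with path-dependent constants for exponents
    arbitrarily close to [(1 - Hmax) H].  Since [n0] may depend on the path, the
    estimate with [eps / 2] in place of [eps] absorbs the constant: for [n]
    large the error is below [n delta_n^(H - eps)] itself ([rate_absorbs]), and
    both constants of the theorem can be taken equal to 1. *)

Lemma expR_ge1 (R : realType) (x : R) : 0 <= x -> 1 <= expR x.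
Proof. by move=> x0; rewrite -[leLHS]expR0 ler_expR. Qed.

(** * Moments of Gaussian laws *)

Section normal_moments.
Context {R : realType}.
Variables (m s : R).
Hypothesis s0 : 0 < s.
Local Notation mu := (@lebesgue_measure R).
Local Notation phi := (normal_pdf m s).
Local Notation s2 := (Num.sqrt 2 * s).

Lemma sqrt2_scale_gt0 : 0 < s2.
Proof. by rewrite mulr_gt0// sqrtr_gt0. Qed.

(** Half of the exponent is kept to absorb polynomials: the other half is
    again a Gaussian, of standard deviation [s2]. *)
Lemma normal_funE x : normal_fun m s x = normal_fun m s2 x ^+ 2.
Proof.
rewrite /normal_fun -expRM_natl; congr expR.
rewrite exprMn sqr_sqrtr//; field.
by rewrite gt_eqF.
Qed.

Lemma normal_fun_decay x : normal_fun m s2 x * (x - m) ^+ 2 <= 4 * s ^+ 2.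
Proof.
have e : (x - m) ^+ 2 = 4 * s ^+ 2 * ((x - m) ^+ 2 / (s2 ^+ 2 *+ 2)).
  by rewrite exprMn sqr_sqrtr//; field; rewrite gt_eqF.
rewrite e mulrCA ler_piMr//.
  by rewrite mulr_ge0 // sqr_ge0.
rewrite /normal_fun mulNr expRN mulrC ler_pdivrMr ?expR_gt0// mul1r.
apply: le_trans (expR_ge1Dx _); by rewrite lerDr.
Qed.

Lemma power_normal_fun_bounded j :
  exists2 C, 0 <= C & forall x, `|x - m| ^+ j * normal_fun m s2 x <= C.
Proof.
exists (1 + (4 * s ^+ 2) ^+ j * j`!%:R).
  by rewrite addr_ge0// mulr_ge0// exprn_ge0// mulr_ge0 ?sqr_ge0.
move=> x.
have v0 : 0 <= (x - m) ^+ 2 / (s2 ^+ 2 *+ 2).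
  by rewrite divr_ge0 ?sqr_ge0 ?mulrn_wge0 ?sqr_ge0.
have nf1 : normal_fun m s2 x <= 1.
  by rewrite /normal_fun mulNr expRN invf_le1 ?expR_gt0// expR_ge1.
have := normal_fun_ge0 m s2 x; set e := normal_fun m s2 x => e0.
have ej : `|x - m| ^+ j <= 1 + ((x - m) ^+ 2) ^+ j.
  rewrite -(real_normK (num_real (x - m))) -exprM mulnC exprM.
  set t := `|x - m| ^+ j; have : 0 <= t by exact: exprn_ge0.
  by nra.
apply: le_trans (ler_wpM2r e0 ej) _; rewrite mulrDl mul1r lerD//.
have -> : (x - m) ^+ 2 = 4 * s ^+ 2 * ((x - m) ^+ 2 / (s2 ^+ 2 *+ 2)).
  by rewrite exprMn sqr_sqrtr//; field; rewrite gt_eqF.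
rewrite exprMn -mulrA ler_wpM2l//.
  by rewrite exprn_ge0// mulr_ge0// sqr_ge0.
rewrite /e /normal_fun mulNr expRN ler_pdivrMr ?expR_gt0//.
case: j {ej} => [|j]; first by rewrite expr0 fact0 mul1r expR_ge1.
rewrite -ler_pdivrMl ?ltr0n ?fact_gt0// mulrC.
by apply: le_trans (expR_ge1Dxn j v0); rewrite lerDr.
Qed.

Lemma power_normal_pdf_dominated j : exists2 C, 0 <= C &
  forall x, `|(x - m) ^+ j * phi x| <= C * normal_fun m s2 x.
Proof.
have [C C0 hC] := power_normal_fun_bounded j.
exists (C * normal_peak s); first by rewrite mulr_ge0 ?normal_peak_ge0.
move=> x; rewrite normrM normrX [`|phi x|]ger0_norm ?normal_pdf_ge0//.
rewrite normal_pdfE ?gt_eqF//  normal_funE expr2.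
have e0 := normal_fun_ge0 m s2 x; have p0 := normal_peak_ge0 s.
have -> (a b c : R) : a * (b * (c * c)) = a * c * b * c by ring.
by rewrite !ler_wpM2r.
Qed.

Lemma measurable_power_normal_pdf j :
  measurable_fun [set: R] (fun x => (x - m) ^+ j * phi x).
Proof.
apply: measurable_funM; last exact: measurable_normal_pdf.
by apply: measurable_funX; exact: measurable_funB.
Qed.

Lemma integrable_power_normal_pdf j :
  mu.-integrable setT (EFin \o (fun x => (x - m) ^+ j * phi x)).
Proof.
have [C C0 hC] := power_normal_pdf_dominated j.
have := @integrableZl _ _ _ mu setT measurableT (C / normal_peak s2) _
  (@integrable_normal_pdf R m s2).
apply: le_integrable => //.
  by apply/measurable_EFinP; exact: measurable_power_normal_pdf.
move=> x _; rewrite lee_fin /=; apply: le_trans (hC x) _.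
apply: le_trans (ler_norm _); rewrite normal_pdfE ?gt_eqF ?sqrt2_scale_gt0//.
rewrite mulrA divfK// gt_eqF// normal_peak_gt0// gt_eqF//.
exact: sqrt2_scale_gt0.
Qed.

Let dpow_pdf j x : R := (j%:R * (x - m) ^+ j.-1 - (x - m) ^+ j.+1 / s ^+ 2) * phi x.

Lemma is_derive_power_normal_pdf j (x : R) :
  is_derive x 1 (fun x => (x - m) ^+ j * phi x) (dpow_pdf j x).
Proof.
have -> : (fun x => (x - m) ^+ j * phi x) =
          (fun x => (x - m) ^+ j) \* (cst (normal_peak s) \* normal_fun m s).
  by apply/funext => z /=; rewrite normal_pdfE ?gt_eqF.
have d1 : is_derive x 1 (fun x => x - m) (1 - 0).
  by apply: is_deriveB.
have d2 : is_derive x 1 (normal_fun m s)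
   (- ((x - m) / s ^+ 2) * normal_fun m s x).
  have -> : normal_fun m s = expR \o (- (s ^+ 2 *+ 2)^-1 *: (fun x => x - m) ^+ 2).
    apply/funext => z; rewrite /normal_fun/=; congr expR.
    by rewrite mulNr mulrC -mulNr.
  apply: is_derive_eq.
  set e := expR _; rewrite subr0 expr1 /GRing.scale/= !mulr1 mulrC.
  by congr (_ * _); field; rewrite gt_eqF.
have d3 : is_derive x 1 (fun x => (x - m) ^+ j) (j%:R * (x - m) ^+ j.-1).
  have -> : (fun x => (x - m) ^+ j) = (fun x => x - m) ^+ j :> (R -> R).
    by apply/funext => z; rewrite exprfctE.
  by apply: is_derive_eq; rewrite subr0 /GRing.scale /= mulr1 mulr_natl.
apply: is_derive_eq; rewrite /dpow_pdf normal_pdfE ?gt_eqF//= /GRing.scale/=.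
rewrite (exprSr _ j); field; by rewrite gt_eqF.
Qed.

Lemma continuous_power_normal_pdf j : continuous (fun x => (x - m) ^+ j * phi x).
Proof.
move=> x; apply/differentiable_continuous/derivable1_diffP.
by have [] := is_derive_power_normal_pdf j x.
Qed.

Lemma dpow_pdfE j : dpow_pdf j = (fun x => j%:R * ((x - m) ^+ j.-1 * phi x)
   - (s ^+ 2)^-1 * ((x - m) ^+ j.+1 * phi x)).
Proof. by apply/funext => x; rewrite /dpow_pdf; ring. Qed.

Lemma continuous_dpow_pdf j : continuous (dpow_pdf j).
Proof.
rewrite dpow_pdfE => x; apply: (@cvgB _ R^o).
  by apply: cvgM; [exact: cvg_cst|exact: continuous_power_normal_pdf].
by apply: cvgM; [exact: cvg_cst|exact: continuous_power_normal_pdf].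
Qed.

Lemma integrable_dpow_pdf j : mu.-integrable setT (EFin \o dpow_pdf j).
Proof.
rewrite dpow_pdfE.
have -> : EFin \o (fun x => j%:R * ((x - m) ^+ j.-1 * phi x)
    - (s ^+ 2)^-1 * ((x - m) ^+ j.+1 * phi x)) =
  ((fun x => (j%:R)%:E * ((x - m) ^+ j.-1 * phi x)%:E)
    \- (fun x => ((s ^+ 2)^-1)%:E * ((x - m) ^+ j.+1 * phi x)%:E))%E.
  by apply/funext => x.
by apply: integrableB => //; apply: integrableZl => //;
  exact: integrable_power_normal_pdf.
Qed.

Let I n : set R := `[m - n.+1%:R, m + n.+1%:R].

Lemma integral_dpow_pdf_segment j n :
  (\int[mu]_(x in I n) (dpow_pdf j x)%:E)%E =
  (n.+1%:R ^+ j * phi (m + n.+1%:R) - (- n.+1%:R) ^+ j * phi (m - n.+1%:R))%:E.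
Proof.
have lt : m - n.+1%:R < m + n.+1%:R by rewrite ltrD2l gtrN.
have cG := continuous_power_normal_pdf j.
rewrite (@continuous_FTC2 _ _ (fun x => (x - m) ^+ j * phi x))//.
- by rewrite -EFinB; congr ((_ ^+ _ * _ - _ ^+ _ * _)%:E); rewrite addrC addKr.
- by apply: continuous_subspaceT; exact: continuous_dpow_pdf.
- split.
  + by move=> x _; have [] := is_derive_power_normal_pdf j x.
  + exact/cvg_at_right_filter/cG.
  + exact/cvg_at_left_filter/cG.
- move=> x _; rewrite derive1E; exact: (@derive_val _ _ _ _ _ _ _ (is_derive_power_normal_pdf j x)).
Qed.

(** Integrating the derivative of [(x - m) ^ j * phi] over growing symmetric
    intervals leaves boundary terms that vanish at infinity. *)
Lemma integral_dpow_pdf j : (\int[mu]_x (dpow_pdf j x)%:E = 0)%E.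
Proof.
have [C C0 hC] := power_normal_pdf_dominated j.
pose f_ n : R -> \bar R := (EFin \o dpow_pdf j) \_ (I n).
have mg : measurable_fun setT (EFin \o dpow_pdf j).
  by case/integrableP: (integrable_dpow_pdf j).
have [] := @dominated_convergence _ _ _ mu setT measurableT f_ (EFin \o dpow_pdf j)
   (fun x => `|(dpow_pdf j x)%:E|%E).
- move=> n; apply/(measurable_restrictT _ _).1; first exact: measurable_itv.
  exact: measurable_funTS.
- exact: mg.
- apply/aeW => x _; apply: cvg_near_cst.
  near=> n; rewrite /f_ patchE mem_set// /I /= in_itv/=.
  have : `|x - m| <= n.+1%:R.
    rewrite -natr1; apply: ler_wpDr => //.
    by near: n; exact: nbhs_infty_ger.
  by rewrite ler_norml; lra.
- exact: integrable_abse (integrable_dpow_pdf j).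
- apply/aeW => x n _; rewrite /f_ patchE; case: ifP => //= _.
  by rewrite lee_fin normr0.
move=> _ _ /cvg_lim <-//; apply/cvg_lim => //.
rewrite (_ : (fun n => _) = (fun n => ((n.+1%:R ^+ j * phi (m + n.+1%:R)) -
   ((- n.+1%:R) ^+ j * phi (m - n.+1%:R)))%:E)); last first.
  apply/funext => n; rewrite /f_ -integral_mkcond -integral_dpow_pdf_segment.
  by [].
apply: cvg_EFin; first by near=> n.
pose D := C * (4 * s ^+ 2).
apply/cvgrPdist_le => e e0; near=> n; rewrite sub0r normrN.
have hb (x : R) : `|x - m| = n.+1%:R -> `|(x - m) ^+ j * phi x| <= D / n.+1%:R.
  move=> hx; apply: le_trans (hC x) _.
  rewrite -mulrA ler_wpM2l// ler_pdivlMr ?ltr0n//.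
  apply: le_trans (normal_fun_decay x).
  rewrite ler_wpM2l ?normal_fun_ge0//.
  by rewrite -(real_normK (num_real (x - m))) hx -natrX ler_nat expnS leq_pmulr.
apply: le_trans (ler_normB _ _) _.
have h1 := hb (m + n.+1%:R); have h2 := hb (m - n.+1%:R).
rewrite (_ : n.+1%:R ^+ j = (m + n.+1%:R - m) ^+ j); last by rewrite addrC addKr.
rewrite (_ : (- n.+1%:R) ^+ j = (m - n.+1%:R - m) ^+ j); last by rewrite addrC addKr.
apply: le_trans (lerD (h1 _) (h2 _)) _.
- by rewrite addrC addKr ger0_norm.
- by rewrite addrC addKr normrN ger0_norm.
rewrite -mulr2n -mulrnAl ler_pdivrMr ?ltr0n// mulrC -ler_pdivrMr//.
rewrite -natr1; apply: ler_wpDr => //.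
by near: n; exact: nbhs_infty_ger.
Unshelve. all: by end_near. Qed.

(** Integration by parts. *)
Lemma normal_moment_rec j :
  (\int[mu]_x ((x - m) ^+ j.+1 * phi x) =
   s ^+ 2 * j%:R * \int[mu]_x ((x - m) ^+ j.-1 * phi x))%R.
Proof.
have : (\int[mu]_x (dpow_pdf j x) = 0)%R by rewrite /Rintegral integral_dpow_pdf.
rewrite dpow_pdfE RintegralB//; last 2 first.
- exact: (integrableZl measurableT j%:R (integrable_power_normal_pdf _)).
- exact: (integrableZl measurableT (s ^+ 2)^-1 (integrable_power_normal_pdf _)).
rewrite !RintegralZl//; [|exact: integrable_power_normal_pdf..].
move/eqP; rewrite subr_eq0 => /eqP e.
by rewrite -mulrA e mulrA divff ?mul1r// gt_eqF// exprn_gt0.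
Qed.

Lemma normal_moment0 : (\int[mu]_x ((x - m) ^+ 0 * phi x) = 1)%R.
Proof.
rewrite /Rintegral; under eq_integral do rewrite expr0 mul1r.
by rewrite integral_normal_pdf.
Qed.

End normal_moments.

Section normal_law.
Context {R : realType}.
Variables (m s : R).
Hypothesis s0 : 0 < s.
Local Notation mu := (@lebesgue_measure R).
Local Notation phi := (normal_pdf m s).

(** The density is identified almost everywhere with the Radon-Nikodym
    derivative, for which the change of variables is known. *)
Lemma ge0_integral_normal_prob (f : R -> \bar R) :
  measurable_fun setT f -> (forall x, 0 <= f x)%E ->
  (\int[normal_prob m s]_x f x = \int[mu]_x (f x * (phi x)%:E))%E.
Proof.
move=> mf f0; have dom := normal_prob_dominates m s.
rewrite -(Radon_Nikodym_SigmaFinite.change_of_variables dom)//.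
have fi := Radon_Nikodym_SigmaFinite.f_integrable dom.
have mphi : measurable_fun [set: R] (EFin \o phi).
  by apply/measurable_EFinP; exact: measurable_normal_pdf.
apply: ae_eq_integral => //.
- by apply: emeasurable_funM => //; exact: measurable_int fi.
- exact: emeasurable_funM.
- apply: ae_eqe_mul2l; apply: integral_ae_eq => // A _ mA.
  by rewrite -Radon_Nikodym_SigmaFinite.f_integral.
Qed.

Lemma integral_normal_prob (f : R -> \bar R) :
  measurable_fun setT f ->
  (\int[normal_prob m s]_x f x = \int[mu]_x (f x * (phi x)%:E))%E.
Proof.
move=> mf; rewrite integralE [RHS]integralE.
have pM (a : \bar R) (b : R) : 0 <= b ->
    (maxe (a * b%:E) 0 = maxe a 0 * b%:E)%E.
  by move=> b0; rewrite maxe_pMl// mul0e.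
rewrite !ge0_integral_normal_prob//; last 2 first.
- exact: measurable_funeneg.
- exact: measurable_funepos.
congr (_ - _)%E; apply: eq_integral => x _.
- by rewrite !funeposE pM ?normal_pdf_ge0.
- by rewrite !funenegE -mulNe pM ?normal_pdf_ge0.
Qed.

End normal_law.

(** The moments are read on the law of [X], where they satisfy the recursion
    [normal_moment_rec] or, for a Dirac mass, are powers of its location; a
    vanishing mean forces the location to be 0. *)
Lemma gaussian_moment4 (R : realType) (d : measure_display)
    (Omega : measurableType d) (P : probability Omega R) (X : Omega -> R) :
  measurable_fun setT X -> gaussian_rv P X ->
  (\int[P]_w (X w)%:E = 0)%E ->
  P.-integrable setT (fun w => (X w ^+ 4)%:E) /\
  (\int[P]_w (X w ^+ 4) = 3 * (\int[P]_w (X w ^+ 2)) ^+ 2)%R.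
Proof.
move=> mX gX EX.
have mpow k : measurable_fun setT (fun x : R => (x ^+ k)%:E).
  by apply/measurable_EFinP; exact: measurable_funX.
pose X' : Omega -> measurableTypeR R := X.
have mX' : measurable_fun setT X' by [].
have pushE (f : R -> \bar R) : measurable_fun setT f ->
    (\int[P]_w f (X w) = \int[pushforward P X']_x f x)%E.
  move=> mf; rewrite integralE [RHS]integralE.
  rewrite !ge0_integral_pushforward//; last 2 first.
  - exact: measurable_funeneg.
  - exact: measurable_funepos.
  by rewrite preimage_setT -funepos_comp -funeneg_comp.
suff [v [e2 e4]] : exists v : R, (\int[P]_w (X w ^+ 2)%:E = v%:E)%E /\
    (\int[P]_w (X w ^+ 4)%:E = (3 * v ^+ 2)%:E)%E.
  split; last by rewrite /Rintegral e2 e4.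
  apply/integrableP; split.
    by apply/measurable_EFinP; exact: measurable_funX.
  under eq_integral do rewrite gee0_abs ?lee_fin ?exprn_even_ge0//.
  by rewrite e4 ltry.
have E1 := pushE _ (mpow 1%N); have E2 := pushE _ (mpow 2); have E4 := pushE _ (mpow 4).
case: gX => [[m hm]|[m [s [s0 hm]]]].
- have lawE (f : R -> \bar R) : measurable_fun setT f ->
      (\int[pushforward P X']_x f x = f m)%E.
    move=> mf; rewrite (eq_measure_integral (@dirac _ (measurableTypeR R) m R)).
      by rewrite integral_dirac// diracT mul1e.
    by move=> A mA _; exact: hm.
  have m0 : m = 0.
    by move: E1; rewrite lawE// => /esym; rewrite EX => -[].
  exists 0; rewrite E2 E4 !lawE// m0; split; congr EFin.
    by rewrite expr0n.
  by rewrite !expr0n mulr0.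
- have lawE (f : R -> R) : measurable_fun setT f ->
      (\int[pushforward P X']_x (f x)%:E =
       \int[lebesgue_measure]_x (f x * normal_pdf m s x)%:E)%E.
    move=> mf; rewrite [LHS](eq_measure_integral (normal_prob m s)); last first.
      by move=> A mA _; exact: hm.
    rewrite [LHS]integral_normal_prob//; exact/measurable_EFinP.
  have fin j := integrable_fin_num measurableT (integrable_power_normal_pdf m s s0 j).
  have rec j := normal_moment_rec m s s0 j.
  have m0 : m = 0.
    have i1 := integrable_power_normal_pdf m s s0 1.
    have i0 := integrable_power_normal_pdf m s s0 0.
    move: (congr1 fine E1); rewrite EX lawE; last exact: measurable_funX.
    rewrite -[RHS]/(\int[lebesgue_measure]_x (x ^+ 1 * normal_pdf m s x))%R.
    rewrite (_ : (fun x => x ^+ 1 * normal_pdf m s x) = (fun x =>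
      (x - m) ^+ 1 * normal_pdf m s x + m * ((x - m) ^+ 0 * normal_pdf m s x))).
      rewrite RintegralD//; last exact: (integrableZl measurableT m i0).
      by rewrite RintegralZl// rec normal_moment0 mulr0 mul0r add0r mulr1.
    by apply/funext => x; rewrite !expr1 expr0 mul1r mulrBl subrK.
  have IE k : (\int[P]_w (X w ^+ k)%:E =
      (\int[lebesgue_measure]_x ((x - m) ^+ k * normal_pdf m s x))%:E)%E.
    rewrite /Rintegral fineK; last exact: fin.
    rewrite (pushE _ (mpow k)) lawE; last exact: measurable_funX.
    by apply: eq_integral => x _; rewrite m0 subr0.
  exists (s ^+ 2); rewrite !IE !rec/= normal_moment0; split; congr EFin.
    by rewrite !mulr1.
  by ring.
Qed.

(** * Convexity of powers *)

Lemma powR_midpoint_convex (R : realType) (p x y : R) :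
  1 <= p -> 0 <= x -> 0 <= y -> ((x + y) / 2) `^ p <= (x `^ p + y `^ p) / 2.
Proof.
move=> p1 x0 y0.
have h0 : 0 <= 2^-1 :> R by rewrite invr_ge0.
have h1 : 2^-1 <= 1 :> R by rewrite invf_le1 ?ler1n.
have := @convex_powR _ _ p1 (Itv01 h0 h1) x y; rewrite !inE/= !in_itv/= !andbT.
move=> /(_ x0 y0) h; rewrite convRE [X in X `^ _ <= _]convRE/= in h.
move: h; rewrite /unstable.onem.
have -> : 1 - 2^-1 = 2^-1 :> R by lra.
by rewrite -!mulrDr !(mulrC 2^-1).
Qed.

(** Convexity of the inverse function, applied to the powers. *)
Lemma powR_midpoint_concave (R : realType) (p x y : R) :
  0 < p -> p <= 1 -> 0 <= x -> 0 <= y ->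
  (x `^ p + y `^ p) / 2 <= ((x + y) / 2) `^ p.
Proof.
move=> p0 p1 x0 y0.
have q1 : 1 <= p^-1 by rewrite invf_ge1.
have := powR_midpoint_convex _ _ _ _ q1 (powR_ge0 x p) (powR_ge0 y p).
rewrite -!powRrM divff ?gt_eqF// !powRr1// => h.
have a0 : 0 <= (x `^ p + y `^ p) / 2 by rewrite divr_ge0// addr_ge0// powR_ge0.
have := ge0_ler_powR (ltW p0) _ _ h.
rewrite !nnegrE powR_ge0 divr_ge0 ?addr_ge0// => /(_ isT isT).
by rewrite -powRrM mulVf ?gt_eqF// powRr1.
Qed.

(** * Second moments of quadratic functionals of Gaussian families *)

Section expectation.
Context {R : realType} {d : measure_display} {Omega : measurableType d}.
Variable P : probability Omega R.
Implicit Types (X Y Z : Omega -> R).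

Local Notation itg X := (P.-integrable setT (EFin \o X)).
Local Notation "''E' X" := (\int[P]_w (X w))%R (at level 10).

Definition L4 X := measurable_fun setT X /\ itg (fun w => X w ^+ 4).

Lemma itg_cst (c : R) : itg (fun=> c).
Proof.
apply/integrableP; split; first exact: measurable_cst.
by rewrite integral_cst//= [P _]probability_setT mule1 ltry.
Qed.

Lemma L4_dominated X Y Z : L4 X -> L4 Y -> measurable_fun setT Z ->
  (forall w, `|Z w| <= 1 + X w ^+ 4 + Y w ^+ 4) -> itg Z.
Proof.
move=> [mX iX] [mY iY] mZ le; apply: (@le_integrable _ _ _ _ _ measurableT _
  (EFin \o (fun w => 1 + X w ^+ 4 + Y w ^+ 4))).
- exact/measurable_EFinP.
- by move=> w _; rewrite lee_fin (le_trans (le w))// ler_norm.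
- have := integrableD measurableT (integrableD measurableT (itg_cst 1) iX) iY.
  by [].
Qed.

Lemma L4_integrable X : L4 X -> itg X.
Proof.
move=> h; apply: (L4_dominated _ _ _ h h); first by case: h.
move=> w; have -> : X w ^+ 4 = `|X w| ^+ 4.
  by rewrite -normrX ger0_norm// exprn_even_ge0.
set t := `|X w|; have := sqr_ge0 (t - 1); have := sqr_ge0 (t ^+ 2 - 1).
have := sqr_ge0 (t ^+ 2); by nra.
Qed.

Lemma L4_integrableM X Y : L4 X -> L4 Y -> itg (fun w => X w * Y w).
Proof.
move=> hX hY; apply: (L4_dominated _ _ _ hX hY).
  by apply: measurable_funM; [case: hX|case: hY].
move=> w; rewrite ler_norml; set x := X w; set y := Y w.
have := sqr_ge0 (x ^+ 2 - 1); have := sqr_ge0 (y ^+ 2 - 1).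
have := sqr_ge0 (x - y); have := sqr_ge0 (x + y); have := sqr_ge0 (x ^+ 2); have := sqr_ge0 (y ^+ 2).
by move=> ? ? ? ? ? ?; apply/andP; split; nra.
Qed.

Lemma L4_integrable_sqrM X Y : L4 X -> L4 Y ->
  itg (fun w => X w ^+ 2 * Y w ^+ 2).
Proof.
move=> hX hY; apply: (L4_dominated _ _ _ hX hY).
  by apply: measurable_funM; apply: measurable_funX; [case: hX|case: hY].
move=> w; rewrite ger0_norm; last by apply: mulr_ge0; exact: sqr_ge0.
set x := X w; set y := Y w.
have := sqr_ge0 (x ^+ 2 - y ^+ 2); have := sqr_ge0 (x ^+ 2 + y ^+ 2).
by nra.
Qed.

Lemma L4_integrable_sqr X : L4 X -> itg (fun w => X w ^+ 2).
Proof. by move=> hX; exact: (L4_integrableM _ _ hX hX). Qed.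

Definition centered_gaussian X := [/\ L4 X, 'E X = 0 &
  'E (fun w => X w ^+ 4) = 3 * ('E (fun w => X w ^+ 2)) ^+ 2].

Lemma gaussian_centered X : measurable_fun setT X -> gaussian_rv P X ->
  (\int[P]_w (X w)%:E = 0)%E -> centered_gaussian X.
Proof.
move=> mX gX E0; have [i4 E4] := gaussian_moment4 _ _ _ _ _ mX gX E0.
by split => //; rewrite /Rintegral E0.
Qed.

(** Polarisation of the fourth moment:
    [12 x^2 y^2 = (x + y)^4 + (x - y)^4 - 2 x^4 - 2 y^4]. *)
Lemma gaussian_sqr_cov X Y : centered_gaussian X -> centered_gaussian Y ->
  centered_gaussian (fun w => X w + Y w) ->
  centered_gaussian (fun w => X w - Y w) ->
  'E (fun w => X w ^+ 2 * Y w ^+ 2) =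
  'E (fun w => X w ^+ 2) * 'E (fun w => Y w ^+ 2)
  + 2 * ('E (fun w => X w * Y w)) ^+ 2.
Proof.
move=> [LX _ EX] [LY _ EY] [[mS iS] _ ES] [[mD iD] _ ED].
have [mX iX] := LX; have [mY iY] := LY.
have iXY := L4_integrableM _ _ LX LY; have iX2Y2 := L4_integrable_sqrM _ _ LX LY.
have iX2 := L4_integrable_sqr _ LX; have iY2 := L4_integrable_sqr _ LY.
have Z (c : R) X' : itg X' -> itg (fun w => c * X' w).
  by move=> i; exact: (integrableZl measurableT c i).
have A X' Y' : itg X' -> itg Y' -> itg (fun w => X' w + Y' w).
  by move=> i j; exact: (integrableD measurableT i j).
have eZ (c : R) X' : itg X' -> 'E (fun w => c * X' w) = c * 'E X'.
  by move=> i; rewrite RintegralZl.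
have eA X' Y' : itg X' -> itg Y' -> 'E (fun w => X' w + Y' w) = 'E X' + 'E Y'.
  by move=> i j; rewrite RintegralD.
have E2 (e : R) : 'E (fun w => (X w + e * Y w) ^+ 2) =
    'E (fun w => X w ^+ 2) + 2 * e * 'E (fun w => X w * Y w)
    + e ^+ 2 * 'E (fun w => Y w ^+ 2).
  rewrite (_ : (fun w => (X w + e * Y w) ^+ 2) = (fun w => X w ^+ 2 + (2 * e) * (X w * Y w)
     + e ^+ 2 * Y w ^+ 2)); last by apply/funext => w; ring.
  by rewrite !(eA, eZ)//; do ?[apply: A|apply: Z].
have ES2 := E2 1; have ED2 := E2 (-1).
rewrite (_ : (fun w => (X w + 1 * Y w) ^+ 2) = (fun w => (X w + Y w) ^+ 2)) in ES2; last first.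
  by apply/funext => w; rewrite mul1r.
rewrite (_ : (fun w => (X w + -1 * Y w) ^+ 2) = (fun w => (X w - Y w) ^+ 2)) in ED2; last first.
  by apply/funext => w; rewrite mulN1r.
rewrite {}ES2 in ES; rewrite {}ED2 in ED.
rewrite (_ : (fun w => X w ^+ 2 * Y w ^+ 2) = (fun w => 12^-1 * (X w + Y w) ^+ 4
   + 12^-1 * (X w - Y w) ^+ 4 + (- 6^-1) * X w ^+ 4 + (-6^-1) * Y w ^+ 4)); last first.
  by apply/funext => w; field.
have j1 := Z 12^-1 _ iS; have j2 := Z 12^-1 _ iD.
have j3 := Z (- 6^-1) _ iX; have j4 := Z (- 6^-1) _ iY.
have j12 := A _ _ j1 j2; have j123 := A _ _ j12 j3.
rewrite (eA _ _ j123 j4) (eA _ _ j12 j3) (eA _ _ j1 j2) !eZ//.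
by rewrite ES ED EX EY; field.
Qed.
End expectation.

Section integral_sum.
Context {R : realType} {d : measure_display} {X : measurableType d}.
Variables (mu : {measure set X -> \bar R}) (D : set X).
Hypothesis mD : measurable D.

Lemma integrable_sumr (I : Type) (r : seq I) (F : I -> X -> R) :
  (forall i, mu.-integrable D (EFin \o F i)) ->
  mu.-integrable D (EFin \o (fun w => \sum_(i <- r) F i w)).
Proof.
move=> h; elim: r => [|i r IH].
  by under eq_fun do rewrite big_nil; exact: integrable0.
under eq_fun do rewrite big_cons.
exact: (integrableD mD (h i) IH).
Qed.

Lemma Rintegral_sum (I : Type) (r : seq I) (F : I -> X -> R) :
  (forall i, mu.-integrable D (EFin \o F i)) ->
  (\int[mu]_(w in D) \sum_(i <- r) F i w)%R =
  \sum_(i <- r) (\int[mu]_(w in D) F i w)%R.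
Proof.
move=> h; elim: r => [|i r IH].
  rewrite big_nil; under eq_Rintegral do rewrite big_nil.
  by rewrite Rintegral_cst// mul0r.
under eq_Rintegral do rewrite big_cons.
rewrite big_cons RintegralD// ?IH//; exact: integrable_sumr.
Qed.

End integral_sum.

Section quadratic_functional.
Context {R : realType} {d : measure_display} {Omega : measurableType d}.
Variable P : probability Omega R.
Local Notation itg X := (P.-integrable setT (EFin \o X)).
Local Notation "''E' X" := (\int[P]_w (X w))%R (at level 10).

Lemma itg_sum (I : Type) (r : seq I) (F : I -> Omega -> R) :
  (forall i, itg (F i)) -> itg (fun w => \sum_(i <- r) F i w).
Proof. exact: integrable_sumr. Qed.

Lemma expectation_sum (I : Type) (r : seq I) (F : I -> Omega -> R) :
  (forall i, itg (F i)) ->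
  'E (fun w => \sum_(i <- r) F i w) = \sum_(i <- r) 'E (F i).
Proof. exact: Rintegral_sum. Qed.

Lemma expectation_cst (c : R) : (\int[P]_w c)%R = c.
Proof. by rewrite Rintegral_cst// -[fine _]/(fine (P setT)) probability_setT mulr1. Qed.

(** Wick's formula: the covariance of the squares of two variables is twice
    the square of their covariance. *)
Lemma gaussian_quadratic_variance L (Z : nat -> Omega -> R) :
  (forall i j, (i < L)%N -> (j < L)%N ->
    [/\ centered_gaussian P (Z i), centered_gaussian P (fun w => Z i w + Z j w)
      & centered_gaussian P (fun w => Z i w - Z j w)]) ->
  let v i j := 'E (fun w => Z i w * Z j w) in
  let D w := \sum_(i < L) (Z i w ^+ 2 - v i i) in
  itg (fun w => D w ^+ 2) /\
  'E (fun w => D w ^+ 2) = 2 * \sum_(i < L) \sum_(j < L) v i j ^+ 2.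
Proof.
move=> hZ v D.
have itgZ (c : R) X : itg X -> itg (fun w => c * X w).
  by move=> i; exact: (integrableZl measurableT c i).
have itgD X Y : itg X -> itg Y -> itg (fun w => X w + Y w).
  by move=> i j; exact: (integrableD measurableT i j).
have LZ i : (i < L)%N -> L4 P (Z i) by move=> hi; have [[]] := hZ _ _ hi hi.
pose F i j w := (Z i w ^+ 2 - v i i) * (Z j w ^+ 2 - v j j).
have FE i j : F i j = (fun w => Z i w ^+ 2 * Z j w ^+ 2
    + ((- v j j) * Z i w ^+ 2 + ((- v i i) * Z j w ^+ 2 + v i i * v j j))).
  by apply/funext => w; rewrite /F; ring.
have iF i j : (i < L)%N -> (j < L)%N -> itg (F i j).
  move=> hi hj; rewrite FE.
  apply: (itgD _ _ (L4_integrable_sqrM _ _ _ (LZ _ hi) (LZ _ hj))).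
  apply: (itgD _ _ (itgZ _ _ (L4_integrable_sqr _ _ (LZ _ hi)))).
  apply: (itgD _ _ (itgZ _ _ (L4_integrable_sqr _ _ (LZ _ hj)))).
  exact: itg_cst.
have eF i j : (i < L)%N -> (j < L)%N -> 'E (F i j) = 2 * v i j ^+ 2.
  move=> hi hj; rewrite FE.
  have i1 := L4_integrable_sqrM _ _ _ (LZ _ hi) (LZ _ hj).
  have i2 := L4_integrable_sqr _ _ (LZ _ hi).
  have i3 := L4_integrable_sqr _ _ (LZ _ hj).
  have i4 := itgD _ _ (itgZ (- v i i) _ i3) (itg_cst P (v i i * v j j)).
  have i5 := itgD _ _ (itgZ (- v j j) _ i2) i4.
  rewrite (RintegralD measurableT i1 i5).
  rewrite (RintegralD measurableT (itgZ (- v j j) _ i2) i4).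
  rewrite (RintegralD measurableT (itgZ (- v i i) _ i3) (itg_cst P _)).
  rewrite (RintegralZl _ measurableT i2) (RintegralZl _ measurableT i3) expectation_cst.
  have [c1 c2 c3] := hZ _ _ hi hj; have [c4 _ _] := hZ _ _ hj hi.
  rewrite (gaussian_sqr_cov _ _ _ c1 c4 c2 c3).
  have e k : 'E (fun w => Z k w ^+ 2) = v k k by [].
  by rewrite !e -/(v i j); ring.
have DE : (fun w => D w ^+ 2) = (fun w => \sum_(i < L) \sum_(j < L) F i j w).
  by apply/funext => w; rewrite expr2 /D big_distrlr.
have iFs (i : 'I_L) : itg (fun w => \sum_(j < L) F i j w).
  by apply: (itg_sum _ _ (fun j : 'I_L => F i j)) => j; exact: iF.
rewrite DE; split.
  exact: (itg_sum _ _ (fun (i : 'I_L) w => \sum_(j < L) F i j w)).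
rewrite (expectation_sum _ _ (fun (i : 'I_L) w => \sum_(j < L) F i j w))//.
rewrite mulr_sumr; apply: eq_bigr => i _.
rewrite (expectation_sum _ _ (fun j : 'I_L => F i j)); last by move=> j; exact: iF.
by rewrite mulr_sumr; apply: eq_bigr => j _; rewrite eF.
Qed.

End quadratic_functional.

(** * Correlation of fractional Gaussian noise *)

Section noise_correlation.
Context {R : realType}.
Variable p : R.
Hypothesis p02 : 0 < p < 2.

(** Correlation of the increments of fractional Brownian motion of index
    [p / 2] over the unit intervals [[i, i + 1]] and [[j, j + 1]]. *)
Definition noise_corr (i j : nat) : R :=
  2^-1 * (`|j%:R + 1 - i%:R| `^ p + `|j%:R - i%:R - 1| `^ p)
  - `|j%:R - i%:R| `^ p.

Let p0 : 0 < p. Proof. by case/andP: p02. Qed.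

Lemma noise_corr_diag i : noise_corr i i = 1.
Proof.
rewrite /noise_corr (_ : i%:R + 1 - i%:R = 1); last by ring.
rewrite subrr sub0r normrN normr1 normr0 powR1 powR0 ?gt_eqF//; lra.
Qed.

Lemma noise_corrC i j : noise_corr i j = noise_corr j i.
Proof.
rewrite /noise_corr (distrC j%:R i%:R); congr (_ * _ - _).
have -> : `|j%:R + 1 - i%:R| = `|i%:R - j%:R - 1| :> R.
  by rewrite -normrN; congr `|_|; ring.
have -> : `|j%:R - i%:R - 1| = `|i%:R + 1 - j%:R| :> R.
  by rewrite -normrN; congr `|_|; ring.
exact: addrC.
Qed.

Lemma noise_corrE i k : noise_corr i (i + k.+1) =
  2^-1 * ((k.+1%:R + 1) `^ p + (k.+1%:R - 1) `^ p) - k.+1%:R `^ p.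
Proof.
rewrite /noise_corr natrD; have k0 : 0 <= k%:R :> R by [].
have -> : `|i%:R + k.+1%:R + 1 - i%:R| = k.+1%:R + 1 :> R.
  by rewrite ger0_norm; [ring|rewrite -natr1; lra].
have -> : `|i%:R + k.+1%:R - i%:R - 1| = k.+1%:R - 1 :> R.
  by rewrite ger0_norm -natr1; [ring|lra].
have -> : `|i%:R + k.+1%:R - i%:R| = k.+1%:R :> R.
  by rewrite addrC addKr ger0_norm.
by [].
Qed.

Lemma noise_corr_ge0 i j : 1 <= p -> 0 <= noise_corr i j.
Proof.
move=> p1.
wlog ij : i j / (i <= j)%N.
  by move=> h; have [/h//|/ltnW/h] := leqP i j; rewrite noise_corrC.
have [k ->] : exists k, j = (i + k)%N by exists (j - i)%N; rewrite subnKC.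
case: k => [|k]; first by rewrite addn0 noise_corr_diag.
rewrite noise_corrE subr_ge0.
have k0 : 0 <= k%:R :> R by [].
have [a0 b0] : 0 <= k.+1%:R + 1 :> R /\ 0 <= k.+1%:R - 1 :> R.
  by rewrite -natr1; split; lra.
have := powR_midpoint_convex _ _ _ _ p1 a0 b0.
have -> : (k.+1%:R + 1 + (k.+1%:R - 1)) / 2 = k.+1%:R :> R by field.
by rewrite [X in _ <= X -> _]mulrC.
Qed.

Lemma noise_corr_le0 i j : p <= 1 -> i != j -> noise_corr i j <= 0.
Proof.
move=> p1.
wlog ij : i j / (i <= j)%N.
  move=> h; have [/h//|/ltnW/h] := leqP i j; rewrite noise_corrC eq_sym.
  exact.
have [k ->] : exists k, j = (i + k)%N by exists (j - i)%N; rewrite subnKC.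
case: k => [|k]; first by rewrite addn0 eqxx.
move=> _; rewrite noise_corrE subr_le0.
have k0 : 0 <= k%:R :> R by [].
have [a0 b0] : 0 <= k.+1%:R + 1 :> R /\ 0 <= k.+1%:R - 1 :> R.
  by rewrite -natr1; split; lra.
have := powR_midpoint_concave _ _ _ _ p0 p1 a0 b0.
have -> : (k.+1%:R + 1 + (k.+1%:R - 1)) / 2 = k.+1%:R :> R by field.
by rewrite mulrC.
Qed.

(** The double sum telescopes: it is the variance of the increment over
    [[0, L]]. *)
Lemma sum_noise_corr L : \sum_(i < L) \sum_(j < L) noise_corr i j = L%:R `^ p.
Proof.
pose g (x : R) := `|x| `^ p.
have g0 : g 0 = 0 by rewrite /g normr0 powR0// gt_eqF.
have gN x : g (- x) = g x by rewrite /g normrN.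
have row i : \sum_(j < L) noise_corr i j =
   2^-1 * ((g (i.+1%:R) - g i%:R) - (g (L%:R - i.+1%:R) - g (L%:R - i%:R))).
  have := telescope_sumr (fun j => g (j%:R - i%:R) - g (j%:R - i.+1%:R)) (leq0n L).
  rewrite !sub0r !gN big_mkord => tel.
  have -> : \sum_(j < L) noise_corr i j = 2^-1 *
     \sum_(j < L) (g (j.+1%:R - i%:R) - g (j.+1%:R - i.+1%:R) -
              (g (j%:R - i%:R) - g (j%:R - i.+1%:R))).
    rewrite mulr_sumr; apply: eq_bigr => j _; rewrite /noise_corr -!/(g _).
    rewrite -!natr1 (_ : j%:R + 1 - (i%:R + 1) = j%:R - i%:R); last by ring.
    by rewrite (_ : j%:R - (i%:R + 1) = j%:R - i%:R - 1); [field|ring].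
  by rewrite tel; ring.
have e1 := telescope_sumr (fun i => g i%:R) (leq0n L).
have e2 := telescope_sumr (fun i => g (L%:R - i%:R)) (leq0n L).
rewrite !big_mkord in e1 e2.
under eq_bigr do rewrite row.
rewrite -mulr_sumr sumrB e1 e2 subrr subr0 g0.
by rewrite /g ger0_norm//; field.
Qed.

(** Off the diagonal the correlations are all nonnegative if [1 <= p] and all
    nonpositive if [p <= 1]; either way the absolute values sum to an explicit
    combination of the diagonal and of the telescoping sum. *)
Lemma sum_abs_noise_corr L :
  \sum_(i < L) \sum_(j < L) `|noise_corr i j| <= 2 * L%:R `^ Num.max 1 p.
Proof.
have [p1|p1] := leP 1 p.
  under eq_bigr => i _ do under eq_bigr => j _ do rewrite ger0_norm ?noise_corr_ge0//.
  by rewrite sum_noise_corr ler_peMl ?powR_ge0// ler1n.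
rewrite powRr1//.
have -> : \sum_(i < L) \sum_(j < L) `|noise_corr i j| =
    \sum_(i < L) \sum_(j < L) (2 * (j == i)%:R - noise_corr i j).
  apply: eq_bigr => i _; apply: eq_bigr => j _.
  have [->|ji] := eqVneq j i.
    rewrite noise_corr_diag normr1 mulr1; lra.
  by rewrite mulr0 sub0r ler0_norm// noise_corr_le0 ?ltW// eq_sym.
under eq_bigr do rewrite sumrB.
rewrite sumrB sum_noise_corr.
have -> : \sum_(i < L) \sum_(j < L) 2 * (j == i)%:R = 2 * L%:R :> R.
  under eq_bigr => i _.
    rewrite (bigD1 i)//= eqxx mulr1 big1; last by move=> j /negPf ->; rewrite mulr0.
    rewrite addr0; over.
  by rewrite sumr_const card_ord mulr_natr.
by rewrite lerBlDr lerDl powR_ge0.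
Qed.

End noise_correlation.

(** * Quadratic variation of fractional Brownian motion *)

Section scalar_fBm.
Context {R : realType} {d : measure_display} {Omega : measurableType d}.
Variables (P : probability Omega R) (T H : R).
Hypothesis H01 : 0 < H < 1.
Local Notation itg X := (P.-integrable setT (EFin \o X)).
Local Notation "''E' X" := (\int[P]_w (X w))%R (at level 10).
Local Notation p := (2 * H).
Local Notation Hmax := (Num.max 2^-1 H).

Definition fBm_cov (s t : R) : R :=
  2^-1 * (t `^ p + s `^ p - `|t - s| `^ p).

(** What the estimates below use of a scalar fractional Brownian motion; every
    combination [\sum_k a_k B^k] with [\sum_k a_k ^ 2 = 1] has it. *)
Definition scalar_fBm (W : R -> Omega -> R) :=
  [/\ forall t, 0 <= t <= T -> L4 P (W t),
      forall s s' t t' a b, 0 <= s <= T -> 0 <= s' <= T -> 0 <= t <= T ->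
        0 <= t' <= T ->
        centered_gaussian P (fun w => a * (W s' w - W s w) + b * (W t' w - W t w))
    & forall s t, 0 <= s <= T -> 0 <= t <= T ->
        'E (fun w => W s w * W t w) = fBm_cov s t].

Variable W : R -> Omega -> R.
Hypothesis hW : scalar_fBm W.

Lemma increment_cov s s' t t' : 0 <= s <= T -> 0 <= s' <= T -> 0 <= t <= T ->
  0 <= t' <= T ->
  'E (fun w => (W s' w - W s w) * (W t' w - W t w)) =
  2^-1 * (`|t' - s| `^ p + `|t - s'| `^ p - `|t' - s'| `^ p - `|t - s| `^ p).
Proof.
have [LW _ cW] := hW; move=> hs hs' ht ht'.
have itgZ (c : R) X : itg X -> itg (fun w => c * X w).
  by move=> i; exact: (integrableZl measurableT c i).
have i1 := L4_integrableM _ _ _ (LW _ hs') (LW _ ht').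
have i2 := itgZ (-1) _ (L4_integrableM _ _ _ (LW _ hs') (LW _ ht)).
have i3 := itgZ (-1) _ (L4_integrableM _ _ _ (LW _ hs) (LW _ ht')).
have i4 := L4_integrableM _ _ _ (LW _ hs) (LW _ ht).
have i34 := integrableD measurableT i3 i4.
have i234 := integrableD measurableT i2 i34.
rewrite (_ : (fun w => _) = (fun w => W s' w * W t' w + (-1 * (W s' w * W t w) +
   (-1 * (W s w * W t' w) + W s w * W t w)))); last by apply/funext => w; ring.
rewrite (RintegralD measurableT i1 i234) (RintegralD measurableT i2 i34).
rewrite (RintegralD measurableT i3 i4).
rewrite !RintegralZl//; last 2 first.
- exact: L4_integrableM (LW _ hs) (LW _ ht').
- exact: L4_integrableM (LW _ hs') (LW _ ht).
by rewrite !cW// /fBm_cov; lra.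
Qed.

Section block.
Variables (t0 D : R) (L : nat).
Hypotheses (t00 : 0 <= t0) (D0 : 0 < D) (t0T : t0 + L%:R * D <= T).

Let g (j : nat) := t0 + j%:R * D.
Let Z (j : nat) w := W (g j.+1) w - W (g j) w.
Let v i j := 'E (fun w => Z i w * Z j w).

Let g_itv j : (j <= L)%N -> 0 <= g j <= T.
Proof.
move=> jL; rewrite addr_ge0 ?mulr_ge0 ?(ltW D0)//=.
by rewrite (le_trans _ t0T)// lerD2l ler_pM2r// ler_nat.
Qed.

Lemma grid_increment_cov i j : (i < L)%N -> (j < L)%N ->
  v i j = D `^ p * noise_corr p i j.
Proof.
move=> iL jL; rewrite /v /Z.
rewrite (increment_cov _ _ _ _ (g_itv _ (ltnW iL)) (g_itv _ iL) (g_itv _ (ltnW jL)) (g_itv _ jL)).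
have scal (x y c : R) : x - y = c * D -> `|x - y| `^ p = `|c| `^ p * D `^ p.
  by move=> ->; rewrite normrM (gtr0_norm D0) powRM// ltW.
rewrite (scal (g j.+1) (g i) (j%:R + 1 - i%:R)); last by rewrite /g -?natr1; ring.
rewrite (scal (g j) (g i.+1) (j%:R - i%:R - 1)); last by rewrite /g -?natr1; ring.
rewrite (scal (g j.+1) (g i.+1) (j%:R - i%:R)); last by rewrite /g -?natr1; ring.
rewrite (scal (g j) (g i) (j%:R - i%:R)); last by rewrite /g -?natr1; ring.
by rewrite /noise_corr; field.
Qed.

Let p02 : 0 < p < 2. Proof. by case/andP: H01; lra. Qed.

Let hZ i j : (i < L)%N -> (j < L)%N ->
    [/\ centered_gaussian P (Z i), centered_gaussian P (fun w => Z i w + Z j w)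
      & centered_gaussian P (fun w => Z i w - Z j w)].
Proof.
have [_ G _] := hW; move=> iL jL.
have h a b : centered_gaussian P (fun w => a * Z i w + b * Z j w).
  by apply: G; [exact/g_itv/ltnW|exact: g_itv|exact/g_itv/ltnW|exact: g_itv].
have := h 1 0; have := h 1 1; have := h 1 (-1).
rewrite (_ : (fun w => 1 * Z i w + 0 * Z j w) = Z i); last first.
  by apply/funext => w; rewrite mul1r mul0r addr0.
rewrite (_ : (fun w => 1 * Z i w + 1 * Z j w) = (fun w => Z i w + Z j w)); last first.
  by apply/funext => w; rewrite !mul1r.
rewrite (_ : (fun w => 1 * Z i w + -1 * Z j w) = (fun w => Z i w - Z j w)) //.
by apply/funext => w; rewrite mul1r mulN1r.
Qed.

Lemma noise_corr_le1 i j : (i < L)%N -> (j < L)%N -> `|noise_corr p i j| <= 1.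
Proof.
move=> iL jL; have Dp : 0 < D `^ p by rewrite powR_gt0.
have LZ k : (k < L)%N -> L4 P (Z k) by move=> hk; have [[]] := hZ k k hk hk.
have E2 (e : R) : 0 <= 'E (fun w => (Z i w + e * Z j w) ^+ 2).
  by apply: Rintegral_ge0 => w _; exact: sqr_ge0.
have {}E2 e : 0 <= v i i + (2 * e * v i j + e ^+ 2 * v j j).
  have := E2 e; have itgZ (c : R) X : itg X -> itg (fun w => c * X w).
    by move=> k; exact: (integrableZl measurableT c k).
  have k1 := L4_integrableM _ _ _ (LZ _ iL) (LZ _ iL).
  have k2 := L4_integrableM _ _ _ (LZ _ iL) (LZ _ jL).
  have k3 := L4_integrableM _ _ _ (LZ _ jL) (LZ _ jL).
  rewrite (_ : (fun w => _) = (fun w => Z i w * Z i w +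
      ((2 * e) * (Z i w * Z j w) + e ^+ 2 * (Z j w * Z j w)))); last first.
    by apply/funext => w; ring.
  have k4 := integrableD measurableT (itgZ (2 * e) _ k2) (itgZ (e ^+ 2) _ k3).
  rewrite (RintegralD measurableT k1 k4).
  rewrite (RintegralD measurableT (itgZ (2 * e) _ k2) (itgZ (e ^+ 2) _ k3)).
  by rewrite (RintegralZl _ measurableT k2) (RintegralZl _ measurableT k3).
have := E2 1; have := E2 (-1); rewrite !grid_increment_cov//.
rewrite !noise_corr_diag// ler_norml => h1 h2; apply/andP; split.
  by rewrite -(ler_pM2l Dp); lra.
by rewrite -(ler_pM2l Dp); lra.
Qed.

(** Up to the factor [D ^ 2], the variance of [Q] is twice the sum of the
    squared correlations, at most [4 * L ^ (2 * Hmax)] since correlations are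
    at most 1 in absolute value; the first absolute moment is at most the
    standard deviation. *)
Lemma block_mean_abs :
  let Q w := D `^ (1 - p) * \sum_(j < L) (W (g j.+1) w - W (g j) w) ^+ 2
             - L%:R * D in
  itg (fun w => `|Q w|) /\
  'E (fun w => `|Q w|) <= 2 * D * L%:R `^ Hmax.
Proof.
move=> Q.
have [L0|L0] := posnP L.
  have -> : (fun w => `|Q w|) = (fun=> 0).
    apply/funext => w; rewrite /Q L0 big_ord0 mulr0 mul0r subr0.
    exact: normr0.
  split; first exact: itg_cst.
  by rewrite Rintegral_cst// mul0r !mulr_ge0 ?powR_ge0 ?(ltW D0).
have Dp : D `^ (1 - p) * D `^ p = D.
  by rewrite -powRD ?subrK ?powRr1 ?(ltW D0)// gt_eqF// implybT.
have [iS ES] := gaussian_quadratic_variance P L Z hZ.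
rewrite /= in iS ES.
have QE w : Q w = D `^ (1 - p) * \sum_(i < L) (Z i w ^+ 2 - v i i).
  rewrite sumrB mulrBr; congr (_ - _).
  rewrite (eq_bigr (fun=> D `^ p)); last first.
    by move=> i _; rewrite grid_increment_cov// noise_corr_diag// mulr1.
  by rewrite sumr_const card_ord mulrnAr Dp mulr_natl.
have iQ : itg (fun w => Q w ^+ 2).
  under eq_fun do rewrite QE exprMn.
  exact: (integrableZl measurableT ((D `^ (1 - p)) ^+ 2) iS).
set b := 2 * D * L%:R `^ Hmax.
have b0 : 0 < b by rewrite !mulr_gt0// powR_gt0// ltr0n.
have EQ : 'E (fun w => Q w ^+ 2) <= b ^+ 2.
  under eq_Rintegral do rewrite QE exprMn.
  rewrite (RintegralZl _ measurableT iS) ES.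
  apply: (@le_trans _ _ (D `^ (1 - p) ^+ 2 * (2 * \sum_(i < L) \sum_(j < L)
      (D `^ p) ^+ 2 * `|noise_corr p i j|))).
    rewrite ler_wpM2l ?sqr_ge0// ler_wpM2l//.
    apply: ler_sum => i _; apply: ler_sum => j _.
    rewrite -/(v i j) grid_increment_cov// exprMn ler_wpM2l ?sqr_ge0//.
    rewrite -real_normK ?num_real// expr2 ler_piMl//.
    exact: noise_corr_le1.
  under eq_bigr do rewrite -mulr_sumr.
  rewrite -mulr_sumr.
  have -> (x y s : R) : x ^+ 2 * (2 * (y ^+ 2 * s)) = (x * y) ^+ 2 * (2 * s).
    by ring.
  have LH : (L%:R `^ Hmax) ^+ 2 = L%:R `^ Num.max 1 p :> R.
    rewrite -powR_mulrn ?powR_ge0// -powRrM; congr (_ `^ _).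
    by rewrite maxr_pMl// mulVf// mulrC.
  rewrite Dp /b !exprMn LH.
  have -> (x y : R) : 2 ^+ 2 * x * y = x * (2 * (2 * y)) by ring.
  by rewrite ler_wpM2l ?sqr_ge0// ler_wpM2l// sum_abs_noise_corr.
have iA : itg (fun w => `|Q w|).
  suff : itg Q by exact: integrable_abse.
  rewrite (funext QE).
  suff s : itg (fun w => \sum_(i < L) (Z i w ^+ 2 - v i i)).
    exact: (integrableZl measurableT (D `^ (1 - p)) s).
  apply: (itg_sum P _ _ (fun (i : 'I_L) w => Z i w ^+ 2 - v i i)) => i.
  have [[LZ _ _] _ _] := hZ i i (ltn_ord i) (ltn_ord i).
  exact: (integrableB measurableT (L4_integrable_sqr _ _ LZ) (itg_cst P _)).
split => //.
(* |Q| <= (Q^2 / b + b) / 2 replaces the Cauchy-Schwarz inequality. *)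
have i2 := integrableD measurableT (integrableZl measurableT (b^-1 / 2) iQ)
   (itg_cst P (b / 2)).
apply: (@le_trans _ _ ('E (fun w => b^-1 / 2 * Q w ^+ 2 + b / 2))).
  apply: le_Rintegral => // w _; rewrite -(real_normK (num_real (Q w))).
  set x := `|Q w|; rewrite -subr_ge0.
  have -> : b^-1 / 2 * x ^+ 2 + b / 2 - x = b^-1 / 2 * (x - b) ^+ 2.
    by field; rewrite gt_eqF.
  by rewrite mulr_ge0 ?sqr_ge0// divr_ge0// invr_ge0 ltW.
rewrite (RintegralD measurableT (integrableZl measurableT (b^-1 / 2) iQ) (itg_cst P (b / 2))).
rewrite (RintegralZl _ measurableT iQ) expectation_cst.
apply: (@le_trans _ _ (b^-1 / 2 * b ^+ 2 + b / 2)).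
  by rewrite lerD2r ler_wpM2l// divr_ge0// invr_ge0 ltW.
by rewrite le_eqVlt; apply/orP; left; apply/eqP; field; rewrite gt_eqF.
Qed.

End block.
End scalar_fBm.

(** * Almost sure rate of the block quadratic covariations *)

(** Markov's inequality and the Borel-Cantelli lemma in one step: the series
    of the [X n] has finite expectation, so it converges almost surely. *)
Lemma ae_bounded_of_geometric_mean (R : realType) (d : measure_display)
    (Omega : measurableType d) (P : probability Omega R)
    (X : nat -> Omega -> R) (A q : R) :
  0 < q < 1 -> (forall n, P.-integrable setT (EFin \o X n)) ->
  (forall n w, 0 <= X n w) ->
  (forall n, \int[P]_w X n w <= A * q ^+ n) ->
  {ae P, forall w, exists C, forall n, X n w <= C}.
Proof.
move=> /andP[q0 q1] iX X0 EX.
have A0 : 0 <= A.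
  have := EX 0%N; rewrite expr0 mulr1; apply: le_trans.
  by apply: Rintegral_ge0 => w _; exact: X0.
have mX n : measurable_fun setT (EFin \o X n) by case/integrableP: (iX n).
have mS : measurable_fun setT (fun w => \sum_(n <oo) (X n w)%:E)%E.
  apply: (@ge0_emeasurable_sum _ _ _ setT (fun n w => (X n w)%:E) xpredT).
    by move=> n w _ _; rewrite lee_fin.
  by move=> n _; exact: mX.
have : P.-integrable setT (fun w => \sum_(n <oo) (X n w)%:E)%E.
  apply/integrableP; split=> //.
  under eq_integral => w _.
    rewrite gee0_abs; last by apply: nneseries_ge0 => n _ _; rewrite lee_fin.
    over.
  rewrite integral_nneseries//; last by move=> n w _; rewrite lee_fin.
  apply: (@le_lt_trans _ _ (A / (1 - q))%:E); last exact: ltry.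
  apply: lime_le.
    by apply: is_cvg_nneseries => n _ _; apply: integral_ge0 => w _; rewrite lee_fin.
  apply: nearW => n; apply: (@le_trans _ _ (\sum_(0 <= k < n) (A * q ^+ k)%:E)%E).
    apply: lee_sum => k _; have := EX k; rewrite -lee_fin /Rintegral fineK//.
    exact: (integrable_fin_num measurableT (iX k)).
  rewrite sumEFin lee_fin; apply: (geometric_le_lim n A0 q0).
  by rewrite gtr0_norm.
move=> /(integrable_ae measurableT); apply: filterS => w /(_ I) fin.
exists (fine (\sum_(n <oo) (X n w)%:E)%E) => n.
rewrite -lee_fin fineK//.
apply: le_trans (@nneseries_lim_ge _ (fun n => (X n w)%:E) xpredT 0 n.+1 _); last first.
  by move=> k _ _; rewrite lee_fin.
rewrite big_nat_recr//= leeDr//.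
by apply: sume_ge0 => k _; rewrite lee_fin.
Qed.

Section blocks.
Context {R : realType}.
Variables (T H : R).
Hypotheses (T0 : 0 < T) (H01 : 0 < H < 1).
Local Notation Hmax := (Num.max 2^-1 H).

(** The [2 ^ n] increments are grouped into [2 ^ coarse_level n] blocks, of
    length about [T * 2 ^ (- n (1 - Hmax))].  With this length the Hölder
    oscillation of an integrand over a block has the order required by the
    theorem, and the quadratic variation inside the blocks still concentrates. *)
Definition coarse_level (n : nat) : nat := Num.truncn (n%:R * (1 - Hmax)).

Definition block_covariation (n c : nat) (x y : R -> R) : R :=
  let L := (2 ^ (n - coarse_level n))%N in
  (T / 2 ^+ n) `^ (1 - 2 * H) *
  \sum_(j < L) delta x (dyadic T n (c * L + j)) (dyadic T n (c * L + j).+1)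
             * delta y (dyadic T n (c * L + j)) (dyadic T n (c * L + j).+1).

Definition covariation_defect (kap : R) (n : nat) (x y : R -> R) : R :=
  \sum_(c < (2 ^ coarse_level n)%N)
    `|block_covariation n c x y - kap * (T / 2 ^+ coarse_level n)|.

Lemma Hmax_itv : 2^-1 <= Hmax < 1.
Proof. by rewrite le_max lexx/= gt_max; case/andP: H01 => _ ->; rewrite invf_lt1 ?ltr1n. Qed.

Lemma coarse_level_itv n :
  n%:R * (1 - Hmax) - 1 <= (coarse_level n)%:R <= n%:R * (1 - Hmax).
Proof.
have /andP[_ h1] := Hmax_itv.
have h : 0 <= n%:R * (1 - Hmax) by rewrite mulr_ge0// subr_ge0 ltW.
have /andP[-> h2] := truncn_itv h; rewrite andbT lerBlDr natr1.
exact: ltW.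
Qed.

Lemma coarse_level_le n : (coarse_level n <= n)%N.
Proof.
have /andP[_ h] := coarse_level_itv n; rewrite -(ler_nat R).
apply: le_trans h _; have /andP[h1 _] := Hmax_itv.
by rewrite ler_piMr//; lra.
Qed.

Lemma dyadic_block n c j :
  dyadic T n (c * 2 ^ (n - coarse_level n) + j) =
  dyadic T (coarse_level n) c + j%:R * (T / 2 ^+ n).
Proof.
have hl := coarse_level_le n; have e2 k : 2 ^+ k != 0 :> R by rewrite expf_neq0.
rewrite /dyadic natrD natrM natrX.
rewrite mulrDl mulrDl; congr (_ + _); last by rewrite mulrA.
rewrite -[in X in _ / X](subnK hl) exprD; field; by rewrite !e2.
Qed.

End blocks.

Section defect_mean.
Context {R : realType} {d : measure_display} {Omega : measurableType d}.
Variables (P : probability Omega R) (T H : R).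
Hypotheses (T0 : 0 < T) (H01 : 0 < H < 1).
Local Notation itg X := (P.-integrable setT (EFin \o X)).
Local Notation "''E' X" := (\int[P]_w (X w))%R (at level 10).
Local Notation Hmax := (Num.max 2^-1 H).
Local Notation rho := (Hmax * (1 - Hmax)).

(** Each block has [2 ^ (n - coarse_level n)] steps, and
    [n - coarse_level n >= n * Hmax]. *)
Lemma defect_mean (W : R -> Omega -> R) n : scalar_fBm P T H W ->
  let X w := covariation_defect T H 1 n (fun t => W t w) (fun t => W t w) in
  itg X /\ 'E X <= 2 * T * (2 `^ (- rho)) ^+ n.
Proof.
move=> hW X; set m := coarse_level H n; have mn : (m <= n)%N := coarse_level_le H H01 n.
set L := (2 ^ (n - m))%N; set D := T / 2 ^+ n.
have D0 : 0 < D by rewrite divr_gt0// exprn_gt0.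
have LD : L%:R * D = T / 2 ^+ m.
  rewrite /L natrX /D -[in X in _ / X](subnK mn) exprD.
  by field; rewrite !expf_neq0.
pose Y c w := `|D `^ (1 - 2 * H) * \sum_(j < L)
   (W (dyadic T m c + j.+1%:R * D) w - W (dyadic T m c + j%:R * D) w) ^+ 2
   - L%:R * D|.
have XE : X = (fun w => \sum_(c < (2 ^ m)%N) Y c w).
  apply/funext => w; rewrite /X /covariation_defect; apply: eq_bigr => c _.
  rewrite /Y mul1r -/m LD; congr `|_ * _ - _|; apply: eq_bigr => j _.
  by rewrite -addnS !dyadic_block// -/m -/D expr2 /delta.
have hY c : (c < 2 ^ m)%N -> itg (Y c) /\ 'E (Y c) <= 2 * D * L%:R `^ Hmax.
  move=> hc; apply: (block_mean_abs P T H H01 W hW) => //.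
    by rewrite /dyadic divr_ge0 ?mulr_ge0 ?exprn_ge0// ltW.
  rewrite LD /dyadic -mulrA -{2}(mul1r (T / _)) -mulrDl natr1.
  have -> : T = (2 ^ m)%:R * (T / 2 ^+ m).
    by rewrite natrX mulrCA mulfV ?mulr1// expf_neq0.
  rewrite [X in _ * (X / _)](_ : _ = T); last first.
    by rewrite natrX mulrCA mulfV ?mulr1// expf_neq0.
  by rewrite ler_wpM2r ?ler_nat// divr_ge0 ?exprn_ge0// ltW.
rewrite XE; split; first by apply: itg_sum => c; case: (hY c (ltn_ord c)).
rewrite expectation_sum; last by move=> c; case: (hY c (ltn_ord c)).
apply: (@le_trans _ _ (\sum_(c < (2 ^ m)%N) 2 * D * L%:R `^ Hmax)).
  by apply: ler_sum => c _; case: (hY c (ltn_ord c)).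
rewrite sumr_const card_ord -(mulr_natl _ (2 ^ m)).
have LE : L%:R = 2 `^ (n%:R - m%:R) :> R.
  by rewrite -natrB// powR_mulrn// natrX.
have -> : (2 ^ m)%:R * (2 * D * L%:R `^ Hmax) = 2 * T * 2 `^ (-((n%:R - m%:R) * (1 - Hmax))).
  have -> : D = T / 2 ^+ m / L%:R.
    by rewrite -LD mulrAC divff ?mul1r// gt_eqF// ltr0n expn_gt0.
  have -> : - ((n%:R - m%:R) * (1 - Hmax)) = (n%:R - m%:R) * Hmax - (n%:R - m%:R) by ring.
  rewrite natrX LE [in RHS]powRD ?pnatr_eq0 ?implybT// (powRrM 2) powRN.
  by field; rewrite expf_neq0// gt_eqF// powR_gt0.
rewrite ler_wpM2l ?mulr_ge0 ?(ltW T0)// -powR_mulrn ?powR_ge0// -powRrM.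
apply: ler_powR; first by rewrite ler1n.
have /andP[_ hm] := coarse_level_itv H H01 n; rewrite -/m in hm.
have /andP[h1 h2] := Hmax_itv H H01.
rewrite mulNr lerN2 (_ : _ * n%:R = n%:R * Hmax * (1 - Hmax)); last by ring.
rewrite ler_wpM2r ?subr_ge0 ?(ltW h2)//.
by move: hm; rewrite mulrBr mulr1; lra.
Qed.

End defect_mean.

Lemma powR2_lt1 (R : realType) (x : R) : x < 0 -> 2 `^ x < 1.
Proof.
move=> x0; rewrite lt_neqAle powR_eq1 (lt_eqF x0) orbF negb_or -leNgt ler0n andbT.
rewrite -[leRHS](powRr0 2) ler_powR ?ler1n ?(ltW x0)// andbT.
by rewrite gt_eqF// ltr1n.
Qed.

Section fBm.
Context {R : realType} {d : measure_display} {Omega : measurableType d}.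
Variables (P : probability Omega R) (K : nat) (T H : R).
Hypotheses (T0 : 0 < T) (H01 : 0 < H < 1).
Variable B : R -> 'I_K -> {RV P >-> R}.
Hypothesis hB : is_fBm T H B.
Local Notation itg X := (P.-integrable setT (EFin \o X)).
Local Notation "''E' X" := (\int[P]_w (X w))%R (at level 10).
Local Notation Hmax := (Num.max 2^-1 H).

Lemma sum_pick (I : finType) (i : I) (F : I -> R) :
  \sum_j (j == i)%:R * F j = F i.
Proof.
rewrite (bigD1 i)//= eqxx mul1r big1 ?addr0// => j /negPf ->.
by rewrite mul0r.
Qed.

Lemma fBm_L4 t k : 0 <= t <= T -> L4 P (B t k).
Proof.
case: hB => [gB EB _ _] ht.
have := gB 1%N (fun=> t) (fun _ l => (l == k)%:R) (fun=> ht).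
rewrite (_ : (fun w => _) = B t k); last first.
  by apply/funext => w; rewrite big_ord1 sum_pick.
have := EB t k ht; rewrite unlock => E0 g.
by case: (gaussian_centered P (B t k) (measurable_funPT (B t k)) g E0).
Qed.

Lemma fBm_mean0 t k : 0 <= t <= T -> 'E (B t k) = 0.
Proof. by case: hB => [_ EB _ _] ht; have := EB t k ht; rewrite /Rintegral unlock => ->. Qed.

Lemma fBm_centered N (t : 'I_N -> R) (c : 'I_N -> 'I_K -> R) :
  (forall i, 0 <= t i <= T) ->
  centered_gaussian P (fun w => \sum_i \sum_k c i k * B (t i) k w).
Proof.
move=> ht; have [gB EB _ _] := hB.
have iB i k : itg (fun w => c i k * B (t i) k w).
  exact: (integrableZl measurableT (c i k) (L4_integrable P _ (fBm_L4 _ k (ht i)))).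
have iS i : itg (fun w => \sum_k c i k * B (t i) k w).
  exact: (itg_sum P _ _ (fun k w => c i k * B (t i) k w)).
have i2 : itg (fun w => \sum_i \sum_k c i k * B (t i) k w).
  exact: (itg_sum P _ _ (fun i w => \sum_k c i k * B (t i) k w)).
apply: gaussian_centered.
- by apply/measurable_EFinP; case/integrableP: i2.
- exact: gB.
- rewrite -[LHS]fineK; last exact: integrable_fin_num.
  rewrite -[fine _]/('E (fun w => \sum_i \sum_k c i k * B (t i) k w)).
  rewrite (expectation_sum P _ _ (fun i w => \sum_k c i k * B (t i) k w))//.
  rewrite big1// => i _.
  rewrite (expectation_sum P _ _ (fun k w => c i k * B (t i) k w))// big1// => k _.
  rewrite (RintegralZl _ measurableT (L4_integrable P _ (fBm_L4 _ k (ht i)))).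
  by rewrite fBm_mean0// mulr0.
Qed.

Lemma fBm_combination (a : 'I_K -> R) : \sum_k a k ^+ 2 = 1 ->
  scalar_fBm P T H (fun t w => \sum_k a k * B t k w).
Proof.
move=> a1; split.
- move=> t ht; have := fBm_centered 1 (fun=> t) (fun=> a) (fun=> ht).
  by under eq_fun do rewrite big_ord1; case.
- move=> s s' t t' x z hs hs' ht ht'.
  have := fBm_centered 4 (fun i => nth 0 [:: s'; s; t'; t] i)
    (fun i k => nth 0 [:: x; - x; z; - z] i * a k).
  rewrite (_ : (fun w => _) = (fun w =>
    x * (\sum_k a k * B s' k w - \sum_k a k * B s k w) +
    z * (\sum_k a k * B t' k w - \sum_k a k * B t k w))); last first.
    apply/funext => w; rewrite !big_ord_recl big_ord0 /= addr0.
    have E e u : \sum_k e * a k * B u k w = e * \sum_k a k * B u k w.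
      by rewrite mulr_sumr; apply: eq_bigr => k _; rewrite mulrA.
    by rewrite !E; ring.
  by apply => -[[|[|[|[|i]]]]].
- move=> s t hs ht.
  have [_ _ cov _] := hB.
  have LB k u : 0 <= u <= T -> L4 P (B u k) by move=> hu; exact: fBm_L4.
  have iB k l : itg (fun w => B s k w * B t l w).
    exact: L4_integrableM (LB _ _ hs) (LB _ _ ht).
  have iF k l : itg (fun w => (a k * a l) * (B s k w * B t l w)).
    exact: (integrableZl measurableT (a k * a l) (iB k l)).
  rewrite (_ : (fun w => _) = (fun w => \sum_k \sum_l (a k * a l) * (B s k w * B t l w))); last first.
    apply/funext => w; rewrite big_distrlr/=; apply: eq_bigr => k _.
    by apply: eq_bigr => l _; ring.
  rewrite (expectation_sum P _ _ (fun k w => \sum_l (a k * a l) * (B s k w * B t l w))); last first.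
    by move=> k; apply: (itg_sum P _ _ (fun l w => (a k * a l) * (B s k w * B t l w))).
  transitivity (\sum_k a k ^+ 2 * fBm_cov H s t); last by rewrite -mulr_suml a1 mul1r.
  apply: eq_bigr => k _.
  rewrite (expectation_sum P _ _ (fun l w => (a k * a l) * (B s k w * B t l w)))//.
  rewrite expr2 -mulrA -(sum_pick _ k (fun l => a k * (a l * fBm_cov H s t))).
  apply: eq_bigr => l _; rewrite (RintegralZl _ measurableT (iB k l)).
  have := cov t s k l ht hs; rewrite unlock => e.
  rewrite [X in _ * X = _]/Rintegral e/= eq_sym.
  by rewrite /fBm_cov distrC (addrC (s `^ _)); ring.
Qed.

Variable r : R.
Hypothesis hr : r < Hmax * (1 - Hmax).

Lemma scalar_fBm_rate (W : R -> Omega -> R) : scalar_fBm P T H W ->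
  {ae P, forall w, exists C, forall n,
     covariation_defect T H 1 n (fun t => W t w) (fun t => W t w)
     <= C * 2 `^ (- (r * n%:R))}.
Proof.
move=> hW.
set q := 2 `^ (r - Hmax * (1 - Hmax)).
pose X n w := 2 `^ (r * n%:R) *
   covariation_defect T H 1 n (fun t => W t w) (fun t => W t w).
have hX n := defect_mean P T H T0 H01 W n hW.
have q01 : 0 < q < 1 by rewrite powR_gt0//= powR2_lt1// subr_lt0.
apply: filterS (@ae_bounded_of_geometric_mean _ _ _ P X (2 * T) q q01 _ _ _).
- move=> w [C hC]; exists C => n.
  have := hC n; rewrite /X -ler_pdivlMl ?powR_gt0// => /le_trans; apply.
  by rewrite powRN mulrC.
- by move=> n; exact: (integrableZl measurableT (2 `^ (r * n%:R)) (hX n).1).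
- by move=> n w; rewrite mulr_ge0 ?powR_ge0// sumr_ge0.
- move=> n; rewrite /X (RintegralZl _ measurableT (hX n).1).
  apply: le_trans (ler_wpM2l (powR_ge0 _ _) (hX n).2) _.
  rewrite mulrCA /q powRD ?pnatr_eq0 ?implybT// exprMn.
  by rewrite powRrM powR_mulrn ?powR_ge0.
Qed.

(** Polarisation: the cross products are half the difference of the squares
    of [(B^k + B^l) / sqrt 2] and [(B^k - B^l) / sqrt 2]. *)
Lemma fBm_covariation_rate : {ae P, forall w, forall k l, exists C, forall n,
  covariation_defect T H (k == l)%:R n (fun t => B t k w) (fun t => B t l w)
  <= C * 2 `^ (- (r * n%:R))}.
Proof.
apply: filter_forall => k; apply: filter_forall => l.
have [<-|kl] := eqVneq k l.
  have h1 : \sum_j ((j == k)%:R : R) ^+ 2 = 1.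
    by under eq_bigr do rewrite expr2; rewrite sum_pick eqxx.
  have := fBm_combination _ h1.
  rewrite (_ : (fun t w => _) = (fun t => B t k : Omega -> R)); last first.
    by apply/funext => t; apply/funext => w; rewrite sum_pick.
  by move/scalar_fBm_rate.
pose a (e : R) j : R := (j == k)%:R / Num.sqrt 2 + (j == l)%:R * e / Num.sqrt 2.
have s2 : Num.sqrt 2 ^+ 2 = 2 :> R by rewrite sqr_sqrtr.
have s20 : Num.sqrt 2 != 0 :> R by rewrite gt_eqF// sqrtr_gt0.
have aE e u w : \sum_j a e j * B u j w = (B u k w + e * B u l w) / Num.sqrt 2.
  transitivity (\sum_j ((j == k)%:R * (B u j w / Num.sqrt 2) +
                        (j == l)%:R * (e * B u j w / Num.sqrt 2))).
    by apply: eq_bigr => j _; rewrite /a; ring.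
  by rewrite big_split/= !sum_pick -mulrDl.
have a1 e : e ^+ 2 = 1 -> \sum_j a e j ^+ 2 = 1.
  move=> e1; transitivity (\sum_j ((j == k)%:R * (1 / 2 : R) + (j == l)%:R * (1 / 2))).
    apply: eq_bigr => j _; rewrite /a.
    have [->|jk] := eqVneq j k.
      by rewrite (negPf kl) !(mul0r, mul1r, addr0) exprVn s2.
    by case: eqVneq => _; rewrite !(mul0r, mul1r, addr0, add0r) ?expr0n// exprMn exprVn s2 e1 mul1r.
  by rewrite big_split/= !(sum_pick _ _ (fun=> 1 / 2)) -mulr2n -mulr_natl; field.
have := scalar_fBm_rate _ (fBm_combination _ (a1 1 (expr1n _ _))).
have e2 : (-1) ^+ 2 = 1 :> R by rewrite sqrrN expr1n.
have := scalar_fBm_rate _ (fBm_combination _ (a1 (-1) e2)).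
apply: filterS2 => w [C hC] [D hD]; exists ((C + D) / 2) => n.
have -> : (C + D) / 2 * 2 `^ (- (r * n%:R)) =
  (C * 2 `^ (- (r * n%:R)) + D * 2 `^ (- (r * n%:R))) / 2 by ring.
rewrite ler_pdivlMr//; apply: le_trans (lerD (hC n) (hD n)).
rewrite /covariation_defect -big_split/= mulr_suml; apply: ler_sum => c _.
set x := block_covariation _ _ _ _ _ _; set y := block_covariation _ _ _ _ _ _.
set z := block_covariation _ _ _ _ _ _.
have -> : x = (z - y) / 2.
  rewrite /x /y /z /block_covariation -mulrBr -sumrB -mulrA; congr (_ * _).
  rewrite mulr_suml; apply: eq_bigr => j _; rewrite /delta !aE.
  have sq (p q : R) : (p / Num.sqrt 2 - q / Num.sqrt 2) *
      (p / Num.sqrt 2 - q / Num.sqrt 2) = (p - q) ^+ 2 / 2.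
    by rewrite -mulrBl -expr2 exprMn exprVn s2.
  by rewrite !sq; field.
rewrite mul0r subr0 mul1r normrM [`|2^-1|]ger0_norm// divfK ?pnatr_eq0//.
set h := T / _; rewrite (_ : z - y = (z - h) - (y - h)); last by ring.
by rewrite addrC; exact: ler_normB.
Qed.
End fBm.

(** * Exponential rates along the dyadic partitions *)

Section decays.
Context {R : realType}.
Implicit Types (r C : R) (e : nat -> R).

(** The constant may depend on anything but [n]: along a path only exponents
    matter. *)
Definition decays r e :=
  exists C, \forall n \near \oo, `|e n| <= C * 2 `^ (- (r * n%:R)).

Lemma decays_le r e e' :
  (\forall n \near \oo, `|e n| <= `|e' n|) -> decays r e' -> decays r e.
Proof.
move=> le [C hC]; exists C; near=> n; apply: (@le_trans _ _ `|e' n|).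
  by near: n.
by near: n.
Unshelve. all: by end_near. Qed.

Lemma decaysN r e : decays r e -> decays r (fun n => - e n).
Proof.
move=> [C hC]; exists C; near=> n; rewrite normrN; near: n; exact: hC.
Unshelve. all: by end_near. Qed.

Lemma decaysD r e e' : decays r e -> decays r e' -> decays r (fun n => e n + e' n).
Proof.
move=> [C hC] [C' hC']; exists (C + C'); near=> n.
by rewrite mulrDl (le_trans (ler_normD _ _))// lerD//; near: n.
Unshelve. all: by end_near. Qed.

Lemma decaysB r e e' : decays r e -> decays r e' -> decays r (fun n => e n - e' n).
Proof. by move=> h /decaysN; exact: decaysD. Qed.

Lemma decays0 r : decays r (fun=> 0).
Proof. by exists 0; near=> n; rewrite normr0 mul0r. Unshelve. all: by end_near. Qed.

Lemma decays_sum r (I : Type) (s : seq I) (e : I -> nat -> R) :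
  (forall i, decays r (e i)) -> decays r (fun n => \sum_(i <- s) e i n).
Proof.
move=> h; elim: s => [|i s IH].
  by under eq_fun do rewrite big_nil; exact: decays0.
by under eq_fun do rewrite big_cons; exact: decaysD.
Qed.

Lemma decaysM r e b (M : R) : (\forall n \near \oo, `|b n| <= M) ->
  decays r e -> decays r (fun n => b n * e n).
Proof.
move=> hb [C hC]; exists (M * C); near=> n.
rewrite normrM -mulrA ler_pM//; near: n.
- exact: hb.
- exact: hC.
Unshelve. all: by end_near. Qed.

Lemma decaysZ r e c : decays r e -> decays r (fun n => c * e n).
Proof. by apply: (decaysM _ _ (fun=> c) `|c|); exact: nearW. Qed.

Lemma decays_pow r (a x : R) : 0 < a -> r <= x ->
  decays r (fun n => (a / 2 ^+ n) `^ x).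
Proof.
move=> a0 rx; exists (a `^ x); near=> n.
rewrite ger0_norm ?powR_ge0// powRM ?invr_ge0 ?exprn_ge0 ?(ltW a0)//.
rewrite ler_wpM2l ?powR_ge0// -powR_mulrn// -powRN -powRrM.
by apply: ler_powR; rewrite ?ler1n// mulNr lerN2 mulrC ler_wpM2l.
Unshelve. all: by end_near. Qed.

Lemma powR2_cvg0 (r : R) : 0 < r -> 2 `^ (- (r * n%:R)) @[n --> \oo] --> (0 : R).
Proof.
move=> r0; have -> : (fun n : nat => 2 `^ (- (r * n%:R))) =
    (fun n => geometric 1 (2 `^ (- r)) n) :> (nat -> R).
  by apply/funext => n; rewrite /= mul1r -powR_mulrn ?powR_ge0// -powRrM mulNr.
apply: cvg_geometric; rewrite ger0_norm ?powR_ge0// powR2_lt1//.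
by rewrite oppr_lt0.
Qed.

Lemma decays_cvg0 r e : 0 < r -> decays r e -> e n @[n --> \oo] --> 0.
Proof.
move=> r0 [C hC]; apply/cvgr0Pnorm_le => x x0.
have h : (`|C| * 2 `^ (- (r * n%:R))) @[n --> \oo] --> 0.
  by rewrite -(mulr0 `|C|); apply: cvgMr; exact: powR2_cvg0.
move/cvgr0Pnorm_le : h => /(_ x x0) h; near=> n.
have h1 : `|e n| <= C * 2 `^ (- (r * n%:R)) by near: n.
apply: le_trans h1 _; apply: le_trans (ler_norm _) _.
by rewrite normrM -normr_id -normrM; near: n.
Unshelve. all: by end_near. Qed.

Lemma decays_cvg r e l : 0 < r -> decays r (fun n => e n - l) -> e n @[n --> \oo] --> l.
Proof. by move=> r0 /(decays_cvg0 _ _ r0) h; apply/subr_cvg0. Qed.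

End decays.

(** * Hölder functions and Riemann sums *)

Section holder.
Context {R : realType}.
Implicit Types (T a C : R) (g h : R -> R).
Local Notation mu := (@lebesgue_measure R).

Definition holder_on T a g := exists2 C, 0 <= C &
  forall s t, 0 <= s -> s <= t -> t <= T -> `|g t - g s| <= C * (t - s) `^ a.

Lemma holder_on_bounded T a g : 0 <= a -> holder_on T a g ->
  exists2 A, 0 <= A & forall t, 0 <= t <= T -> `|g t| <= A.
Proof.
move=> a0 [C C0 hC]; exists (C * T `^ a + `|g 0|).
  by rewrite addr_ge0// mulr_ge0// powR_ge0.
move=> t /andP[t0 tT]; rewrite -[g t](subrK (g 0)) (le_trans (ler_normD _ _))//.
rewrite lerD2r (le_trans (hC _ _ _ t0 tT))// ler_wpM2l// subr0.
by rewrite ge0_ler_powR// nnegrE// (le_trans t0).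
Qed.

Lemma holder_onM T a g h : 0 <= a -> holder_on T a g -> holder_on T a h ->
  holder_on T a (fun t => g t * h t).
Proof.
move=> a0 hg hh; have [A A0 gA] := holder_on_bounded _ _ _ a0 hg.
have [B B0 hB] := holder_on_bounded _ _ _ a0 hh.
case: hg hh => [C C0 hC] [D D0 hD]; exists (A * D + C * B).
  by rewrite addr_ge0// mulr_ge0.
move=> s t s0 st tT.
have -> : g t * h t - g s * h s = g t * (h t - h s) + (g t - g s) * h s by ring.
rewrite (le_trans (ler_normD _ _))// !normrM mulrDl lerD//.
  by rewrite -mulrA ler_pM ?gA ?hD// (le_trans s0).
by rewrite -mulrA (mulrC B) mulrA ler_pM ?hB ?hC// s0 (le_trans st).
Qed.

Lemma holder_onD T a g h : holder_on T a g -> holder_on T a h ->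
  holder_on T a (fun t => g t + h t).
Proof.
move=> [C C0 hC] [D D0 hD]; exists (C + D); first by rewrite addr_ge0.
move=> s t s0 st tT; rewrite opprD addrACA mulrDl (le_trans (ler_normD _ _))//.
by rewrite lerD ?hC ?hD.
Qed.

Lemma holder_on_sum T a (I : Type) (r : seq I) (g : I -> R -> R) :
  (forall i, holder_on T a (g i)) -> holder_on T a (fun t => \sum_(i <- r) g i t).
Proof.
move=> h; elim: r => [|i r IH].
  under eq_fun do rewrite big_nil; exists 0 => // *.
  by rewrite subrr normr0 mul0r.
by under eq_fun do rewrite big_cons; exact: holder_onD.
Qed.

Lemma holder_continuous (V : normedModType R) T a C (g : R -> V) :
  0 < a -> 0 <= C ->
  (forall s t, 0 <= s -> s <= t -> t <= T -> `|g t - g s| <= C * (t - s) `^ a) ->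
  {within `[0, T], continuous g}.
Proof.
move=> a0 C0 hC.
have hC' s t : 0 <= s <= T -> 0 <= t <= T -> `|g t - g s| <= C * `|t - s| `^ a.
  move=> /andP[s0 sT] /andP[t0 tT]; have [st|ts] := leP s t.
    by rewrite (ger0_norm (x := t - s)) ?subr_ge0// hC.
  by rewrite (distrC (g t)) (distrC t) (ger0_norm (x := s - t)) ?subr_ge0 ?(ltW ts)// hC// ltW.
apply/subspace_continuousP => x xT; apply/cvgrPdist_le => e e0.
pose dl := (e / (C + 1)) `^ a^-1.
have C1 : 0 < C + 1 by rewrite ltr_wpDl.
have dl0 : 0 < dl by rewrite powR_gt0// divr_gt0.
have hdl : dl `^ a = e / (C + 1).
  by rewrite /dl -powRrM mulVf ?gt_eqF// powRr1// divr_ge0 ?ltW.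
rewrite near_withinE; near=> z => zT.
rewrite distrC (le_trans (hC' _ _ _ _))//; try by move: xT zT; rewrite /= !in_itv.
apply: (@le_trans _ _ (C * (e / (C + 1)))).
  have zx : `|z - x| <= dl.
    by rewrite distrC; near: z; apply: cvgr_dist_le; [exact: cvg_id|].
  rewrite ler_wpM2l// -hdl; apply: ge0_ler_powR => //; first exact: ltW.
  by rewrite nnegrE ltW.
by rewrite mulrCA ler_piMr ?(ltW e0)// ler_pdivrMr// mul1r lerDl.
Unshelve. all: by end_near. Qed.

Lemma holder_on_continuous T a g : 0 < a -> holder_on T a g ->
  {within `[0, T], continuous g}.
Proof. by move=> a0 [C C0 hC]; exact: holder_continuous a0 C0 hC. Qed.

Lemma continuous_segment_integrable g (x y : R) :
  {within `[x, y], continuous g} -> mu.-integrable `[x, y] (EFin \o g).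
Proof. by move=> cg; apply: continuous_compact_integrable => //; exact: segment_compact. Qed.

(** Half-open cells, so that the segments [[0, t]] are cut without overlap. *)
Lemma integral_cell T a C g x y : 0 <= a ->
  (forall s t, 0 <= s -> s <= t -> t <= T -> `|g t - g s| <= C * (t - s) `^ a) ->
  mu.-integrable `[0, T] (EFin \o g) ->
  0 <= x -> x <= y -> y <= T ->
  `|\int[mu]_(r in `]x, y]) g r - g x * (y - x)| <= C * (y - x) `^ a * (y - x).
Proof.
move=> a0 hC ig x0 xy yT.
have sub : `]x, y] `<=` `[0, T].
  by apply: subset_itv; rewrite bnd_simp.
have ixy : mu.-integrable `]x, y] (EFin \o g).
  by apply: integrableS ig => //.
have len : fine (mu `]x, y]) = y - x.
  rewrite lebesgue_measure_itv/= lte_fin; case: ltP => // yx.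
  by rewrite /= (_ : y = x) ?subrr//; apply/eqP; rewrite eq_le yx.
have icst (c : R) : mu.-integrable `]x, y] (EFin \o (fun=> c)).
  apply/integrableP; split; first exact: measurable_cst.
  rewrite integral_cst//= lebesgue_measure_itv/=.
  by case: ifP => _; rewrite ?mule0 -?EFinM ltry.
have cstE (c : R) : (\int[mu]_(r in `]x, y]) c)%R = c * (y - x).
  by rewrite Rintegral_cst// len.
rewrite -cstE -RintegralB//.
have iB : mu.-integrable `]x, y] (EFin \o (fun r => g r - g x)).
  exact: (integrableB _ ixy (icst (g x))).
apply: le_trans (le_normr_Rintegral _ iB) _ => //.
rewrite -cstE; apply: le_Rintegral => //.
  exact: (integrable_abse iB).
move=> r /=; rewrite in_itv/= => /andP[xr ry].
apply: le_trans (hC _ _ x0 (ltW xr) (le_trans ry yT)) _.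
have C0 : 0 <= C.
  have := hC _ _ x0 (ltW xr) (le_trans ry yT); have := normr_ge0 (g r - g x).
  by move=> h1 /(le_trans h1); rewrite pmulr_lge0// powR_gt0// subr_gt0.
by rewrite ler_wpM2l// ge0_ler_powR// ?nnegrE ?subr_ge0 ?lerD2r// ltW.
Qed.

Lemma dyadic_mesh T n i : dyadic T n i.+1 - dyadic T n i = T / 2 ^+ n.
Proof. by rewrite /dyadic -natr1; ring. Qed.

Lemma dyadic_itv T n i : 0 < T -> (i <= 2 ^ n)%N -> 0 <= dyadic T n i <= T.
Proof.
move=> T0 hi; have e0 : 0 < 2 ^+ n :> R by rewrite exprn_gt0.
apply/andP; split; first by rewrite divr_ge0 ?(ltW e0)// mulr_ge0// ltW.
rewrite ler_pdivrMr//; by rewrite mulrC ler_pM2l// -natrX ler_nat.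
Qed.

Lemma dyadic_le T n i : 0 < T -> dyadic T n i <= dyadic T n i.+1.
Proof. by move=> T0; rewrite -subr_ge0 dyadic_mesh divr_ge0 ?exprn_ge0 ?ltW. Qed.

Lemma riemann_sum_error T a C g n : 0 < T -> 0 < a -> 0 <= C ->
  (forall s t, 0 <= s -> s <= t -> t <= T -> `|g t - g s| <= C * (t - s) `^ a) ->
  `|\sum_(i < (2 ^ n)%N) g (dyadic T n i) * (T / 2 ^+ n)
     - \int[mu]_(r in `[0, T]) g r| <= C * T * (T / 2 ^+ n) `^ a.
Proof.
move=> T0 a0 C0 hC.
have ig : mu.-integrable `[0, T] (EFin \o g).
  apply: continuous_segment_integrable.
  by apply: holder_on_continuous a0 _; exists C.
have key k : (k <= 2 ^ n)%N ->
  `|\sum_(i < k) g (dyadic T n i) * (T / 2 ^+ n)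
    - \int[mu]_(r in `[0, dyadic T n k]) g r| <=
     k%:R * (C * (T / 2 ^+ n) `^ a * (T / 2 ^+ n)).
  elim: k => [|k IH] hk.
    by rewrite big_ord0 mul0r /dyadic !mul0r set_itv1 Rintegral_set1 subrr normr0.
  rewrite big_ord_recr/=.
  have /andP[k0 kT] := dyadic_itv T n k T0 (ltnW hk).
  have /andP[k10 k1T] := dyadic_itv T n k.+1 T0 hk.
  have kk := dyadic_le T n k T0.
  have e := @Rintegral_itvB R g (BLeft 0) (BRight (dyadic T n k.+1)) (dyadic T n k).
  have i1 : mu.-integrable `[0, dyadic T n k.+1] (EFin \o g).
    by apply: integrableS ig => //; apply: subset_itvl; rewrite bnd_simp.
  have := e i1; rewrite !bnd_simp => /(_ k0 kk) {}e.
  have cell := integral_cell T a C g _ _ (ltW a0) hC ig k0 kk k1T.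
  rewrite dyadic_mesh in cell; rewrite -e in cell.
  rewrite -[k.+1%:R]natr1 [leRHS]mulrDl mul1r.
  move: cell (IH (ltnW hk)).
  set S := \sum_(i < k) _; set u := g _ * _.
  set J := (\int[mu]_(r in `[0, dyadic T n k.+1]) g r)%R.
  set J' := (\int[mu]_(r in `[0, dyadic T n k]) g r)%R => cell IHk.
  rewrite (_ : S + u - J = (S - J') - (J - J' - u)); last by ring.
  by rewrite (le_trans (ler_normB _ _))// lerD.
have := key (2 ^ n)%N (leqnn _).
have e2 : 2 ^+ n != 0 :> R by rewrite expf_neq0.
rewrite (_ : dyadic T n (2 ^ n) = T); last by rewrite /dyadic natrX mulrAC divff ?mul1r.
move=> /le_trans; apply; rewrite le_eqVlt; apply/orP; left; apply/eqP.
by rewrite natrX; field.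
Qed.

End holder.

(** * Scaled quadratic variation of controlled paths *)

Lemma sum_blocks (V : nmodType) (a L : nat) (F : nat -> V) :
  \sum_(i < (a * L)%N) F i = \sum_(c < a) \sum_(j < L) F (c * L + j)%N.
Proof.
elim: a => [|a IH]; first by rewrite mul0n !big_ord0.
rewrite big_ord_recr/= -IH -!(big_mkord xpredT F) mulSnr.
rewrite (@big_cat_nat _ _ _ (a * L))//= ?leq_addr//; congr (_ + _).
rewrite -{1}[(a * L)%N]add0n big_addn addKn big_mkord.
by apply: eq_bigr => j _; rewrite addnC.
Qed.

Section controlled.
Context {R : realType}.
Variables (T H : R).
Hypotheses (T0 : 0 < T) (H01 : 0 < H < 1).
Local Notation mu := (@lebesgue_measure R).
Local Notation Hmax := (Num.max 2^-1 H).
Local Notation lvl := (coarse_level H).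

(** Freezing [G] at the left end of each block costs its oscillation over a
    block; what remains is a Riemann sum of [G]. *)
Lemma block_sum_error n (q : nat -> R) (G : R -> R) (A C M E kap a : R) :
  0 < a -> 0 <= C -> 0 <= A ->
  (forall t, 0 <= t <= T -> `|G t| <= A) ->
  (forall s t, 0 <= s -> s <= t -> t <= T -> `|G t - G s| <= C * (t - s) `^ a) ->
  \sum_(i < (2 ^ n)%N) `|q i| <= M ->
  \sum_(c < (2 ^ lvl n)%N) `|\sum_(j < (2 ^ (n - lvl n))%N)
     q (c * 2 ^ (n - lvl n) + j)%N - kap * (T / 2 ^+ lvl n)| <= E ->
  `|\sum_(i < (2 ^ n)%N) G (dyadic T n i) * q i
    - kap * \int[mu]_(r in `[0, T]) G r| <=
  (C * M + `|kap| * (C * T)) * (T / 2 ^+ lvl n) `^ a + A * E.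
Proof.
move=> a0 C0 A0 GA hC hM hE; set m := lvl n; set L := (2 ^ (n - m))%N.
have mn : (m <= n)%N := coarse_level_le H H01 n.
have nE : (2 ^ n = 2 ^ m * L)%N by rewrite /L -expnD subnKC.
set h := T / 2 ^+ m.
have D0 : 0 <= T / 2 ^+ n by rewrite divr_ge0 ?exprn_ge0// ltW.
have osc c j : (c < 2 ^ m)%N -> (j < L)%N ->
  `|G (dyadic T n (c * L + j)) - G (dyadic T m c)| <= C * h `^ a.
  move=> hc hj; have bnd : (c * L + j <= 2 ^ n)%N.
    by rewrite nE (leq_trans (ltnW _) (leq_mul hc (leqnn L)))// mulSnr ltn_add2l.
  have /andP[s0 _] := dyadic_itv T m c T0 (ltnW hc).
  have /andP[_ tT] := dyadic_itv T n _ T0 bnd.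
  have e : dyadic T n (c * L + j) - dyadic T m c = j%:R * (T / 2 ^+ n).
    by rewrite dyadic_block// addrC addKr.
  have st : dyadic T m c <= dyadic T n (c * L + j).
    by rewrite -subr_ge0 e mulr_ge0.
  apply: le_trans (hC _ _ s0 st tT) _; rewrite ler_wpM2l// e.
  have le : j%:R * (T / 2 ^+ n) <= h.
    have -> : h = L%:R * (T / 2 ^+ n).
      rewrite /h /L natrX -[in X in _ * (_ / X)](subnK mn) exprD.
      by field; rewrite !expf_neq0.
    by rewrite ler_wpM2r// ler_nat ltnW.
  apply: ge0_ler_powR => //; rewrite ?nnegrE ?(ltW a0)//.
  - by rewrite mulr_ge0.
  - by rewrite (le_trans _ le)// mulr_ge0.
have rs := riemann_sum_error T a C G m T0 a0 C0 hC.
pose S1 := \sum_(c < (2 ^ m)%N) \sum_(j < L)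
   (G (dyadic T n (c * L + j)) - G (dyadic T m c)) * q (c * L + j)%N.
pose S2 := \sum_(c < (2 ^ m)%N) G (dyadic T m c) *
   (\sum_(j < L) q (c * L + j)%N - kap * h).
pose S3 := kap * (\sum_(c < (2 ^ m)%N) G (dyadic T m c) * h -
   \int[mu]_(r in `[0, T]) G r).
have -> : \sum_(i < (2 ^ n)%N) G (dyadic T n i) * q i
    - kap * \int[mu]_(r in `[0, T]) G r = S1 + S2 + S3.
  rewrite /S3 mulrBr addrA; congr (_ - _).
  rewrite nE (sum_blocks _ _ _ (fun i => G (dyadic T n i) * q i)).
  rewrite /S1 /S2 mulr_sumr -!big_split/=; apply: eq_bigr => c _.
  have -> : \sum_(j < L) (G (dyadic T n (c * L + j)) - G (dyadic T m c))
        * q (c * L + j)%N = \sum_(j < L) G (dyadic T n (c * L + j)) * q (c * L + j)%N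
      - G (dyadic T m c) * \sum_(j < L) q (c * L + j)%N.
    by rewrite mulr_sumr -sumrB; apply: eq_bigr => j _; rewrite mulrBl.
  by ring.
have b1 : `|S1| <= C * M * h `^ a.
  apply: (@le_trans _ _ (\sum_(c < (2 ^ m)%N) \sum_(j < L) C * h `^ a * `|q (c * L + j)%N|)).
    apply: le_trans (ler_norm_sum _ _ _) _; apply: ler_sum => c _.
    apply: le_trans (ler_norm_sum _ _ _) _; apply: ler_sum => j _.
    by rewrite normrM ler_wpM2r// osc.
  under eq_bigr do rewrite -mulr_sumr.
  rewrite -mulr_sumr -(sum_blocks _ _ _ (fun i => `|q i|)) -nE mulrAC.
  by rewrite ler_wpM2r ?powR_ge0// ler_wpM2l.
have b2 : `|S2| <= A * E.
  apply: le_trans (ler_norm_sum _ _ _) _.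
  apply: (@le_trans _ _ (A * \sum_(c < (2 ^ m)%N) `|\sum_(j < L) q (c * L + j)%N - kap * h|)).
    rewrite mulr_sumr; apply: ler_sum => c _; rewrite normrM ler_wpM2r// GA//.
    exact/dyadic_itv/ltnW.
  by rewrite ler_wpM2l.
have b3 : `|S3| <= `|kap| * (C * T) * h `^ a.
  by rewrite normrM -mulrA ler_wpM2l.
rewrite mulrDl [leRHS]addrAC (le_trans (ler_normD _ _))// lerD//.
by rewrite (le_trans (ler_normD _ _))// lerD.
Qed.

Lemma coarse_mesh_pow (a r : R) n : 0 < a -> r <= a * (1 - Hmax) ->
  (T / 2 ^+ lvl n) `^ a <= (2 * T) `^ a * 2 `^ (- (r * n%:R)).
Proof.
move=> a0 hr; have /andP[hl _] := coarse_level_itv H H01 n.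
have -> : (2 * T) `^ a = T `^ a * 2 `^ a by rewrite mulrC powRM// ltW.
rewrite powRM ?invr_ge0 ?exprn_ge0 ?(ltW T0)// -mulrA ler_wpM2l ?powR_ge0//.
rewrite -powR_mulrn// -powRN -powRrM -powRD ?pnatr_eq0 ?implybT//.
apply: ler_powR; first by rewrite ler1n.
have h1 : r * n%:R <= a * (1 - Hmax) * n%:R by rewrite ler_wpM2r.
have h2 : a * (n%:R * (1 - Hmax) - 1) <= a * (lvl n)%:R by rewrite ler_wpM2l// ltW.
by move: h1 h2; set x := Hmax; set l := (lvl n)%:R; set k := (n%:R : R); nra.
Qed.

Variables (K : nat) (z : 'I_K -> R -> R) (a r : R).
Hypotheses (a0 : 0 < a) (r0 : 0 <= r) (ra : r <= a * (1 - Hmax)).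
Hypothesis hz : forall k, holder_on T a (z k).
Hypothesis hdef : forall k l, exists C, forall n,
  covariation_defect T H (k == l)%:R n (z k) (z l) <= C * 2 `^ (- (r * n%:R)).

Let w n k l i : R := (T / 2 ^+ n) `^ (1 - 2 * H) *
  (delta (z k) (dyadic T n i) (dyadic T n i.+1) *
   delta (z l) (dyadic T n i) (dyadic T n i.+1)).

Lemma block_covariationE n c k l : block_covariation T H n c (z k) (z l) =
  \sum_(j < (2 ^ (n - lvl n))%N) w n k l (c * 2 ^ (n - lvl n) + j)%N.
Proof. by rewrite /block_covariation mulr_sumr. Qed.

(** The diagonal sums are bounded because their block sums converge; the mixed
    ones are dominated by them. *)
Lemma square_variation_bounded : exists2 M, 0 <= M & forall n k l,
  \sum_(i < (2 ^ n)%N) `|w n k l i| <= M.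
Proof.
have sq k : exists2 M, 0 <= M & forall n, \sum_(i < (2 ^ n)%N) w n k k i <= M.
  have [C hC] := hdef k k; have CT : 0 <= `|C| + T by rewrite addr_ge0// ltW.
  exists (`|C| + T) => // n.
  have mn := coarse_level_le H H01 n.
  rewrite [(2 ^ n)%N](_ : _ = 2 ^ lvl n * 2 ^ (n - lvl n))%N; last by rewrite -expnD subnKC.
  rewrite sum_blocks; have := hC n; rewrite eqxx /covariation_defect => {}hC.
  have -> : T = \sum_(c < (2 ^ lvl n)%N) 1 * (T / 2 ^+ lvl n).
    by rewrite sumr_const card_ord mul1r -[RHS]mulr_natl natrX mulrCA divff ?mulr1// expf_neq0.
  rewrite -lerBlDr -sumrB.
  apply: (@le_trans _ _ (C * 2 `^ (- (r * n%:R)))).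
    apply: le_trans hC; apply: ler_sum => c _.
    by rewrite block_covariationE ler_norm.
  rewrite (le_trans (ler_norm _))// normrM ler_piMr// ger0_norm ?powR_ge0//.
  rewrite -[leRHS](powRr0 2) ler_powR ?ler1n// oppr_le0 mulr_ge0//.
have {sq} : exists2 M : 'I_K -> R, (forall k, 0 <= M k) &
    forall n k, \sum_(i < (2 ^ n)%N) w n k k i <= M k.
  have h k : {M | 0 <= M & forall n, \sum_(i < (2 ^ n)%N) w n k k i <= M}.
    by apply: cid2; exact: sq.
  by exists (fun k => s2val (h k)) => [k|n k]; case: (h k).
case=> M M0 hM; exists (\sum_k M k); first exact: sumr_ge0.
move=> n k l.
apply: (@le_trans _ _ ((\sum_(i < (2 ^ n)%N) w n k k i + \sum_(i < (2 ^ n)%N) w n l l i) / 2)).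
  rewrite -big_split/= mulr_suml; apply: ler_sum => i _.
  rewrite /w -mulrDr -mulrA normrM ger0_norm ?powR_ge0// ler_wpM2l ?powR_ge0//.
  set x := delta _ _ _; set y := delta _ _ _; rewrite normrM.
  have -> : x * x = `|x| ^+ 2 by rewrite real_normK ?num_real// expr2.
  have -> : y * y = `|y| ^+ 2 by rewrite real_normK ?num_real// expr2.
  by rewrite ler_pdivlMr//; have := sqr_ge0 (`|x| - `|y|); nra.
have le k' : \sum_(i < (2 ^ n)%N) w n k' k' i <= \sum_k M k.
  by rewrite (le_trans (hM n k'))// (bigD1 k')//= lerDl sumr_ge0.
by have := le k; have := le l; lra.
Qed.

Variables (x : R -> R) (g : 'I_K -> R -> R) (nu : R).
Hypotheses (ran : r <= a + nu - 2 * H) (rn : r <= 2 * nu - 2 * H).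
Hypothesis hg : forall k, holder_on T a (g k).
Hypothesis hx : exists2 C, 0 <= C & forall s t, 0 <= s -> s < t -> t <= T ->
  `|delta x s t - \sum_k g k s * delta (z k) s t| <= C * (t - s) `^ nu.

Lemma covariation_rate k l G : holder_on T a G -> decays r (fun n =>
  \sum_(i < (2 ^ n)%N) G (dyadic T n i) * w n k l i
  - (k == l)%:R * \int[mu]_(r in `[0, T]) G r).
Proof.
move=> hG; have [A A0 GA] := holder_on_bounded _ _ _ (ltW a0) hG.
have [C C0 hC] := hG; have [M M0 hM] := square_variation_bounded.
have [E hE] := hdef k l.
exists ((C * M + (k == l)%:R * (C * T)) * (2 * T) `^ a + A * E); apply: nearW => n.
have := block_sum_error n (w n k l) G A C M (E * 2 `^ (- (r * n%:R))) (k == l)%:R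
  a a0 C0 A0 GA hC (hM n k l).
move=> /(_ _)/le_trans; apply.
  apply: le_trans (hE n); apply: ler_sum => c _.
  by rewrite block_covariationE.
rewrite normr_nat [leRHS]mulrDl lerD//; last by rewrite mulrA.
rewrite -[leRHS]mulrA.
rewrite ler_wpM2l ?coarse_mesh_pow//.
by rewrite addr_ge0 ?mulr_ge0// ltW.
Qed.

(** In the expansion of the squared increments, the square of the leading part
    converges by [covariation_rate] with [G = g_k * g_l].  Among [2 ^ n] terms
    weighted by [D ^ (1 - 2H)], with [D] the mesh, the cross products are of
    order [D ^ (a + nu)] and the squared remainders of order [D ^ (2 nu)]. *)
Lemma controlled_variation_rate : decays r (fun n =>
  scaled_var_n T (1 - 2 * H) n x T
  - \sum_k \int[mu]_(s in `[0, T]) (g k s ^+ 2)).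
Proof.
pose main n := \sum_k \sum_l (\sum_(i < (2 ^ n)%N) (g k (dyadic T n i) * g l (dyadic T n i))
   * w n k l i - (k == l)%:R * \int[mu]_(s in `[0, T]) (g k s * g l s)).
have hmain : decays r main.
  apply: decays_sum => k; apply: decays_sum => l.
  by apply: (covariation_rate k l (fun s => g k s * g l s));
    exact: holder_onM (ltW a0) (hg k) (hg l).
have [Cx Cx0 hCx] := hx.
pose lead n i := \sum_k g k (dyadic T n i) * delta (z k) (dyadic T n i) (dyadic T n i.+1).
pose rem n i := delta x (dyadic T n i) (dyadic T n i.+1) - lead n i.
have svE n : scaled_var_n T (1 - 2 * H) n x T = \sum_(i < (2 ^ n)%N)
    (T / 2 ^+ n) `^ (1 - 2 * H) * (lead n i + rem n i) ^+ 2.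
  rewrite /scaled_var_n; apply: eq_big => [i|i _].
    by have /andP[] := dyadic_itv T n i.+1 T0 (ltn_ord i).
  by rewrite dyadic_mesh [lead n i + _]addrC subrK.
have mainE n : main n = \sum_(i < (2 ^ n)%N) (T / 2 ^+ n) `^ (1 - 2 * H) * lead n i ^+ 2
    - \sum_k \int[mu]_(s in `[0, T]) (g k s ^+ 2).
  rewrite /main; under eq_bigr do rewrite sumrB.
  rewrite sumrB; congr (_ - _).
    under eq_bigr do rewrite exchange_big/=.
    rewrite exchange_big/=; apply: eq_bigr => i _.
    rewrite expr2 /lead big_distrlr/= mulr_sumr; apply: eq_bigr => k _.
    by rewrite mulr_sumr; apply: eq_bigr => l _; rewrite /w; ring.
  apply: eq_bigr => k _.
  under eq_bigr do rewrite eq_sym.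
  by rewrite (sum_pick _ k (fun l => \int[mu]_(s in `[0, T]) (g k s * g l s))).
have hB : exists2 B, 0 <= B & forall n i, (i < 2 ^ n)%N ->
    `|lead n i| <= B * (T / 2 ^+ n) `^ a.
  have h k : exists2 B, 0 <= B & forall n i, (i < 2 ^ n)%N ->
    `|g k (dyadic T n i) * delta (z k) (dyadic T n i) (dyadic T n i.+1)|
    <= B * (T / 2 ^+ n) `^ a.
    have [A A0 gA] := holder_on_bounded _ _ _ (ltW a0) (hg k).
    have [C C0 hC] := hz k; exists (A * C); first exact: mulr_ge0.
    move=> n i hi; rewrite normrM -mulrA.
    apply: ler_pM => //; first exact/gA/dyadic_itv/ltnW.
    rewrite -(dyadic_mesh T n i); apply: hC; last 2 first.
    - exact: dyadic_le.
    - by have /andP[] := dyadic_itv T n i.+1 T0 hi.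
    by have /andP[] := dyadic_itv T n i T0 (ltnW hi).
  have {}h k := cid2 (h k); exists (\sum_k s2val (h k)).
    by apply: sumr_ge0 => k _; case: (h k).
  move=> n i hi; rewrite mulr_suml (le_trans (ler_norm_sum _ _ _))//.
  by apply: ler_sum => k _; case: (h k) => /= B _; exact.
have [B B0 {}hB] := hB.
have hR n i : (i < 2 ^ n)%N -> `|rem n i| <= Cx * (T / 2 ^+ n) `^ nu.
  move=> hi; rewrite -(dyadic_mesh T n i); apply: hCx; last 2 first.
  - by rewrite -subr_gt0 dyadic_mesh divr_gt0// exprn_gt0.
  - by have /andP[] := dyadic_itv T n i.+1 T0 hi.
  by have /andP[] := dyadic_itv T n i T0 (ltnW hi).
have hrem : decays r (fun n => \sum_(i < (2 ^ n)%N)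
    (T / 2 ^+ n) `^ (1 - 2 * H) * (2 * lead n i * rem n i + rem n i ^+ 2)).
  have p1 := decaysZ _ _ (T * (2 * B * Cx)) (decays_pow _ _ _ T0 ran).
  have p2 := decaysZ _ _ (T * Cx ^+ 2) (decays_pow _ _ _ T0 rn).
  apply: decays_le (decaysD _ _ _ p1 p2); apply: nearW => n.
  set D := T / 2 ^+ n; have D0 : 0 < D by rewrite divr_gt0// exprn_gt0.
  rewrite [leRHS]ger0_norm; last first.
    by rewrite addr_ge0// mulr_ge0 ?powR_ge0// !mulr_ge0// ltW.
  apply: le_trans (ler_norm_sum _ _ _) _.
  apply: (@le_trans _ _ (\sum_(i < (2 ^ n)%N) D `^ (1 - 2 * H) *
     (2 * (B * D `^ a) * (Cx * D `^ nu) + (Cx * D `^ nu) ^+ 2))).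
    apply: ler_sum => i _; rewrite normrM ger0_norm ?powR_ge0// ler_wpM2l ?powR_ge0//.
    have := hB n i (ltn_ord i); have := hR n i (ltn_ord i); rewrite -/D => h1 h2.
    rewrite (le_trans (ler_normD _ _))// lerD// !normrM.
      by rewrite normr_nat ler_pM// ler_pM.
    by rewrite -expr2 lerXn2r ?nnegrE// mulr_ge0 ?powR_ge0.
  rewrite sumr_const card_ord -[leLHS](mulr_natl _ (2 ^ n)).
  have e : (2 ^ n)%:R * D = T.
    by rewrite natrX mulrCA divff ?mulr1// expf_neq0.
  have pD y : D `^ (y - 2 * H) = D `^ y * D `^ (1 - 2 * H) / D.
    rewrite -(powR_inv1 (ltW D0)) -!powRD ?(gt_eqF D0) ?implybT//.
    by congr (_ `^ _); ring.
  rewrite le_eqVlt; apply/orP; left; apply/eqP.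
  have D2 : D `^ (2 * nu) = (D `^ nu) ^+ 2.
    by rewrite mulrC powRrM powR_mulrn ?powR_ge0.
  rewrite (pD (a + nu)) (pD (2 * nu)) D2 powRD ?(gt_eqF D0) ?implybT// -[in RHS]e.
  by field; rewrite gt_eqF.
rewrite (_ : (fun n => _) = (fun n => main n + \sum_(i < (2 ^ n)%N)
    (T / 2 ^+ n) `^ (1 - 2 * H) * (2 * lead n i * rem n i + rem n i ^+ 2))).
  exact: decaysD.
apply/funext => n; rewrite svE mainE addrAC; congr (_ - _).
by rewrite -big_split/=; apply: eq_bigr => i _; ring.
Qed.
End controlled.

(** * Local Lipschitz bounds and Taylor expansion in several variables *)

Section calculus.
Context {R : realType} {d : nat}.
Implicit Types (f h : 'rV[R]_d -> R) (x z : 'rV[R]_d).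

Lemma entry_le_norm x j : `|x 0 j| <= `|x|.
Proof. by rewrite [leRHS]mx_normrE; apply: le_trans (le_bigmax _ _ (0, j)). Qed.

Lemma norm_le_fnorm x : `|x| <= fnorm x.
Proof.
rewrite [leLHS]mx_normrE; apply/bigmax_leP; split=> [|[i j] _ /=].
  exact: sqrtr_ge0.
rewrite /fnorm -sqrtr_sqr ler_wsqrtr//.
rewrite (bigD1 i)//= (bigD1 j)//= -addrA lerDl addr_ge0//.
  by apply: sumr_ge0 => l _; exact: sqr_ge0.
by apply: sumr_ge0 => k _; apply: sumr_ge0 => l _; exact: sqr_ge0.
Qed.

Lemma bounded_on_ball h (M : R) : 0 <= M -> continuous h ->
  exists2 C, 0 <= C & forall x, `|x| <= M -> `|h x| <= C.
Proof.
move=> M0 ch; pose A := [set x : 'rV[R]_d | `|x| <= M].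
have cA : compact A.
  apply: bounded_closed_compact.
    by exists M; split; [exact: num_real|move=> N MN x /= xM; exact: le_trans (ltW MN)].
  have -> : A = (fun x => `|x|) @^-1` [set r | r <= M] by [].
  by apply: closed_comp; [move=> x _; exact: norm_continuous|exact: closed_le].
have A0 : A !=set0 by exists 0; rewrite /A /= normr0.
have [c cA' hc] := compact_EVT_max A0 cA (continuous_subspaceT (fun x => cvg_norm (ch x))).
by exists `|h c| => // x xM; apply: hc; rewrite inE.
Qed.

Lemma derive_partial f x v : differentiable f x ->
  'D_v f x = \sum_j v 0 j * partial j f x.
Proof.
move=> df; rewrite deriveE// {1}(row_sum_delta v) linear_sum.
by apply: eq_bigr => j _; rewrite linearZ/= /partial deriveE.
Qed.

(** Along the segment from [x] to [z]; the intermediate point stays in every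
    ball containing both ends. *)
Lemma mean_value_rV f x z : (forall y, differentiable f y) ->
  exists2 t : R, 0 <= t <= 1 &
  f z - f x = \sum_j (z - x) 0 j * partial j f (x + t *: (z - x)).
Proof.
move=> df; pose g (t : R) := f (x + t *: (z - x)).
have dg (t : R) : is_derive t 1 g ('D_(z - x) f (x + t *: (z - x))).
  have quot : (fun k : R => k^-1 *: ((g \o shift t) (k *: (1 : R)) - g t)) =
    (fun k : R => k^-1 *: ((f \o shift (x + t *: (z - x))) (k *: (z - x))
                       - f (x + t *: (z - x)))).
    apply/funext => k /=; congr (_ *: (f _ - _)).
    by rewrite [k *: 1]mulr1 scalerDl addrCA.
  have dv : derivable f (x + t *: (z - x)) (z - x) by exact: diff_derivable.
  by apply: DeriveDef; rewrite ?/derivable ?/derive quot.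
have cg : {within `[0, 1], continuous g}.
  apply: continuous_subspaceT => t; apply/differentiable_continuous/derivable1_diffP.
  by have [] := dg t.
case: (@MVT_segment R g (fun t => 'D_(z - x) f (x + t *: (z - x))) 0 1 ler01
  (fun t _ => dg t) cg) => t.
rewrite in_itv/= subr0 mulr1 => t01; rewrite derive_partial// => e; exists t => //.
by rewrite -e /g scale1r scale0r addr0 [x + _]addrC subrK.
Qed.

Definition locally_lipschitz h := forall M, 0 <= M -> exists2 C, 0 <= C &
  forall x z, `|x| <= M -> `|z| <= M -> `|h z - h x| <= C * `|z - x|.

Lemma segment_in_ball x z (t M : R) : 0 <= t <= 1 -> `|x| <= M -> `|z| <= M ->
  `|x + t *: (z - x)| <= M.
Proof.
move=> /andP[t0 t1] xM zM.
have -> : x + t *: (z - x) = (1 - t) *: x + t *: z.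
  by rewrite scalerBr scalerBl scale1r addrA addrAC.
rewrite (le_trans (ler_normD _ _))// !normrZ (ger0_norm t0) ger0_norm ?subr_ge0//.
have t1' : 0 <= 1 - t by rewrite subr_ge0.
have := ler_wpM2l t1' xM; have := ler_wpM2l t0 zM; lra.
Qed.

Lemma C1_locally_lipschitz h : (forall x, differentiable h x) ->
  (forall j, continuous (partial j h)) -> locally_lipschitz h.
Proof.
move=> dh ch M M0.
have /(_ _)/cid2 b j := bounded_on_ball _ _ M0 (ch j).
exists (\sum_j s2val (b j)); first by apply: sumr_ge0 => j _; case: (b j).
move=> x z xM zM; have [t t01 ->] := mean_value_rV h x z dh.
rewrite (le_trans (ler_norm_sum _ _ _))// mulr_suml; apply: ler_sum => j _.
rewrite normrM mulrC ler_pM ?entry_le_norm//.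
by case: (b j) => /= C _; apply; exact: segment_in_ball.
Qed.

Lemma Cn_continuous n h : Cn n h -> continuous h.
Proof.
by case: n => [//|n [dh _]] x; exact: differentiable_continuous.
Qed.

Lemma Cn_locally_lipschitz n h : (0 < n)%N -> Cn n h -> locally_lipschitz h.
Proof.
case: n => // n _ [dh ch]; apply: C1_locally_lipschitz => // j.
exact: Cn_continuous (ch j).
Qed.

Lemma taylor_rV f M : 0 <= M -> (forall x, differentiable f x) ->
  (forall j, locally_lipschitz (partial j f)) ->
  exists2 C, 0 <= C & forall x z, `|x| <= M -> `|z| <= M ->
  `|f z - f x - \sum_j (z - x) 0 j * partial j f x| <= C * `|z - x| ^+ 2.
Proof.
move=> M0 df lf; have /(_ _)/cid2 b j := lf j M M0.
exists (\sum_j s2val (b j)); first by apply: sumr_ge0 => j _; case: (b j).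
move=> x z xM zM; have [t t01 ->] := mean_value_rV f x z df.
rewrite -sumrB (le_trans (ler_norm_sum _ _ _))// mulr_suml; apply: ler_sum => j _.
rewrite -mulrBr normrM expr2 mulrA mulrAC [leRHS]mulrC ler_pM ?entry_le_norm//.
case: (b j) => /= C C0 hC; have xtM := segment_in_ball x z t M t01 xM zM.
apply: le_trans (hC _ _ xM xtM) _; rewrite ler_wpM2l//.
rewrite addrC addKr normrZ; case/andP: t01 => t0 t1.
by rewrite ger0_norm// ler_piMl.
Qed.

End calculus.

(** * Solutions of the equation as controlled paths *)

Section increments.
Context {R : realType}.
Implicit Types (T a : R) (g h : R -> R -> R).

Definition holder2_on T a g := exists2 C, 0 <= C &
  forall s t, 0 <= s -> s < t -> t <= T -> `|g s t| <= C * (t - s) `^ a.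

Lemma holder2_lty T a g : (holder2 T a g < +oo)%E -> holder2_on T a g.
Proof.
move=> fin; pose S := holder2 T a g.
have ub s t : 0 <= s -> s < t -> t <= T -> ((`|g s t| / (t - s) `^ a)%:E <= S)%E.
  by move=> s0 st tT; apply: ereal_sup_ubound; exists (s, t).
exists `|fine S| => // s t s0 st tT.
have h := ub s t s0 st tT.
have st0 : 0 < (t - s) `^ a by rewrite powR_gt0// subr_gt0.
have Sfin : S \is a fin_num.
  rewrite ge0_fin_numE//; apply: le_trans h.
  by rewrite lee_fin divr_ge0// ltW.
rewrite -ler_pdivrMr// (le_trans _ (ler_norm _))//.
by rewrite -lee_fin fineK.
Qed.

Lemma holder2_onD T a g h : holder2_on T a g -> holder2_on T a h ->
  holder2_on T a (fun s t => g s t + h s t).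
Proof.
move=> [C C0 hC] [D D0 hD]; exists (C + D); first by rewrite addr_ge0.
move=> s t s0 st tT; rewrite mulrDl (le_trans (ler_normD _ _))//.
by rewrite lerD ?hC ?hD.
Qed.

Lemma holder2_onM T a g (b : R -> R) A :
  (forall t, 0 <= t <= T -> `|b t| <= A) -> holder2_on T a g ->
  holder2_on T a (fun s t => b s * g s t).
Proof.
move=> hA [C C0 hC]; exists (`|A| * C); first by rewrite mulr_ge0.
move=> s t s0 st tT; rewrite normrM -mulrA ler_pM ?hC//.
by rewrite (le_trans (hA _ _)) ?ler_norm// s0 (le_trans (ltW st)).
Qed.

Lemma holder2_on_sum T a (I : Type) (r : seq I) (g : I -> R -> R -> R) :
  (forall i, holder2_on T a (g i)) ->
  holder2_on T a (fun s t => \sum_(i <- r) g i s t).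
Proof.
move=> h; elim: r => [|i r IH].
  exists 0 => // s t *; by rewrite big_nil normr0 mul0r.
case: (holder2_onD _ _ _ _ (h i) IH) => C C0 hC; exists C => // s t *.
by rewrite big_cons; exact: hC.
Qed.

Lemma holder2_on_weaken T a b g : 0 < T -> b <= a -> holder2_on T a g ->
  holder2_on T b g.
Proof.
move=> T0 ba [C C0 hC]; exists (C * T `^ (a - b)).
  by rewrite mulr_ge0// powR_ge0.
move=> s t s0 st tT; rewrite (le_trans (hC _ _ s0 st tT))// -mulrA ler_wpM2l//.
have st0 : 0 < t - s by rewrite subr_gt0.
have -> : (t - s) `^ a = (t - s) `^ (a - b) * (t - s) `^ b.
  by rewrite -powRD ?subrK ?(gt_eqF st0) ?implybT.
rewrite ler_wpM2r ?powR_ge0//.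
apply: ge0_ler_powR; rewrite ?subr_ge0 ?nnegrE ?(ltW st0) ?(ltW T0)//.
by rewrite lerBlDr ler_wpDr.
Qed.

Lemma holder2_on_le T a g h : (forall s t, 0 <= s -> s < t -> t <= T ->
    `|g s t| <= `|h s t|) -> holder2_on T a h -> holder2_on T a g.
Proof.
move=> gh [C C0 hC]; exists C => // s t s0 st tT.
by rewrite (le_trans (gh _ _ s0 st tT))// hC.
Qed.

Lemma holder2_on_delta T a (x : R -> R) : holder2_on T a (delta x) -> holder_on T a x.
Proof.
move=> [C C0 hC]; exists C => // s t s0; rewrite le_eqVlt => /predU1P[->|st] tT.
  by rewrite subrr normr0 mulr_ge0// powR_ge0.
exact: hC.
Qed.

Lemma fnorm_ge0 m n (A : 'M[R]_(m, n)) : 0 <= fnorm A.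
Proof. exact: sqrtr_ge0. Qed.

Lemma holder2_mx_norm T a d (g : R -> R -> 'rV[R]_d) :
  (holder2_mx T a g < +oo)%E -> holder2_on T a (fun s t => `|g s t|).
Proof.
move=> /holder2_lty; apply: holder2_on_le => s t _ _ _.
by rewrite normr_id ger0_norm ?norm_le_fnorm// fnorm_ge0.
Qed.

Lemma holder2_mx_entry T a d (g : R -> R -> 'rV[R]_d) j :
  (holder2_mx T a g < +oo)%E -> holder2_on T a (fun s t => g s t 0 j).
Proof.
move=> /holder2_mx_norm; apply: holder2_on_le => s t _ _ _.
by rewrite normr_id entry_le_norm.
Qed.

End increments.

Section solution.
Context {R : realType} {d K : nat}.
Local Notation mu := (@lebesgue_measure R).
Variables (T a : R) (y : R -> 'rV[R]_d) (z : R -> 'rV[R]_K).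
Variables (u : R -> 'rV[R]_d -> 'rV[R]_d) (sig : 'I_K -> 'rV[R]_d -> 'rV[R]_d).
Hypotheses (T0 : 0 < T) (a0 : 0 < a).
Hypothesis cu : {within [set p : R * 'rV[R]_d | 0 <= p.1 <= T],
        continuous (fun p => u p.1 p.2)}.
Hypothesis hy : (holder2_mx T a (delta y) < +oo)%E.
Hypothesis hrem : (holder2_mx T (2 * a) (remainder1 u sig z y) < +oo)%E.
Local Notation nu := (Num.min 1 (2 * a)).

Let nu_le1 : nu <= 1. Proof. by rewrite ge_min lexx. Qed.
Let nu_le2 : nu <= 2 * a. Proof. by rewrite ge_min lexx orbT. Qed.

Lemma path_holder : exists2 C, 0 <= C & forall s t, 0 <= s -> s <= t -> t <= T ->
  `|y t - y s| <= C * (t - s) `^ a.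
Proof.
have [C C0 hC] := holder2_mx_norm _ _ _ _ hy; exists C => // s t s0.
rewrite le_eqVlt => /predU1P[->|st] tT.
  by rewrite subrr normr0 mulr_ge0// powR_ge0.
by have := hC _ _ s0 st tT; rewrite normr_id.
Qed.

Lemma path_continuous : {within `[0, T], continuous y}.
Proof. by have [C C0 hC] := path_holder; exact: holder_continuous a0 C0 hC. Qed.

Lemma path_bounded : exists2 M, 0 <= M & forall t, 0 <= t <= T -> `|y t| <= M.
Proof.
have [C C0 hC] := path_holder; exists (C * T `^ a + `|y 0|).
  by rewrite addr_ge0// mulr_ge0// powR_ge0.
move=> t /andP[t0 tT]; rewrite -[y t](subrK (y 0)) (le_trans (ler_normD _ _))//.
rewrite lerD2r (le_trans (hC _ _ _ t0 tT))// ler_wpM2l// subr0.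
by apply: ge0_ler_powR => //; rewrite ?nnegrE// ltW.
Qed.

Lemma lipschitz_holder (h : 'rV[R]_d -> R) : locally_lipschitz h -> holder_on T a (fun t => h (y t)).
Proof.
move=> lh; have [M M0 hM] := path_bounded; have [L L0 hL] := lh M M0.
have [C C0 hC] := path_holder; exists (L * C); first by rewrite mulr_ge0.
move=> s t s0 st tT.
have ys : `|y s| <= M by apply: hM; rewrite s0 (le_trans st).
have yt : `|y t| <= M by apply: hM; rewrite tT (le_trans s0).
by rewrite (le_trans (hL _ _ ys yt))// -mulrA ler_wpM2l// hC.
Qed.

Lemma vf_act_holder (s : 'rV[R]_d -> 'rV[R]_d) (f : 'rV[R]_d -> R) : (forall j, locally_lipschitz (fun x => s x 0 j)) ->
  (forall j, locally_lipschitz (partial j f)) ->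
  holder_on T a (fun t => vf_act s f (y t)).
Proof.
move=> ls lf; apply: (holder_on_sum T a _ _ (fun j t => s (y t) 0 j * partial j f (y t))) => j.
apply: (holder_onM T a (fun t => s (y t) 0 j) (fun t => partial j f (y t)) (ltW a0)).
  exact: (lipschitz_holder (fun x => s x 0 j)).
exact: lipschitz_holder.
Qed.

Lemma drift_continuous : {within `[0, T], continuous (fun r => u r (y r))}.
Proof.
apply/subspace_continuousP => r rT.
have cy := (subspace_continuousP _ _).1 path_continuous r rT.
have rA : [set p : R * 'rV[R]_d | 0 <= p.1 <= T] (r, y r).
  by move: rT; rewrite /= in_itv.
have cu' := (subspace_continuousP _ _).1 cu (r, y r) rA.
apply: (@cvg_comp _ _ _ (fun r => (r, y r)) (fun p => u p.1 p.2) _ _ _ _ cu').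
move=> B; rewrite /= /within/= => nB.
have cp : (fun r => (r, y r)) @ within [set` `[0, T]] (nbhs r) --> nbhs (r, y r).
  exact: (cvg_pair (f := fun r => r) (cvg_within _) cy).
have h : nbhs r [set q | `[0, T]%classic q -> 0 <= q <= T -> B (q, y q)] := cp _ nB.
by apply: filterS h => q h qT; apply: h.
Qed.

Lemma drift_holder2 i : holder2_on T 1
  (fun s t => \int[mu]_(r in `[s, t]) u r (y r) 0 i)%R.
Proof.
have cU : {within `[0, T], continuous (fun r => u r (y r) 0 i)}.
  apply/subspace_continuousP => r rT.
  have := (subspace_continuousP _ _).1 drift_continuous r rT => h.
  exact: cvg_comp h (@coord_continuous _ _ _ 0 i (u r (y r))).
have cN : {within `[0, T], continuous (fun r => `|u r (y r) 0 i|)}.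
  by move=> r; exact: cvg_norm (cU r).
have [c cT hc] := @EVT_max R (fun r => `|u r (y r) 0 i|) 0 T (ltW T0) cN.
exists `|u c (y c) 0 i| => // s t s0 st tT.
have sub : `[s, t] `<=` `[0, T] by apply: subset_itv; rewrite bnd_simp.
have iU : mu.-integrable `[s, t] (EFin \o (fun r => u r (y r) 0 i)).
  by apply: integrableS (continuous_segment_integrable _ _ _ cU).
rewrite (le_trans (le_normr_Rintegral _ iU))//.
have icst (k : R) : mu.-integrable `[s, t] (EFin \o (fun=> k)).
  apply/integrableP; split; first exact: measurable_cst.
  rewrite integral_cst//= lebesgue_measure_itv/=.
  by case: ifP => _; rewrite ?mule0 -?EFinM ltry.
rewrite powRr1 ?subr_ge0 ?(ltW st)//.
have -> : `|u c (y c) 0 i| * (t - s) = (\int[mu]_(r in `[s, t]) `|u c (y c) 0 i|)%R.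
  by rewrite Rintegral_cst//= lebesgue_measure_itv/= lte_fin st.
apply: le_Rintegral => //; first exact: (integrable_abse iU).
by move=> r /sub rT; apply: hc.
Qed.

(** The drift is only Lipschitz in time, hence the exponent [nu], which is
    smaller than [2 * a] when [a > 1/2]. *)
Lemma solution_coordinate i : holder2_on T nu (fun s t =>
  delta (fun r => y r 0 i) s t
  - \sum_k sig k (y s) 0 i * delta (fun r => z r 0 k) s t).
Proof.
have h1 := holder2_on_weaken _ _ _ _ T0 nu_le2 (holder2_mx_entry _ _ _ _ i hrem).
have h2 := holder2_on_weaken _ _ _ _ T0 nu_le1 (drift_holder2 i).
apply: holder2_on_le (holder2_onD _ _ _ _ h1 h2) => s t _ _ _.
rewrite le_eqVlt; apply/orP; left; apply/eqP; congr `|_|.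
rewrite /remainder1 !mxE summxE addrAC subrK; congr (_ - _).
by apply: eq_bigr => k _; rewrite !mxE mulrC.
Qed.

(** Taylor's formula at [y s]: the second order term is quadratic in the
    increment of [y], the first order term is a combination of the
    remainders of the coordinates. *)
Lemma solution_function (f : 'rV[R]_d -> R) : Cn 2 f -> holder2_on T nu (sharp sig f z y).
Proof.
move=> [df Cf].
have lf j : locally_lipschitz (partial j f) by exact: (Cn_locally_lipschitz 1 _ _ (Cf j)).
have [M M0 hM] := path_bounded; have [L L0 hL] := taylor_rV f M M0 df lf.
pose tay s t := delta (f \o y) s t - \sum_j (y t - y s) 0 j * partial j f (y s).
have h1 : holder2_on T (2 * a) tay.
  have [C C0 hC] := path_holder; exists (L * C ^+ 2).
    by rewrite mulr_ge0// sqr_ge0.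
  move=> s t s0 st tT.
  have ys : `|y s| <= M by apply: hM; rewrite s0 (le_trans (ltW st)).
  have yt : `|y t| <= M by apply: hM; rewrite tT (le_trans s0 (ltW st)).
  rewrite (le_trans (hL _ _ ys yt))// -mulrA ler_wpM2l//.
  have -> : (t - s) `^ (2 * a) = ((t - s) `^ a) ^+ 2.
    by rewrite mulrC powRrM powR_mulrn ?powR_ge0.
  rewrite -exprMn lerXn2r ?nnegrE ?mulr_ge0 ?powR_ge0//.
  exact: hC s0 (ltW st) tT.
have h2 : holder2_on T nu (fun s t => \sum_j partial j f (y s) *
   (delta (fun r => y r 0 j) s t
    - \sum_k sig k (y s) 0 j * delta (fun r => z r 0 k) s t)).
  apply: holder2_on_sum => j.
  have [A _ hA] := holder_on_bounded _ _ _ (ltW a0) (lipschitz_holder _ (lf j)).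
  exact: (holder2_onM _ _ _ (fun s => partial j f (y s)) A hA (solution_coordinate j)).
have h1' := holder2_on_weaken _ _ _ _ T0 nu_le2 h1.
apply: holder2_on_le (holder2_onD _ _ _ _ h1' h2) => s t _ _ _.
rewrite le_eqVlt; apply/orP; left; apply/eqP; congr `|_|.
pose A j := partial j f (y s) * delta (fun r => y r 0 j) s t.
pose B j := partial j f (y s) * \sum_k sig k (y s) 0 j * delta (fun r => z r 0 k) s t.
have eA : \sum_j (y t - y s) 0 j * partial j f (y s) = \sum_j A j.
  by apply: eq_bigr => j _; rewrite /A !mxE mulrC.
have eB : \sum_k vf_act (sig k) f (y s) * delta z s t 0 k = \sum_j B j.
  under [in RHS]eq_bigr do rewrite /B mulr_sumr.
  rewrite exchange_big/=; apply: eq_bigr => k _.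
  rewrite /vf_act mulr_suml; apply: eq_bigr => j _.
  by rewrite !mxE /delta; ring.
have e : \sum_j partial j f (y s) * (delta (fun r => y r 0 j) s t
    - \sum_k sig k (y s) 0 j * delta (fun r => z r 0 k) s t) = \sum_j A j - \sum_j B j.
  by rewrite -sumrB; apply: eq_bigr => j _; rewrite mulrBr.
by rewrite /sharp /tay eA eB e; ring.
Qed.

End solution.

(** * The Hurst index estimator *)

Section rates.
Context {R : realType}.
Implicit Types (r : R) (e : nat -> R).

Lemma decaysS r e : decays r e -> decays r (fun n => e n.+1).
Proof.
move=> [C [N _ hC]]; exists (C * 2 `^ (- r)); exists N => // n /= Nn.
apply: le_trans (hC n.+1 _) _; first exact: leqW.
rewrite -mulrA -powRD ?pnatr_eq0 ?implybT//.
by rewrite -[n.+1%:R]natr1 mulrDr mulr1 opprD addrC.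
Qed.

(** A factor [n] is absorbed by lowering the exponent. *)
Lemma decaysM_nat r r' e : r' < r -> decays r e -> decays r' (fun n => n%:R * e n).
Proof.
move=> rr [C hC]; pose s := (r - r') * ln 2.
have s0 : 0 < s by rewrite mulr_gt0 ?subr_gt0// ln_gt0// ltr1n.
exists (s^-1 * C); near=> n.
have hn : `|e n| <= C * 2 `^ (- (r * n%:R)) by near: n.
rewrite normrM normr_nat.
apply: le_trans (ler_wpM2l (ler0n _ _) hn) _.
have -> : - (r * n%:R) = - (r' * n%:R) - (r - r') * n%:R by ring.
rewrite powRD ?pnatr_eq0 ?implybT//.
have C0 : 0 <= C.
  by have := le_trans (normr_ge0 _) hn; rewrite pmulr_lge0// powR_gt0.
have key : n%:R * 2 `^ (- ((r - r') * n%:R)) <= s^-1.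
  rewrite powRN ler_pdivrMr ?powR_gt0// ler_pdivlMl//.
  rewrite /powR pnatr_eq0/= (_ : _ * ln 2 = s * n%:R); last by rewrite /s; ring.
  by apply: le_trans (expR_ge1Dx _); rewrite lerDr.
have -> (x y : R) : n%:R * (C * (x * y)) = n%:R * y * (C * x) by ring.
by rewrite -[leRHS]mulrA ler_wpM2r// mulr_ge0// powR_ge0.
Unshelve. all: by end_near. Qed.

Lemma near_close e (l x : R) r : 0 < r -> 0 < x -> decays r (fun n => e n - l) ->
  \forall n \near \oo, `|e n - l| <= x.
Proof. by move=> r0 x0 /(decays_cvg0 _ _ r0) /cvgr0Pnorm_le; apply. Qed.

Lemma norm_ln_le (x : R) : `|x - 1| <= 2^-1 -> `|ln x| <= 2 * `|x - 1|.
Proof.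
rewrite ler_norml => /andP[h1 h2]; have x0 : 0 < x by lra.
have up : ln x <= x - 1.
  have := @le_ln1Dx R (x - 1); rewrite (_ : 1 + (x - 1) = x); last by ring.
  by apply; lra.
have lo : - ln x <= x^-1 - 1.
  rewrite -lnV ?posrE//; have := @le_ln1Dx R (x^-1 - 1).
  rewrite (_ : 1 + (x^-1 - 1) = x^-1); last by ring.
  apply.
  by rewrite ltrBrDr addNr invr_gt0.
have lo2 : x^-1 - 1 <= 2 * `|x - 1|.
  have -> : x^-1 - 1 = (1 - x) / x by field; rewrite gt_eqF.
  rewrite ler_pdivrMr// distrC; have := ler_norm (1 - x); have := normr_ge0 (1 - x).
  by nra.
have n0 := normr_ge0 (x - 1); have n1 := ler_norm (x - 1).
by rewrite ler_norml; apply/andP; split; lra.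
Qed.

Lemma norm_expR_sub1_le (t : R) : `|t| <= 2^-1 -> `|expR t - 1| <= 2 * `|t|.
Proof.
rewrite ler_norml => /andP[h1 h2].
have lo := expR_ge1Dx t; have up := expR_ge1Dx (- t).
have e0 := expR_gt0 t; have ee : expR t * expR (- t) = 1 by rewrite expRxMexpNx_1.
have n1 := ler_norm t; have n2 := ler_norm (- t); rewrite normrN in n2.
rewrite ler_norml; apply/andP; split; first lra.
have : expR t * (1 - t) <= 1 by rewrite -[leRHS]ee ler_wpM2l// ltW.
have [t0|t0] := leP 0 t.
  by rewrite ger0_norm//; nra.
move=> _; have : expR t <= 1 by rewrite -[leRHS]expR0 ler_expR ltW.
by have := normr_ge0 t; lra.
Qed.

End rates.

Section hurst_estimator.
Context {R : realType} {d : nat}.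
Variables (T H : R) (y : R -> 'rV[R]_d) (r V : R).
Hypotheses (T0 : 0 < T) (r0 : 0 < r) (V0 : 0 < V).

Let D n : R := T / 2 ^+ n.
Let D0 n : 0 < D n. Proof. by rewrite divr_gt0// exprn_gt0. Qed.

Lemma scaled_var_change (g g' : R) n x : scaled_var_n T g n x T =
  D n `^ (g - g') * scaled_var_n T g' n x T.
Proof.
rewrite /scaled_var_n mulr_sumr; apply: eq_bigr => i _.
rewrite dyadic_mesh -/(D n) mulrA -powRD ?subrK//.
by rewrite (gt_eqF (D0 n)) implybT.
Qed.

Let Vn n := \sum_i scaled_var_n T (1 - 2 * H) n (fun t => y t 0 i) T.
Hypothesis hV : decays r (fun n => Vn n - V).

Lemma scaled_var_vec0E n : scaled_var_vec_n T 0 n y T = D n `^ (2 * H - 1) * Vn n.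
Proof.
rewrite /scaled_var_vec_n /Vn mulr_sumr; apply: eq_bigr => i _.
by rewrite (scaled_var_change 0 (1 - 2 * H)) sub0r opprB.
Qed.

Let ratio n := Vn n.+1 / Vn n.

(** Halving the mesh multiplies the unscaled variation by [2 ^ (1 - 2H)], up
    to the ratio of two scaled variations with the same positive limit. *)
Lemma S_ratioE n : S_ratio T y n = 2 `^ (1 - 2 * H) * ratio n.
Proof.
rewrite /S_ratio !scaled_var_vec0E /ratio.
have -> : D n.+1 `^ (2 * H - 1) = D n `^ (2 * H - 1) * 2 `^ (1 - 2 * H).
  have -> : D n.+1 = D n * 2^-1.
    by rewrite /D exprS; field; rewrite expf_neq0.
  rewrite powRM ?(ltW (D0 n)) ?invr_ge0//; congr (_ * _).
  by rewrite -(powR_inv1 (ler0n _ 2)) -powRrM mulN1r opprB.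
rewrite invfM; set a := _ `^ _; have a0 : a != 0 by rewrite gt_eqF// powR_gt0.
have -> (b v v' : R) : a * b * v * (a^-1 * v') = b * (v * v') * (a / a) by ring.
by rewrite divff// mulr1.
Qed.

Lemma near_variation_pos : \forall n \near \oo, V / 2 <= Vn n.
Proof.
have V2 : 0 < V / 2 by rewrite divr_gt0.
have := near_close _ _ _ _ r0 V2 hV; apply: filterS => n.
by rewrite ler_norml => /andP[]; lra.
Qed.

Lemma near_hurst_est_defined : \forall n \near \oo, hurst_est_defined T y n.
Proof.
near=> n; have V2 : 0 < V / 2 by rewrite divr_gt0.
have v0 : 0 < Vn n by apply: lt_le_trans V2 _; near: n; exact: near_variation_pos.
have v1 : 0 < Vn n.+1.
  apply: lt_le_trans V2 _; near: n.
  have [N _ hN] := near_variation_pos; exists N => // n /= Nn; apply: hN.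
  exact: leqW.
split; first by rewrite scaled_var_vec0E gt_eqF// mulr_gt0// powR_gt0.
by rewrite S_ratioE mulr_gt0 ?powR_gt0// divr_gt0.
Unshelve. all: by end_near. Qed.

Lemma decays_ratio : decays r (fun n => ratio n - 1).
Proof.
have h : decays r (fun n => (Vn n)^-1 * ((Vn n.+1 - V) - (Vn n - V))).
  apply: (decaysM _ _ _ (V / 2)^-1); last exact: (decaysB _ _ _ (decaysS _ _ hV) hV).
  have V2 : 0 < V / 2 by rewrite divr_gt0.
  apply: filterS near_variation_pos => n hn.
  have v0 := lt_le_trans V2 hn.
  by rewrite ger0_norm ?invr_ge0 ?(ltW v0)// lef_pV2 ?posrE.
apply: decays_le h; apply: filterS near_variation_pos => n hn.
have v0 : 0 < Vn n by apply: lt_le_trans hn; rewrite divr_gt0.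
rewrite le_eqVlt; apply/orP; left; apply/eqP; congr `|_|.
by rewrite /ratio; field; rewrite gt_eqF.
Qed.

Lemma hurst_est_rate : decays r (fun n => hurst_est T y n - H).
Proof.
have ln2 : 0 < ln 2 :> R by rewrite ln_gt0// ltr1n.
apply: decays_le (decaysZ _ _ (ln 2)^-1 decays_ratio).
have close := near_close _ _ _ _ r0 (_ : 0 < 2^-1) decays_ratio.
near=> n.
have h : `|ratio n - 1| <= 2^-1 by near: n; apply: close.
have p0 : 0 < ratio n by move: h; rewrite ler_norml => /andP[]; lra.
have -> : hurst_est T y n - H = - (ln 2)^-1 * (2^-1 * ln (ratio n)).
  rewrite /hurst_est S_ratioE lnM ?posrE ?powR_gt0// ln_powR.
  by field; rewrite gt_eqF.
rewrite !normrM normrN ler_wpM2l// ger0_norm// mulrC ler_pdivrMr// mulrC.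
exact: norm_ln_le.
Unshelve. all: by end_near. Qed.

(** The power is the exponential of [2 (H - H_n) ln (T / 2 ^ n)], and the
    logarithm grows linearly in [n]. *)
Lemma mesh_power_rate r' : r' < r -> 0 < r' ->
  decays r' (fun n => D n `^ (2 * (H - hurst_est T y n)) - 1).
Proof.
move=> rr r'0; pose t n := 2 * (H - hurst_est T y n) * ln (D n).
have ht : decays r' t.
  have h1 := decaysZ _ _ (- 2 * ln T) (decaysM_nat _ _ _ rr hurst_est_rate).
  have h2 := decaysZ _ _ (2 * ln 2) (decaysM_nat _ _ _ rr hurst_est_rate).
  have h1' : decays r' (fun n => - 2 * ln T * (hurst_est T y n - H)).
    apply: decays_le h1; near=> n; rewrite !normrM normr_nat ler_wpM2l ?mulr_ge0//.
    by rewrite ler_peMl// ler1n; near: n; exists 1%N.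
  apply: decays_le (decaysD _ _ _ h1' h2); apply: nearW => n.
  rewrite le_eqVlt; apply/orP; left; apply/eqP; congr `|_|.
  rewrite /t /D lnM ?posrE ?invr_gt0 ?exprn_gt0// lnV ?posrE ?exprn_gt0// lnXn//.
  by rewrite -mulr_natl; ring.
have close : \forall n \near \oo, `|t n| <= 2^-1.
  have h20 : 0 < 2^-1 :> R by [].
  exact: (cvgr0Pnorm_le _).1 (decays_cvg0 _ _ r'0 ht) _ h20.
apply: decays_le (decaysZ _ _ 2 ht); near=> n.
rewrite /powR (gt_eqF (D0 n)) normrM normr_nat; apply: norm_expR_sub1_le.
by near: n.
Unshelve. all: by end_near. Qed.

End hurst_estimator.

(** * Stability of least squares *)

Section least_squares.
Context {R : realType}.

Definition sqnorm {n} (v : 'cV[R]_n) : R := \sum_i v i 0 ^+ 2.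

Lemma sqnorm_ge0 n (v : 'cV[R]_n) : 0 <= sqnorm v.
Proof. by apply: sumr_ge0 => i _; exact: sqr_ge0. Qed.

Lemma fnorm_cvE n (v : 'cV[R]_n) : fnorm v = Num.sqrt (sqnorm v).
Proof. by congr Num.sqrt; apply: eq_bigr => i _; rewrite big_ord1. Qed.

Lemma sqnormE n (v : 'cV[R]_n) : sqnorm v = (v^T *m v) 0 0.
Proof. by rewrite mxE; apply: eq_bigr => i _; rewrite mxE expr2. Qed.

Lemma sqnorm_eq0 n (v : 'cV[R]_n) : sqnorm v = 0 -> v = 0.
Proof.
move=> /eqP; rewrite psumr_eq0; last by move=> i _; exact: sqr_ge0.
move=> /allP h; apply/colP => i; rewrite mxE.
by have := h i (mem_index_enum _); rewrite sqrf_eq0 => /eqP.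
Qed.

Lemma sqnormD_le n (v w : 'cV[R]_n) : sqnorm (v + w) <= 2 * (sqnorm v + sqnorm w).
Proof.
rewrite /sqnorm -big_split/= mulr_sumr; apply: ler_sum => i _.
by rewrite mxE; have := sqr_ge0 (v i 0 - w i 0); rewrite sqrrB sqrrD; lra.
Qed.

Lemma sqnormN n (v : 'cV[R]_n) : sqnorm (- v) = sqnorm v.
Proof. by apply: eq_bigr => i _; rewrite mxE sqrrN. Qed.

Lemma sqr_sum_le n (x : 'I_n -> R) : (\sum_i x i) ^+ 2 <= n%:R * \sum_i x i ^+ 2.
Proof.
apply: (@le_trans _ _ (\sum_i \sum_j (x i ^+ 2 + x j ^+ 2) / 2)).
  rewrite expr2 big_distrlr/=; apply: ler_sum => i _; apply: ler_sum => j _.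
  by have := sqr_ge0 (x i - x j); rewrite sqrrB ler_pdivlMr//; lra.
under eq_bigr => i _ do rewrite -mulr_suml big_split/= sumr_const card_ord.
rewrite -mulr_suml big_split/= sumrMnl sumr_const card_ord.
by set s := \sum_i _; rewrite -(mulr_natl s n); lra.
Qed.

(** A bound for the square of the Euclidean operator norm. *)
Definition mx_bound {m n} (A : 'M[R]_(m, n)) : R := n%:R * \sum_i \sum_j A i j ^+ 2.

Lemma mx_bound_ge0 m n (A : 'M[R]_(m, n)) : 0 <= mx_bound A.
Proof.
rewrite mulr_ge0//; apply: sumr_ge0 => i _; apply: sumr_ge0 => j _.
exact: sqr_ge0.
Qed.

Lemma sqnorm_mulmx m n (A : 'M[R]_(m, n)) (v : 'cV[R]_n) :
  sqnorm (A *m v) <= mx_bound A * sqnorm v.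
Proof.
rewrite /mx_bound -mulrA mulr_suml mulr_sumr; apply: ler_sum => i _.
rewrite mxE (le_trans (sqr_sum_le _ _))// ler_wpM2l// mulr_suml.
apply: ler_sum => j _; rewrite exprMn ler_wpM2l ?sqr_ge0//.
by rewrite /sqnorm (bigD1 j)//= lerDl sumr_ge0// => l _; exact: sqr_ge0.
Qed.

Lemma fnorm_le_sum_norm n (v : 'cV[R]_n) : fnorm v <= \sum_i `|v i 0|.
Proof.
have s0 : 0 <= \sum_i `|v i 0| by exact: sumr_ge0.
rewrite fnorm_cvE -(ger0_norm s0) -sqrtr_sqr ler_wsqrtr//.
rewrite expr2 mulr_suml; apply: ler_sum => i _.
rewrite -(real_normK (num_real (v i 0))) expr2 ler_wpM2l//.
by rewrite (bigD1 i)//= lerDl sumr_ge0.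
Qed.

Lemma full_rank_lower_bound m n (X : 'M[R]_(m, n)) : row_free X^T ->
  exists2 c, 0 < c & forall v : 'cV[R]_n, sqnorm v <= c * sqnorm (X *m v).
Proof.
move=> /row_freeP[B hB]; exists (mx_bound B^T + 1).
  by rewrite ltr_wpDl// mx_bound_ge0.
move=> v; have -> : sqnorm v = sqnorm (B^T *m (X *m v)).
  have BX : B^T *m X = 1%:M by rewrite -[LHS]trmxK trmx_mul trmxK hB trmx1.
  by rewrite mulmxA BX mul1mx.
rewrite (le_trans (sqnorm_mulmx _ _ _ _))// ler_wpM2r ?sqnorm_ge0//.
by rewrite lerDl.
Qed.

Lemma perturbed_lower_bound m n (X X' : 'M[R]_(m, n)) c : 0 < c ->
  (forall v : 'cV[R]_n, sqnorm v <= c * sqnorm (X *m v)) ->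
  mx_bound (X - X') <= (4 * c)^-1 ->
  forall v : 'cV[R]_n, sqnorm v <= 4 * c * sqnorm (X' *m v).
Proof.
move=> c0 hc hX v; have := sqnormD_le _ (X' *m v) ((X - X') *m v).
rewrite -mulmxDl addrCA subrr addr0 => h.
have h1 := le_trans (hc v) (ler_wpM2l (ltW c0) h).
have h2 : sqnorm ((X - X') *m v) <= (4 * c)^-1 * sqnorm v.
  by rewrite (le_trans (sqnorm_mulmx _ _ _ _))// ler_wpM2r ?sqnorm_ge0.
have h3 : c * (2 * sqnorm ((X - X') *m v)) <= 2^-1 * sqnorm v.
  have := ler_wpM2l (ltW c0) (ler_wpM2l (ler0n R 2) h2).
  by rewrite [X in _ <= X](_ : _ = 2^-1 * sqnorm v)//; field; rewrite gt_eqF.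
by move: h1; rewrite !mulrDr; lra.
Qed.

Lemma gram_unit m n (X : 'M[R]_(m, n)) :
  (forall v : 'cV[R]_n, X *m v = 0 -> v = 0) -> X^T *m X \in unitmx.
Proof.
move=> inj; rewrite -row_free_unit -kermx_eq0; apply/eqP/row_matrixP => i.
rewrite row0; set u := row i _.
have u0 : u *m (X^T *m X) = 0 by rewrite -row_mul mulmx_ker row0.
rewrite -[u]trmxK; suff -> : u^T = 0 by rewrite trmx0.
apply: inj; apply: sqnorm_eq0; rewrite sqnormE trmx_mul trmxK -mulmxA.
by rewrite (mulmxA X^T) mulmxA u0 mul0mx mxE.
Qed.

Lemma least_squares_pythagoras m n (X : 'M[R]_(m, n)) Y b b' :
  X^T *m (Y - X *m b) = 0 ->
  sqnorm (Y - X *m b') = sqnorm (Y - X *m b) + sqnorm (X *m (b - b')).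
Proof.
move=> ortho.
have -> : Y - X *m b' = (Y - X *m b) + X *m (b - b').
  by rewrite mulmxBr addrA subrK.
set s := Y - X *m b; set t := X *m (b - b').
have st : t^T *m s = 0 by rewrite /t trmx_mul -mulmxA ortho mulmx0.
have ts : s^T *m t = 0 by rewrite -[LHS]trmxK trmx_mul trmxK st trmx0.
have -> : sqnorm (s + t) = ((s^T + t^T) *m (s + t)) 0 0.
  by rewrite sqnormE; congr ((_ *m _) _ _); apply/matrixP => i j; rewrite !mxE.
by rewrite !sqnormE mulmxDl (mulmxDr _ s t) (mulmxDr _ s t) st ts addr0 add0r mxE.
Qed.

Lemma argminP m n (X : 'M[R]_(m, n)) Y b : is_argmin X Y b <->
  forall b', sqnorm (Y - X *m b) <= sqnorm (Y - X *m b').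
Proof.
split=> h b'; have := h b'; rewrite !fnorm_cvE ler_sqrt ?sqnorm_ge0//.
Qed.

(** The solution of the normal equations; the Pythagorean identity makes any
    other vector strictly worse. *)
Lemma argmin_exists_unique m n (X : 'M[R]_(m, n)) Y :
  (forall v : 'cV[R]_n, X *m v = 0 -> v = 0) -> exists! b, is_argmin X Y b.
Proof.
move=> inj; have gu := gram_unit _ _ _ inj.
pose b := invmx (X^T *m X) *m (X^T *m Y).
have ortho : X^T *m (Y - X *m b) = 0.
  by rewrite mulmxBr mulmxA /b mulKVmx// subrr.
have pyth b' := least_squares_pythagoras _ _ X Y b b' ortho.
exists b; split.
  by apply/argminP => b'; rewrite (pyth b') lerDl sqnorm_ge0.
move=> b' /argminP/(_ b); rewrite (pyth b') gerDl => le0.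
have /sqnorm_eq0/inj/eqP : sqnorm (X *m (b - b')) = 0.
  by apply/eqP; rewrite eq_le le0 sqnorm_ge0.
by rewrite subr_eq0 => /eqP.
Qed.

(** A minimiser fits [Y] at least as well as [beta] does, so [X (b - beta)]
    is controlled by the residual of [beta]. *)
Lemma argmin_error m n (X : 'M[R]_(m, n)) Y b beta c : 0 <= c ->
  (forall v : 'cV[R]_n, sqnorm v <= c * sqnorm (X *m v)) ->
  is_argmin X Y b ->
  fnorm (beta - b) <= 2 * Num.sqrt c * \sum_i `|(Y - X *m beta) i 0|.
Proof.
move=> c0 hc /argminP/(_ beta) hb.
have hs : sqnorm (beta - b) <= 4 * c * sqnorm (Y - X *m beta).
  rewrite (le_trans (hc _))// [4 * c]mulrC -mulrA ler_wpM2l//.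
  have -> : X *m (beta - b) = (Y - X *m b) + - (Y - X *m beta).
    by rewrite mulmxBr opprB [RHS]addrC addrA subrK.
  by rewrite (le_trans (sqnormD_le _ _ _))// sqnormN; lra.
rewrite fnorm_cvE.
apply: (@le_trans _ _ (Num.sqrt (4 * c * sqnorm (Y - X *m beta)))).
  by rewrite ler_wsqrtr.
rewrite sqrtrM ?mulr_ge0// sqrtrM// -fnorm_cvE.
have -> : Num.sqrt 4 = 2 :> R.
  by rewrite (_ : 4 = 2 ^+ 2) ?sqrtr_sqr ?ger0_norm//; ring.
by rewrite ler_wpM2l ?fnorm_le_sum_norm// mulr_ge0// sqrtr_ge0.
Qed.

End least_squares.

(** * Consistency of the estimator along one path *)

Section more_rates.
Context {R : realType}.
Implicit Types (r : R) (e : nat -> R).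

Lemma decays_weaken r r' e : r' <= r -> decays r e -> decays r' e.
Proof.
move=> rr [C hC]; exists `|C|; near=> n.
apply: (@le_trans _ _ (C * 2 `^ (- (r * n%:R)))); first by near: n.
apply: le_trans (ler_wpM2r (powR_ge0 _ _) (ler_norm C)) _.
rewrite ler_wpM2l//; apply: ler_powR; first by rewrite ler1n.
by rewrite lerN2 ler_wpM2r.
Unshelve. all: by end_near. Qed.

Lemma decays_norm r e : decays r e -> decays r (fun n => `|e n|).
Proof. by apply: decays_le; apply: nearW => n; rewrite normr_id. Qed.

Lemma decays_bounded r e l : 0 < r -> decays r (fun n => e n - l) ->
  \forall n \near \oo, `|e n| <= `|l| + 1.
Proof.
move=> r0 /(near_close _ _ _ _ r0 ltr01); apply: filterS => n h.
by rewrite -[e n](subrK l) (le_trans (ler_normD _ _))// addrC lerD2l.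
Qed.

(** The bounds on [r] hold strictly at [a = H], hence for [a < H] close enough
    to [H].  The last two are those under which [controlled_variation_rate] can ignore the remainder of
    exponent [min 1 (2 a)], and they read [r <= H] and [r <= 2 H] at [a = H]
    when [H <= 1/2], [r <= 1 - H] and [r <= 2 (1 - H)] otherwise. *)
Lemma holder_exponent_choice (H eps : R) : 3^-1 < H < 1 -> 0 < eps < H ->
  let r := (1 - Num.max 2^-1 H) * (H - eps / 4) in
  exists a, [/\ admissible H a, 0 < a < H, r <= a * (1 - Num.max 2^-1 H),
    r <= a + Num.min 1 (2 * a) - 2 * H & r <= 2 * Num.min 1 (2 * a) - 2 * H].
Proof.
move=> /andP[H1 H2] /andP[e0 eH] r; rewrite /admissible /r.
have [Hh|Hh] := leP H 2^-1.
  pose dl := Num.min (eps / 24) ((H - 3^-1) / 2).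
  have d0 : 0 < dl by rewrite lt_min; apply/andP; split; lra.
  have d1 : dl <= eps / 24 by rewrite ge_min lexx.
  have d2 : dl <= (H - 3^-1) / 2 by rewrite ge_min lexx orbT.
  exists (H - dl).
  have -> : Num.min 1 (2 * (H - dl)) = 2 * (H - dl) by apply/min_idPr; lra.
  split; lra.
pose dl := Num.min ((1 - H) * eps / 4) ((H - 2^-1) / 2).
have e1 : 0 < (1 - H) * eps by rewrite mulr_gt0// subr_gt0.
have e2 : (1 - H) * eps < eps by rewrite gtr_pMl//; lra.
have d0 : 0 < dl by rewrite lt_min; apply/andP; split; lra.
have d1 : dl <= (1 - H) * eps / 4 by rewrite ge_min lexx.
have d2 : dl <= (H - 2^-1) / 2 by rewrite ge_min lexx orbT.
exists (H - dl).
have -> : Num.min 1 (2 * (H - dl)) = 1 by apply/min_idPl; lra.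
split; try lra; nra.
Qed.

(** For [n >= 1] the right-hand side is at least
    [2 ^ (- (1 - Hmax) (H - eps) n)], with [Hmax] the maximum of [1/2] and
    [H]; the gap between [eps / 2] and [eps] absorbs the constant hidden in
    [decays]. *)
Lemma rate_absorbs (H eps : R) e : 3^-1 < H < 1 -> 0 < eps < H ->
  decays ((1 - Num.max 2^-1 H) * (H - eps / 2)) e ->
  \forall n \near \oo, `|e n| <= n%:R * delta_rate H n `^ (H - eps).
Proof.
move=> /andP[H1 H2] /andP[e0 eH] [C hC].
set x := 1 - Num.max 2^-1 H.
have x0 : 0 < x by rewrite subr_gt0 gt_max H2 andbT; lra.
pose s := x * (eps / 2).
have s0 : 0 < s by rewrite mulr_gt0// divr_gt0.
have hs : decays s (fun n => C * 2 `^ (- (s * n%:R))).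
  by exists `|C|; apply: nearW => n; rewrite normrM (ger0_norm (powR_ge0 _ _)).
have small := (cvgr0Pnorm_le _).1 (decays_cvg0 _ _ s0 hs) 1 ltr01.
near=> n.
have n1 : 1 <= n%:R :> R by rewrite ler1n; near: n; exists 1%N.
have h1 : `|e n| <= C * 2 `^ (- (x * (H - eps / 2) * n%:R)) by near: n.
have h2 : `|C * 2 `^ (- (s * n%:R))| <= 1 by near: n; exact: small.
apply: le_trans h1 _.
have -> : - (x * (H - eps / 2) * n%:R) = - (s * n%:R) + (- (n%:R * x)) * (H - eps).
  by rewrite /s; field.
rewrite [X in C * X]powRD ?pnatr_eq0 ?implybT// mulrA.
apply: le_trans (ler_wpM2r (powR_ge0 _ _) (ler_norm (C * _))) _.
apply: ler_pM (normr_ge0 _) (powR_ge0 _ _) (le_trans h2 n1) _.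
rewrite powRrM; apply: ge0_ler_powR; rewrite ?nnegrE ?powR_ge0//.
- by rewrite subr_ge0 ltW.
- by rewrite /delta_rate; case: ifP => _; rewrite mulr_ge0 ?powR_ge0 ?sqrtr_ge0.
have sn : 1 <= Num.sqrt n%:R :> R by rewrite -[leLHS]sqrtr1 ler_wsqrtr.
rewrite /delta_rate /x; have [hH|hH] := leP H 2^-1.
  by rewrite (_ : n%:R * (1 - 2^-1) = n%:R / 2) ?ler_peMr ?powR_ge0//; field.
by rewrite ler_peMr ?powR_ge0.
Unshelve. all: by end_near. Qed.

End more_rates.

Section pathwise.
Context {R : realType} {d K M : nat}.
Local Notation mu := (@lebesgue_measure R).
Variables (T H eps : R) (theta : 'I_K -> R).
Variables (u : R -> 'rV[R]_d -> 'rV[R]_d) (sigma : 'I_K -> 'rV[R]_d -> 'rV[R]_d).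
Variables (f : 'I_M -> 'rV[R]_d -> R) (y : R -> 'rV[R]_d) (z : R -> 'rV[R]_K).
Hypotheses (T0 : 0 < T) (H31 : 3^-1 < H < 1) (heps : 0 < eps < H).
Local Notation Hmax := (Num.max 2^-1 H).
Local Notation sig := (scaled_vf theta sigma).
Let r := (1 - Hmax) * (H - eps / 4).
Let r' := (1 - Hmax) * (H - eps / 2).

Hypothesis cu : {within [set p : R * 'rV[R]_d | 0 <= p.1 <= T],
        continuous (fun p => u p.1 p.2)}.
Hypothesis Csigma : forall a, admissible H a ->
  forall k i, Cn (Num.truncn a^-1) (fun x => sigma k x 0 i).
Hypothesis Cf : forall m, Cn 2 (f m).
Hypothesis hy : forall a, admissible H a -> (holder2_mx T a (delta y) < +oo)%E.
Hypothesis hrem : forall a, admissible H a ->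
  (holder2_mx T (2 * a) (remainder1 u sig z y) < +oo)%E.
Hypothesis hz : forall a, 0 < a < H -> (holder2_mx T a (delta z) < +oo)%E.
Hypothesis hdef : forall k l, exists C, forall n,
  covariation_defect T H (k == l)%:R n (fun t => z t 0 k) (fun t => z t 0 l)
  <= C * 2 `^ (- (r * n%:R)).

Let H01 : 0 < H < 1. Proof. by case/andP: H31; lra. Qed.
Let x0 : 0 < 1 - Hmax.
Proof. by case/andP: H31 => h1 h2; rewrite subr_gt0 gt_max h2 andbT; lra. Qed.
Let r'0 : 0 < r'.
Proof. by case/andP: heps => h1 h2; rewrite mulr_gt0//; lra. Qed.
Let rr : r' < r.
Proof. by case/andP: heps => h1 h2; rewrite ltr_pM2l//; lra. Qed.
Let r0 : 0 < r. Proof. exact: lt_trans rr. Qed.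

Lemma sigma_locally_lipschitz k i : locally_lipschitz (fun x => sigma k x 0 i).
Proof.
have [a [adm /andP[a0 aH] _ _ _]] := holder_exponent_choice H eps H31 heps.
apply: Cn_locally_lipschitz (Csigma a adm k i).
rewrite truncn_gt0 invf_ge1//; case/andP: H01 => _ h; lra.
Qed.

Lemma scaled_locally_lipschitz k i : locally_lipschitz (fun x => sig k x 0 i).
Proof.
move=> N N0; have [C C0 hC] := sigma_locally_lipschitz k i N N0.
exists (`|theta k| * C); first by rewrite mulr_ge0.
move=> v w vN wN; rewrite !mxE -mulrBr normrM -mulrA ler_wpM2l//.
exact: hC.
Qed.

Lemma vf_act_scaled k m w : vf_act (sig k) (f m) w = theta k * vf_act (sigma k) (f m) w.
Proof.
rewrite /vf_act mulr_sumr; apply: eq_bigr => j _.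
by rewrite mxE mulrA.
Qed.

Let lf m j : locally_lipschitz (partial j (f m)).
Proof. by case: (Cf m) => _ h; exact: (Cn_locally_lipschitz 1 _ _ (h j)). Qed.

Let V := \sum_i \sum_k \int[mu]_(s in `[0, T]) (sig k (y s) 0 i ^+ 2).
Let Xm := X_mx T sigma f y.
Let beta : 'cV[R]_K := \col_k theta k ^+ 2.

Lemma coordinate_variation_rate i : decays r (fun n =>
  scaled_var_n T (1 - 2 * H) n (fun t => y t 0 i) T
  - \sum_k \int[mu]_(s in `[0, T]) (sig k (y s) 0 i ^+ 2)).
Proof.
have [a [adm /andP[a0 aH] ra ran rn]] := holder_exponent_choice H eps H31 heps.
have hza := hz a (introT andP (conj a0 aH)).
have hz' k : holder_on T a (fun t => z t 0 k).
  apply: holder2_on_delta; apply: holder2_on_le (holder2_mx_entry _ _ _ _ k hza).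
  by move=> s t _ _ _; rewrite !mxE.
have hg k : holder_on T a (fun s => sig k (y s) 0 i).
  exact: (lipschitz_holder T a y T0 a0 (hy a adm) (fun x => sig k x 0 i)
    (scaled_locally_lipschitz k i)).
have hx := solution_coordinate T a y z u sig T0 a0 cu (hy a adm) (hrem a adm) i.
exact: (controlled_variation_rate T H T0 H01 K (fun k t => z t 0 k) a r a0
  (ltW r0) ra hz' hdef _ (fun k s => sig k (y s) 0 i) _ ran rn hg hx).
Qed.

Lemma function_variation_rate m : decays r (fun n =>
  scaled_var_n T (1 - 2 * H) n (f m \o y) T
  - \sum_k \int[mu]_(s in `[0, T]) (vf_act (sig k) (f m) (y s) ^+ 2)).
Proof.
have [a [adm /andP[a0 aH] ra ran rn]] := holder_exponent_choice H eps H31 heps.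
have hza := hz a (introT andP (conj a0 aH)).
have hz' k : holder_on T a (fun t => z t 0 k).
  apply: holder2_on_delta; apply: holder2_on_le (holder2_mx_entry _ _ _ _ k hza).
  by move=> s t _ _ _; rewrite !mxE.
have hg k : holder_on T a (fun s => vf_act (sig k) (f m) (y s)).
  apply: (vf_act_holder T a y T0 a0 (hy a adm)) => j //.
  exact: scaled_locally_lipschitz.
have hx : holder2_on T (Num.min 1 (2 * a)) (fun s t => delta (f m \o y) s t
    - \sum_k vf_act (sig k) (f m) (y s) * delta (fun t => z t 0 k) s t).
  have := solution_function T a y z u sig T0 a0 cu (hy a adm) (hrem a adm) _ (Cf m).
  apply: holder2_on_le => s t _ _ _; rewrite le_eqVlt; apply/orP; left; apply/eqP.
  by congr `|_ - _|; apply: eq_bigr => k _; rewrite !mxE.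
exact: (controlled_variation_rate T H T0 H01 K (fun k t => z t 0 k) a r a0
  (ltW r0) ra hz' hdef _ (fun k s => vf_act (sig k) (f m) (y s)) _ ran rn hg hx).
Qed.

Lemma vf_sqr_holder k m : exists a, [/\ 0 < a, r <= a &
  holder_on T a (fun s => vf_act (sigma k) (f m) (y s) ^+ 2)].
Proof.
have [a [adm /andP[a0 aH] ra _ _]] := holder_exponent_choice H eps H31 heps.
exists a; split => //.
  apply: le_trans ra _; rewrite ler_piMr ?(ltW a0)//.
  have /andP[h _] := Hmax_itv H H01; lra.
have hg : holder_on T a (fun s => vf_act (sigma k) (f m) (y s)).
  apply: (vf_act_holder T a y T0 a0 (hy a adm)) => j //.
  exact: sigma_locally_lipschitz.
exact: (holder_onM T a _ _ (ltW a0) hg hg).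
Qed.

Lemma vf_sqr_integrable k m :
  mu.-integrable `[0, T] (EFin \o (fun s => vf_act (sigma k) (f m) (y s) ^+ 2)).
Proof.
have [a [a0 _ h]] := vf_sqr_holder k m.
exact: continuous_segment_integrable (holder_on_continuous _ _ _ a0 h).
Qed.

Lemma design_matrix_rate m k :
  decays r (fun n => Xn_mx T sigma f y n m k - Xm m k).
Proof.
have [a [a0 ra [C C0 hC]]] := vf_sqr_holder k m.
apply: decays_le (decaysZ _ _ (C * T) (decays_pow _ _ _ T0 ra)).
apply: nearW => n; rewrite [leRHS]ger0_norm ?mulr_ge0 ?powR_ge0 ?(ltW T0)//.
apply: le_trans (riemann_sum_error T a C _ n T0 a0 C0 hC).
rewrite le_eqVlt; apply/orP; left; apply/eqP; congr `|_|.
rewrite !mxE; congr (_ - _); apply: eq_bigr => i _.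
by rewrite dyadic_mesh.
Qed.

Lemma limit_variationE m :
  \sum_k \int[mu]_(s in `[0, T]) (vf_act (sig k) (f m) (y s) ^+ 2)
  = (Xm *m beta) m 0.
Proof.
rewrite mxE; apply: eq_bigr => k _; rewrite !mxE mulrC.
rewrite -(RintegralZl _ _ (vf_sqr_integrable k m))//.
by apply: eq_Rintegral => s _; rewrite vf_act_scaled exprMn.
Qed.

Lemma response_rate m : decays r (fun n =>
  scaled_var_n T (1 - 2 * H) n (f m \o y) T - (Xm *m beta) m 0).
Proof. by rewrite -limit_variationE; exact: function_variation_rate. Qed.

Lemma Y_vecE : Y_vec T H f y = Xm *m beta.
Proof.
apply/colP => m; rewrite mxE; apply/cvg_lim => //.
exact: decays_cvg r0 (response_rate m).
Qed.

(** By the chain rule the variation of every [f_m (y)] is bounded by a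
    multiple of that of [y], so a nonzero response forces [y] to have nonzero variation. *)
Lemma variation_gt0 : Y_vec T H f y != 0 -> 0 < V.
Proof.
have [a [adm /andP[a0 aH] _ _ _]] := holder_exponent_choice H eps H31 heps.
have hs k i : holder_on T a (fun s => sig k (y s) 0 i).
  exact: (lipschitz_holder T a y T0 a0 (hy a adm) (fun x => sig k x 0 i)
    (scaled_locally_lipschitz k i)).
have is2 k i : mu.-integrable `[0, T] (EFin \o (fun s => sig k (y s) 0 i ^+ 2)).
  exact: continuous_segment_integrable (holder_on_continuous _ _ _ a0
    (holder_onM T a _ _ (ltW a0) (hs k i) (hs k i))).
have I0 k i : 0 <= \int[mu]_(s in `[0, T]) (sig k (y s) 0 i ^+ 2).
  by apply: Rintegral_ge0 => s _; exact: sqr_ge0.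
have V0 : 0 <= V by apply: sumr_ge0 => i _; apply: sumr_ge0 => k _; exact: I0.
move=> Y0; rewrite lt_neqAle V0 andbT; apply: contra_neq Y0 => /esym VE.
have IE k i : \int[mu]_(s in `[0, T]) (sig k (y s) 0 i ^+ 2) = 0.
  move/eqP: VE; rewrite psumr_eq0; last by move=> j _; exact: sumr_ge0.
  move/allP/(_ i (mem_index_enum _)); rewrite psumr_eq0//.
  by move/allP/(_ k (mem_index_enum _))/eqP.
rewrite Y_vecE; apply/colP => m; rewrite -limit_variationE mxE.
apply: big1 => k _; apply/eqP; rewrite eq_le Rintegral_ge0 ?andbT; last first.
  by move=> s _; exact: sqr_ge0.
have hp j := holder_on_bounded _ _ _ (ltW a0)
  (lipschitz_holder T a y T0 a0 (hy a adm) _ (lf m j)).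
pose A j := s2val (cid2 (hp j)).
have hA j t : 0 <= t <= T -> partial j (f m) (y t) ^+ 2 <= A j ^+ 2.
  move=> ht; rewrite /A; case: (cid2 _) => /= B B0 hB.
  by rewrite -real_normK ?num_real// lerXn2r ?nnegrE// hB.
have mI : measurable (`[0, T]%classic : set (measurableTypeR R)) by exact: measurable_itv.
have iA j : mu.-integrable `[0, T] (EFin \o (fun s => d%:R * A j ^+ 2 * sig k (y s) 0 j ^+ 2)).
  exact: (integrableZl mI (d%:R * A j ^+ 2) (is2 k j)).
apply: (@le_trans _ _ (\int[mu]_(s in `[0, T])
    \sum_j (d%:R * A j ^+ 2 * sig k (y s) 0 j ^+ 2))).
  apply: le_Rintegral => //.
  - under [X in EFin \o X]eq_fun do rewrite vf_act_scaled exprMn.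
    exact: (integrableZl mI (theta k ^+ 2) (vf_sqr_integrable k m)).
  - exact: integrable_sumr.
  - move=> s; rewrite /= in_itv/= => hs'.
    rewrite /vf_act (le_trans (sqr_sum_le _ _))// mulr_sumr.
    apply: ler_sum => j _; rewrite exprMn -mulrA ler_wpM2l// mulrC.
    by rewrite ler_wpM2r ?sqr_ge0// hA.
rewrite Rintegral_sum// big1// => j _.
by rewrite (RintegralZl _ _ (is2 k j))// IE mulr0.
Qed.

(** The residual [Ybar_n - X_n beta] splits into the effect of [H_n] on the
    response, the error of the scaled variations, and the error of the design
    matrix applied to [beta]. *)
Lemma estimator_rate : row_free Xm^T -> Y_vec T H f y != 0 ->
  exists2 e : nat -> R, decays r' e & \forall n \near \oo,
    [/\ hurst_est_defined T y n,
        exists! b, is_argmin (Xn_mx T sigma f y n) (Ybar_vec T f y n) b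
      & forall b, is_argmin (Xn_mx T sigma f y n) (Ybar_vec T f y n) b ->
        fnorm (beta - b) <= e n].
Proof.
move=> fullX Y0; have V0 := variation_gt0 Y0.
have hV : decays r (fun n =>
    \sum_i scaled_var_n T (1 - 2 * H) n (fun t => y t 0 i) T - V).
  rewrite /V; under eq_fun do rewrite -sumrB.
  by apply: decays_sum => i; exact: coordinate_variation_rate.
have [c c0 hc] := full_rank_lower_bound _ _ _ fullX.
have hX : decays r (fun n => mx_bound (Xm - Xn_mx T sigma f y n)).
  apply: decaysZ; apply: decays_sum => m; apply: decays_sum => k.
  have h := design_matrix_rate m k.
  have bnd : \forall n \near \oo, `|Xn_mx T sigma f y n m k - Xm m k| <= 1.
    exact: near_close r0 ltr01 h.
  apply: decays_le (decaysM _ _ _ _ bnd h); apply: nearW => n.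
  rewrite le_eqVlt; apply/orP; left; apply/eqP; congr `|_|.
  have -> : (Xm - Xn_mx T sigma f y n) m k = Xm m k - Xn_mx T sigma f y n m k.
    by rewrite !mxE.
  by ring.
have c40 : 0 < (4 * c)^-1 by rewrite invr_gt0 mulr_gt0.
have smallX := (cvgr0Pnorm_le _).1 (decays_cvg0 _ _ r0 hX) _ c40.
pose res n m := (Ybar_vec T f y n - Xn_mx T sigma f y n *m beta) m 0.
have hres m : decays r' (fun n => res n m).
  have hmesh := mesh_power_rate T H y r V T0 r0 V0 hV r' rr r'0.
  have h1 := decaysM _ _ _ _ (decays_bounded _ _ _ r0 (response_rate m)) hmesh.
  have h2 := decays_weaken _ _ _ (ltW rr) (response_rate m).
  have h3 : decays r' (fun n => \sum_k beta k 0 * (Xn_mx T sigma f y n m k - Xm m k)).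
    apply: decays_sum => k; apply: decaysZ; apply: decays_weaken (ltW rr) _.
    exact: design_matrix_rate.
  apply: decays_le (decaysB _ _ _ (decaysD _ _ _ h1 h2) h3); apply: nearW => n.
  rewrite le_eqVlt; apply/orP; left; apply/eqP; congr `|_|.
  have -> : res n m = Ybar_vec T f y n m 0 - (Xn_mx T sigma f y n *m beta) m 0.
    by rewrite /res !mxE.
  rewrite [Ybar_vec T f y n m 0]mxE (scaled_var_change T T0 _ (1 - 2 * H)).
  have -> : 1 - 2 * hurst_est T y n - (1 - 2 * H) = 2 * (H - hurst_est T y n) by ring.
  have -> : \sum_k beta k 0 * (Xn_mx T sigma f y n m k - Xm m k) =
      (Xn_mx T sigma f y n *m beta) m 0 - (Xm *m beta) m 0.
    rewrite [(Xn_mx _ _ _ _ _ *m _) m 0]mxE [(Xm *m _) m 0]mxE -sumrB.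
    by apply: eq_bigr => k _; ring.
  by ring.
exists (fun n => 2 * Num.sqrt (4 * c) * \sum_m `|res n m|).
  by apply: decaysZ; apply: decays_sum => m; exact: decays_norm.
near=> n; have hn : mx_bound (Xm - Xn_mx T sigma f y n) <= (4 * c)^-1.
  apply: le_trans (ler_norm _) _; near: n; exact: smallX.
have low := perturbed_lower_bound _ _ _ _ c c0 hc hn.
split.
- by near: n; exact: near_hurst_est_defined T0 r0 V0 hV.
- apply: argmin_exists_unique => v Xv0; apply: sqnorm_eq0; apply/eqP.
  rewrite eq_le sqnorm_ge0 andbT (le_trans (low v))// Xv0.
  by rewrite sqnormE mulmx0 mxE mulr0.
- move=> b hb; apply: argmin_error low hb.
  by rewrite mulr_ge0// ltW.
Unshelve. all: by end_near. Qed.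

End pathwise.

(** * Almost sure error of the least squares estimator *)

Theorem theorem5p5 (R : realType) (K d M : nat) (H eps : R)
    (hH : 3^-1 < H < 1) (heps : 0 < eps < H) :
  exists (C1 : const_fun R K M) (C2 : R -> R),
  forall (disp : measure_display) (Omega : measurableType disp)
    (P : probability Omega R) (T : R) (B : R -> 'I_K -> {RV P >-> R})
    (BB : Omega -> R -> R -> 'M[R]_K) (theta : 'I_K -> R)
    (u : R -> 'rV[R]_d -> 'rV[R]_d) (sigma : 'I_K -> 'rV[R]_d -> 'rV[R]_d)
    (y : Omega -> R -> 'rV[R]_d) (f : 'I_M -> 'rV[R]_d -> R),
  0 < T ->
  is_fBm T H B ->
  is_rough_lift T H B BB ->
  (forall k, 0 <= theta k) ->
  is_pathwise_solution T H B BB theta u sigma y ->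
  (forall m, Cn 2 (f m)) ->
  {ae P, forall w, row_free (X_mx T sigma f (y w))^T} ->
  {ae P, forall w, Y_vec T H f (y w) != 0} ->
  let beta : 'cV[R]_K := \col_k theta k ^+ 2 in
  {ae P, forall w, exists n0 : nat, forall n, (n0 <= n)%N ->
     [/\ hurst_est_defined T (y w) n,
         exists! b, is_argmin (Xn_mx T sigma f (y w) n)
                              (Ybar_vec T f (y w) n) b
       & forall b, is_argmin (Xn_mx T sigma f (y w) n)
                             (Ybar_vec T f (y w) n) b ->
         fnorm (beta - b)
         <= const_at C1 T (H - eps) theta sigma f (sample_path B w) (y w)
            * (n%:R * delta_rate H n `^ (H - eps))]}
  /\
  (forall k, 0 < beta k 0 ->
   {ae P, forall w, exists n0 : nat, forall n, (n0 <= n)%N ->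
     [/\ hurst_est_defined T (y w) n,
         exists! b, is_argmin (Xn_mx T sigma f (y w) n)
                              (Ybar_vec T f (y w) n) b
       & forall b, is_argmin (Xn_mx T sigma f (y w) n)
                             (Ybar_vec T f (y w) n) b ->
         0 < b k 0 /\
         `|theta k - Num.sqrt (b k 0)|
         <= C2 (Num.max
                  (const_at C1 T (H - eps) theta sigma f (sample_path B w) (y w))
                  (beta k 0)^-1)
            * (n%:R * delta_rate H n `^ (H - eps))]}).
Proof.
have H01 : 0 < H < 1 by case/andP: hH; lra.
have [e0 eH] := andP heps.
(* The random n0 absorbs the path-dependent constants. *)
exists (fun _ _ _ _ _ _ => 1), (fun=> 1).
move=> disp Omega P T B BB theta u sigma y f T0 hB _ theta0 [cu Csig aey] Cf aeX aeY beta.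
pose r' := (1 - Num.max 2^-1 H) * (H - eps / 2).
have r'0 : 0 < r'.
  rewrite mulr_gt0//; last lra.
  by case/andP: hH => h1 h2; rewrite subr_gt0 gt_max h2 andbT; lra.
have rE : (1 - Num.max 2^-1 H) * (H - eps / 4) < Num.max 2^-1 H * (1 - Num.max 2^-1 H).
  have /andP[h1 h2] := Hmax_itv H H01.
  rewrite mulrC ltr_pM2r ?subr_gt0//; have : H <= Num.max 2^-1 H by rewrite le_max lexx orbT.
  lra.
have main : {ae P, forall w, exists2 e : nat -> R, decays r' e & \forall n \near \oo,
    [/\ hurst_est_defined T (y w) n,
        exists! b, is_argmin (Xn_mx T sigma f (y w) n) (Ybar_vec T f (y w) n) b
      & forall b, is_argmin (Xn_mx T sigma f (y w) n) (Ybar_vec T f (y w) n) b ->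
        fnorm (beta - b) <= e n]}.
  have aeB := fBm_covariation_rate P K T H T0 H01 B hB _ rE.
  have [_ _ _ aeh] := hB.
  near=> w; apply: (estimator_rate T H eps theta u sigma f (y w) (sample_path B w)).
  - exact: T0.
  - exact: hH.
  - exact: heps.
  - exact: cu.
  - exact: Csig.
  - exact: Cf.
  - have h : forall a, admissible H a ->
        [/\ (holder2_mx T a (delta (y w)) < +oo)%E,
            (holder2_mx T (2 * a) (remainder1 u (scaled_vf theta sigma) (sample_path B w) (y w)) < +oo)%E
          & H <= 2^-1 -> (holder2_mx T (3 * a)
               (remainder2 u (scaled_vf theta sigma) (sample_path B w) (BB w) (y w)) < +oo)%E].
      by near: w.
    by move=> a /h[].
  - have h : forall a, admissible H a ->
        [/\ (holder2_mx T a (delta (y w)) < +oo)%E,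
            (holder2_mx T (2 * a) (remainder1 u (scaled_vf theta sigma) (sample_path B w) (y w)) < +oo)%E
          & H <= 2^-1 -> (holder2_mx T (3 * a)
               (remainder2 u (scaled_vf theta sigma) (sample_path B w) (BB w) (y w)) < +oo)%E].
      by near: w.
    by move=> a /h[].
  - by near: w.
  - move=> k l; have -> : (fun t => sample_path B w t 0 k) = (fun t => B t k w).
      by apply/funext => t; rewrite mxE.
    have -> : (fun t => sample_path B w t 0 l) = (fun t => B t l w).
      by apply/funext => t; rewrite mxE.
    by move: k l; near: w.
  - by near: w.
  - by near: w.
split.
  apply: filterS main => w [e he [n0 _ hn0]].
  have [n1 _ hn1] := rate_absorbs _ _ _ hH heps he.
  exists (maxn n0 n1) => n; rewrite geq_max => /andP[n0n n1n].
  have [h1 h2 h3] := hn0 n n0n; split => // b hb.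
  rewrite /const_at mul1r (le_trans (h3 b hb))// (le_trans (ler_norm _))//.
  exact: hn1.
move=> k bk; have tk : 0 < theta k.
  rewrite lt_neqAle theta0 andbT eq_sym; apply: contraTneq bk => tk0.
  by rewrite mxE tk0 expr0n ltxx.
apply: filterS main => w [e he [n0 _ hn0]].
have [n1 _ hn1] := rate_absorbs _ _ _ hH heps (decaysZ _ _ (theta k)^-1 he).
have [n2 _ hn2] := (cvgr0Pnorm_lt _).1 (decays_cvg0 _ _ r'0 he) _ bk.
exists (maxn n0 (maxn n1 n2)) => n; rewrite !geq_max => /and3P[n0n n1n n2n].
have [h1 h2 h3] := hn0 n n0n; split => // b hb.
have bb : `|beta k 0 - b k 0| <= e n.
  apply: le_trans (h3 b hb); rewrite fnorm_cvE.
  have -> : beta k 0 - b k 0 = (beta - b) k 0 by rewrite !mxE.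
  rewrite -sqrtr_sqr ler_wsqrtr// /sqnorm (bigD1 k)//= lerDl.
  by apply: sumr_ge0 => i _; exact: sqr_ge0.
have en : e n < beta k 0 by apply: le_lt_trans (ler_norm _) (hn2 n n2n).
have b0 : 0 < b k 0 by have := le_lt_trans (ler_norm _) (le_lt_trans bb en); lra.
split => //.
(* The square root is Lipschitz away from 0. *)
have s0 : 0 <= Num.sqrt (b k 0) by exact: sqrtr_ge0.
have fact : (theta k - Num.sqrt (b k 0)) * (theta k + Num.sqrt (b k 0)) = beta k 0 - b k 0.
  by rewrite -subr_sqr sqr_sqrtr ?(ltW b0)// mxE.
rewrite mul1r; apply: le_trans (hn1 n n1n); apply: le_trans (ler_norm _).
rewrite ler_pdivlMl// mulrC; apply: le_trans bb.
rewrite -fact normrM ler_wpM2l// ger0_norm; last by rewrite addr_ge0// ltW.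
by rewrite lerDl.
Unshelve. all: by end_near. Qed.
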